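(* There are constants $d_0$ and $C$ such that for every integer $d \geq d_0$, \[ \lambda(d) \leq C d^{-1/4} (\log d)^2 . \]
   Context: $\mathbb{Z}^d$ also denotes the nearest-neighbor graph on the vertex set $\mathbb{Z}^d$: two vertices are adjacent iff their $L^1$-distance is $1$. $\log$ is the natural logarithm. For a graph with vertex set $V$ (countable, locally finite), a configuration $\omega \in \{0,1\}^V$ (or in $\{0,1\}^{W}$ for $W\subseteq V$) is feasible if no two adjacent vertices $v_1,v_2$ satisfy $\omega(v_1)=\omega(v_2)=1$. Let $\lambda > 0$. A hard-core measure with activity $\lambda$ on an infinite graph is a probability measure $\mu$ on $\{0,1\}^V$ such that for each finite $W \subseteq V$, every $\omega_1 \in \{0,1\}^W$, and $\mu$-a.e. $\omega_2 \in \{0,1\}^{V\setminus W}$, \[ \mu\bigl(\omega|_W = \omega_1 \,\big|\, \omega|_{V\setminus W} = \omega_2\bigr) = \begin{cases} Z_W^{-1}\prod_{v\in W}\lambda^{\omega_1(v)} & \text{if } \omega_1\sqcup\omega_2 \text{ is feasible},\\ 0 & \text{otherwise},\end{cases} \] where $\omega_1 \sqcup \omega_2$ is the configuration on $V$ agreeing with $\omega_1$ on $W$ and with $\omega_2$ on $V\setminus W$, and $Z_W$ (depending on $W$ and $\omega_2$) is the normalizing constant. $\lambda(d)$ is defined as the supremum of those $\lambda>0$ for which there is a unique hard-core measure with activity $\lambda$ on the graph $\mathbb{Z}^d$. *)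

(* Defs.v *)
From HB Require Import structures.
From mathcomp Require Import all_boot all_order all_algebra.
From mathcomp Require Import finmap.
From mathcomp Require Import all_classical all_reals all_analysis.

Set Implicit Arguments.
Unset Strict Implicit.
Unset Printing Implicit Defensive.

Import Order.TTheory GRing.Theory Num.Theory.
Import numFieldNormedType.Exports.

Local Open Scope classical_set_scope.
Local Open Scope ring_scope.

Definition cylinders (V : Type) (S : set V) : set (set (V -> bool)) :=
  [set [set omega : V -> bool | omega v] | v in S].

(* {0,1}^V with the product sigma-algebra. *)
Definition config (V : countType) := g_sigma_algebraType (cylinders [set: V]).

(* The sub-sigma-algebra of {0,1}^V generated by the restriction
   omega |-> omega|_S. *)
Definition sigma_on (V : countType) (S : set V) : set (set (config V)) :=
  <<s cylinders S >>.

(* g is a version of the conditional probability mu(E | F). *)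
Definition cond_prob_version (d : measure_display) (T : measurableType d)
    (R : realType) (mu : probability T R) (F : set (set T)) (E : set T)
    (g : T -> R) : Prop :=
  [/\ forall B : set R, measurable B -> F (g @^-1` B),
      mu.-integrable [set: T] (EFin \o g)
    & forall A : set T, F A -> (mu (E `&` A) = \int[mu]_(x in A) (g x)%:E)%E].

Section HardCore.
Variables (V : countType) (adj : rel V).

Definition feasible (omega : V -> bool) : Prop :=
  forall v1 v2 : V, adj v1 v2 -> ~~ (omega v1 && omega v2).

(* The configuration omega1 |_| omega2. A configuration on the complement of W
   is represented by any extension omega2 of it to V: the values of omega2 on W
   are ignored. *)
Definition join_config (W : {fset V}) (omega1 : {ffun W -> bool})
    (omega2 : V -> bool) : V -> bool :=
  fun v => if insub v is Some w then omega1 w else omega2 v.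

Variables (R : realType) (lambda : R).

Definition weight (W : {fset V}) (omega1 : {ffun W -> bool}) : R :=
  \prod_(v : W) lambda ^+ omega1 v.

Definition partition_function (W : {fset V}) (omega2 : V -> bool) : R :=
  \sum_(omega1 : {ffun W -> bool} | `[< feasible (join_config omega1 omega2) >])
    weight omega1.

Definition hard_core_kernel (W : {fset V}) (omega1 : {ffun W -> bool})
    (omega2 : V -> bool) : R :=
  if `[< feasible (join_config omega1 omega2) >]
  then (partition_function W omega2)^-1 * weight omega1 else 0.

Definition restricts_to (W : {fset V}) (omega1 : {ffun W -> bool}) :
    set (config V) :=
  [set omega | forall v : W, omega (val v) = omega1 v].

(* A conditional probability is only defined up to a null set, hence the
   choice of a version g. *)
Definition hard_core_measure (mu : probability (config V) R) : Prop :=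
  forall (W : {fset V}) (omega1 : {ffun W -> bool}),
    exists2 g : config V -> R,
      cond_prob_version mu (sigma_on [set v | v \notin W])
        (restricts_to omega1) g
      & {ae mu, forall omega, g omega = hard_core_kernel omega1 omega}.

(* Measures are identified when they agree on measurable sets, since the
   underlying function of a measure is total on [set (config V)]. *)
Definition unique_hard_core_measure : Prop :=
  exists2 mu : probability (config V) R, hard_core_measure mu
    & forall nu : probability (config V) R, hard_core_measure nu ->
        forall A : set (config V), measurable A -> nu A = mu A.

End HardCore.

Definition Zd_adj (d : nat) : rel 'rV[int]_d :=
  fun x y => \sum_(i < d) `|x 0 i - y 0 i| == 1.

(* The supremum is taken in the extended reals, so that it is +oo, not a junk
   value, if the set is unbounded. *)
Definition critical_activity (R : realType) (d : nat) : \bar R :=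
  ereal_sup [set lambda%:E | lambda in
    [set lambda : R | 0 < lambda /\
       unique_hard_core_measure (@Zd_adj d) lambda]].

(* Main.v *)
(* Put L = log d, and let lambda exceed d^(-1/4) L^2. In a box whose even outer
   sites are occupied, a Peierls argument shows that an odd site u is occupied with
   probability at most d^-2. An occupied u is enclosed by a contour, the boundary
   of a set W of sites whose boundary edges all join an even site inside to an odd
   site outside; W has t more even than odd sites, and t >= d. Translating the
   configuration inside W by one step frees t even sites, which gains a factor
   (1 + lambda)^t, but there are too many contours for a union bound. With r the
   integer part of sqrt d, W is therefore determined only up to an approximation
   (F, S), F inside the even part and S containing the odd part, and greedy covers
   by few sites show that exp (O (t L^2 / r)) pairs suffice. Either S has so many
   sites less than the even part of W that the translation gains enough for the
   pair, or the even part of W is F up to few sites and can be enumerated. This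
   works since min (lambda, 1)^2 r is much larger than L^3.

   An ultrafilter limit of the finite-volume laws is a finitely additive function;
   restricted to cylinder events it defines a probability measure, which satisfies
   the conditional probability equations because these involve finitely many
   sites. For the boundary condition with even sites occupied, the origin is
   occupied with probability at least lambda / (1 + lambda) (1 - 2 / d); for the
   opposite one, with probability at most d^-2. So there are two measures. *)
Require Import Defs.
From HB Require Import structures.
From mathcomp Require Import all_boot all_order all_algebra.
From mathcomp Require Import finmap zify ring lra.
From mathcomp Require Import all_classical all_reals all_analysis.
From mathcomp Require Import measurable_realfun.

Set Implicit Arguments.
Unset Strict Implicit.
Unset Printing Implicit Defensive.

Import Order.TTheory GRing.Theory Num.Theory.
Import numFieldNormedType.Exports.

Local Open Scope fset_scope.
Local Open Scope ring_scope.

(** * Walks in the lattice *)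

(** The exponent 1/4 is the balance of two cases. Put q = t L^2 / r and c = mu / (8 L), where mu is
    lambda cut off at 1. Listing the pairs (F, S) costs exp (4000 q). If S has over c t sites less
    than the even part of W, the translation gains exp (mu^2 t / (16 L)). If not, at most about c t
    even sites are unknown; naming each costs a factor d, in all exp (mu t / 8), paid from the full
    gain exp (mu t / 2). The first case is the tight one: mu^2 / L must exceed a multiple of L^2 /
    r, which for r near sqrt d means mu above a multiple of d^(-1/4) L^(3/2). The spare L^(1/2)
    absorbs the multiple, so C = 1 works for large d. The size of r balances the covers: greedy
    choices take about t L / r sites, the remaining cases about t r / d. The obstacle in the
    transfer is that a translated configuration does not show which of its even sites were odd
    before. For the sites of [shift s0 S] outside [F] this has to be recorded, a factor 2 per site,
    so the approximation must leave only O (t / r) of them in some direction. *)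

Lemma card_fset_count (T : choiceType) (A : {fset T}) (P : pred T) :
  #|` [fset x in A | P x]| = count P A.
Proof.
rewrite -size_filter; apply/perm_size/uniq_perm; rewrite ?filter_uniq ?fset_uniq //.
by move=> x; rewrite mem_filter !inE andbC.
Qed.

Section Graph.
Variable d : nat.
Local Notation V := 'rV[int]_d.
Local Notation D := ('I_d * bool)%type.

Definition stp (s : D) : V := (-1) ^+ s.2 *: delta_mx 0 s.1.
Definition opp (s : D) : D := (s.1, ~~ s.2).

Lemma oppK : involutive opp.
Proof. by case=> i b; rewrite /opp /= negbK. Qed.

Lemma stpN s : stp (opp s) = - stp s.
Proof. by rewrite /stp /opp /=; case: s.2; rewrite /= ?expr0 ?expr1 ?scale1r ?scaleN1r ?opprK. Qed.

Lemma card_dir : #|{: D}| = (2 * d)%N.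
Proof. by rewrite card_prod card_ord card_bool mulnC. Qed.

Definition nb (P : pred V) (x : V) : nat := #|[pred s : D | P (x + stp s)]|.

Definition Nb (A : {fset V}) : {fset V} :=
  seq_fset tt [seq x + stp s | x <- A, s <- enum {: D}].

Lemma in_Nb A y : (y \in Nb A) = [exists s, y + stp s \in A].
Proof.
rewrite seq_fsetE; apply/allpairsP/existsP => [[[x s] /= [xA _ ->]]|[s ysA]].
  by exists (opp s); rewrite stpN addrK.
by exists (y + stp s, opp s); rewrite /= mem_enum stpN addrK.
Qed.

Lemma mem_Nb A x s : x \in A -> x + stp s \in Nb A.
Proof.
by move=> xA; rewrite in_Nb; apply/existsP; exists (opp s); rewrite stpN addrK.
Qed.

Lemma card_Nb A : (#|` Nb A| <= #|` A| * (2 * d))%N.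
Proof.
rewrite size_seq_fset (leq_trans (size_undup _)) //.
by rewrite size_allpairs -cardE card_dir.
Qed.

Lemma nbE (P : pred V) x : nb P x = (\sum_(s : D) P (x + stp s)%R)%N.
Proof. by rewrite /nb -sum1_card big_mkcond /=; apply: eq_bigr => s _; rewrite inE; case: (P _). Qed.

Lemma nb_le (P : pred V) x : (nb P x <= (2 * d))%N.
Proof. by rewrite -card_dir max_card. Qed.

Lemma nb_sub (P Q : pred V) x : (forall s, P (x + stp s) -> Q (x + stp s)) ->
  (nb P x <= nb Q x)%N.
Proof. by move=> PQ; apply/subset_leq_card/fintype.subsetP => s; apply: PQ. Qed.

Lemma nbC (P : pred V) x : (nb P x + nb (predC P) x = 2 * d)%N.
Proof. by rewrite -card_dir; exact: (cardC [pred s : D | P (x + stp s)]). Qed.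

Lemma nb_gt0P (P : pred V) x : reflect (exists s, P (x + stp s)) (0 < nb P x)%N.
Proof.
apply: (iffP card_gt0P) => [[s]|[s Ps]]; first by exists s.
by exists s.
Qed.

Lemma nbU (P Q : pred V) x : (nb (fun y => P y || Q y) x <= nb P x + nb Q x)%N.
Proof.
rewrite !nbE -big_split /=; apply: leq_sum => s _.
by case: (P (x + stp s)); case: (Q (x + stp s)).
Qed.

(** Double counting of the edges between [A] and [B]: translation by a direction matches the pairs
    counted on one side with those counted on the other for the opposite direction. *)
Lemma nb_swap (A B : {fset V}) :
  (\sum_(x <- A) nb (mem B) x = \sum_(y <- B) nb (mem A) y)%N.
Proof.
under eq_bigr do rewrite nbE.
under [RHS]eq_bigr do rewrite nbE.
rewrite exchange_big /= [RHS]exchange_big /= (reindex_inj (inv_inj oppK)) /=.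
apply: eq_bigr => s _.
have sumcount (C : {fset V}) (P : pred V) :
    (\sum_(x <- C) P x = #|` [fset x in C | P x]|)%N.
  by rewrite card_fset_count -sum1_count [RHS]big_mkcond; apply: eq_bigr => x _; case: (P x).
rewrite (sumcount A (fun x => x + stp (opp s) \in B)).
rewrite (sumcount B (fun x => x + stp s \in A)).
transitivity #|` [fset x + stp (opp s) |
    x in [fset x in A | x + stp (opp s) \in B]]|.
  by apply/esym/card_imfset; exact: addIr.
congr (#|` _|).
apply/fsetP => y; rewrite !inE; apply/imfsetP/andP => /= [[x]|[yB yA]].
  by rewrite !inE => /andP[xA xB] ->; rewrite xB stpN subrK.
by exists (y + stp s); rewrite ?inE ?yA /= stpN addrK.
Qed.

Lemma sum_fset_ge (A : {fset V}) (f : V -> nat) k :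
  (forall x, x \in A -> f x <= k)%N -> (\sum_(x <- A) f x <= #|` A| * k)%N.
Proof.
move=> kf; rewrite -sum1_size big_distrl /= big_seq_cond [leqRHS]big_seq_cond.
by apply: leq_sum => x /andP[xA _]; rewrite mul1n; apply: kf.
Qed.

Lemma sum_fset_subset (A B : {fset V}) (f : V -> nat) : A `<=` B ->
  (\sum_(x <- A) f x <= \sum_(x <- B) f x)%N.
Proof.
move=> AB; rewrite [leqRHS](big_fsetID _ (mem A)) /=.
have -> : [fset x in B | x \in A] = A.
  apply/fsetP => x; rewrite !inE andbC; case xA: (x \in A) => //=.
  by rewrite (fsubsetP AB).
exact: leq_addr.
Qed.

Fixpoint inwalk (P : pred V) (x : V) (l : seq D) : bool :=
  P x && (if l is s :: l' then inwalk P (x + stp s) l' else true).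

Definition endp (x : V) (l : seq D) : V := x + \sum_(s <- l) stp s.

Definition reach (P : pred V) (x y : V) : Prop :=
  exists2 l, inwalk P x l & endp x l = y.

Lemma endp_cons x s l : endp x (s :: l) = endp (x + stp s) l.
Proof. by rewrite /endp big_cons addrA. Qed.

Lemma endp_cat x l l' : endp x (l ++ l') = endp (endp x l) l'.
Proof. by rewrite /endp big_cat /= addrA. Qed.

Lemma endp_nil x : endp x [::] = x.
Proof. by rewrite /endp big_nil addr0. Qed.

Lemma inwalk_cat (P : pred V) x l l' :
  inwalk P x (l ++ l') = inwalk P x l && inwalk P (endp x l) l'.
Proof.
elim: l x => [|s l IH] x; first by rewrite endp_nil /= andbT; case: l' => /= *; case: (P x).
by rewrite /= IH endp_cons andbA.
Qed.

Lemma inwalk_start (P : pred V) x l : inwalk P x l -> P x.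
Proof. by case: l => [|s l] /= /andP[]. Qed.

Lemma inwalk_end (P : pred V) x l : inwalk P x l -> P (endp x l).
Proof.
elim: l x => [|s l IH] x /=; first by rewrite andbT endp_nil.
by move=> /andP[_ /IH]; rewrite endp_cons.
Qed.

Lemma reach_refl (P : pred V) x : P x -> reach P x x.
Proof. by move=> Px; exists [::]; rewrite /= ?Px ?endp_nil. Qed.

Lemma reach_trans (P : pred V) x y z : reach P x y -> reach P y z -> reach P x z.
Proof.
move=> [l w1 <-] [l' w2 <-]; exists (l ++ l'); last exact: endp_cat.
by rewrite inwalk_cat w1.
Qed.

Lemma reach_step (P : pred V) x s : P x -> P (x + stp s) -> reach P x (x + stp s).
Proof. by move=> px ps; exists [:: s]; rewrite ?endp_cons ?endp_nil //= px ps. Qed.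

Lemma reach_start (P : pred V) x y : reach P x y -> P x.
Proof. by move=> [l /inwalk_start]. Qed.

Lemma reach_end (P : pred V) x y : reach P x y -> P y.
Proof. by move=> [l /inwalk_end + <-]. Qed.

Lemma reach_sym (P : pred V) x y : reach P x y -> reach P y x.
Proof.
move=> [l + <-]; elim: l x => [|s l IH] x /=.
  by rewrite andbT endp_nil; exact: reach_refl.
move=> /andP[px /[dup] /inwalk_start ps /IH]; rewrite endp_cons => rl.
apply: reach_trans rl _; rewrite -{2}[x](addrK (stp s)) -stpN.
by apply: reach_step => //; rewrite stpN addrK.
Qed.

Lemma reach_sub (P Q : pred V) x y : (forall z, P z -> Q z) ->
  reach P x y -> reach Q x y.
Proof.
move=> PQ [l w <-]; exists l => //; elim: l x w => [|s l IH] x /=.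
  by rewrite !andbT => /PQ.
by move=> /andP[/PQ -> /IH].
Qed.

Lemma reach_ind (P : pred V) (Q : V -> Prop) x y :
  Q x -> (forall z s, Q z -> P z -> P (z + stp s) -> Q (z + stp s)) ->
  reach P x y -> Q y.
Proof.
move=> + st [l + <-]; elim: l x => [|s l IH] x Qx /=; first by rewrite endp_nil.
move=> /andP[px w]; rewrite endp_cons; apply: IH => //.
by apply: st => //; apply: inwalk_start w.
Qed.

End Graph.

(** * Shifting the inside of a contour *)

Section Sums.
Variables (R : realFieldType).

Lemma ler_sum_inj (T T' : eqType) (s : seq T) (s' : seq T') (f : T -> T')
    (F : T' -> R) :
  uniq s -> uniq s' -> {in s &, injective f} -> {subset map f s <= s'} ->
  (forall y, 0 <= F y) ->
  \sum_(x <- s) F (f x) <= \sum_(y <- s') F y.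
Proof.
move=> us us' fI sub F0; rewrite -(big_map f xpredT).
rewrite [leRHS](bigID (mem (map f s))) /= -[X in _ <= X + _]big_filter.
have -> : \sum_(y <- map f s) F y =
    \sum_(y <- [seq y <- s' | y \in map f s]) F y.
  apply/perm_big/uniq_perm; rewrite ?map_inj_in_uniq ?filter_uniq // => y.
  by rewrite mem_filter; case: (boolP (y \in map f s)) => //= /sub ->.
by rewrite lerDl sumr_ge0.
Qed.

Lemma sum_fpowersetU1 (T : choiceType) (a : T) (A : {fset T}) (g : {fset T} -> R) :
  a \notin A -> \sum_(X <- fpowerset (a |` A)) g X =
  \sum_(X <- fpowerset A) (g X + g (a |` X)).
Proof.
move=> aA; rewrite (big_fsetID _ (fun X : {fset T} => a \in X)) /= addrC big_split /=.
congr (_ + _).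
  apply: eq_fbigl => X; rewrite !inE /= !fpowersetE; apply/andP/idP.
    move=> [/fsubsetP XaA aX]; apply/fsubsetP => x xX.
    have := XaA _ xX; rewrite !inE => /orP[/eqP xa|//].
    by move: xX aX; rewrite xa => ->.
  move=> XA; split; first by apply: fsubset_trans XA (fsubsetUr _ _).
  by apply: contra aA => /(fsubsetP XA).
have -> : [fset x in fpowerset (a |` A) | a \in x] =
    [fset a |` X | X in fpowerset A].
  apply/fsetP => X; rewrite !inE /=; apply/andP/imfsetP => /=.
    move=> [XA aX]; exists (X `\ a); last by rewrite fsetD1K.
    by rewrite fpowersetE fsubDset -fpowersetE.
  move=> [Y]; rewrite !fpowersetE => YA ->; split; last exact: fset1U1.
  exact: fsetUS.
rewrite big_imfset //= => X Y; rewrite !fpowersetE => XA YA XY.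
have aN Z : Z `<=` A -> (a |` Z) `\ a = Z.
  by move=> ZA; apply: fsetU1K; apply: contra aA => /(fsubsetP ZA).
by rewrite -(aN _ XA) XY aN.
Qed.

Lemma sum_fpowerset_expr (T : choiceType) (A : {fset T}) (x : R) :
  \sum_(X <- fpowerset A) x ^+ #|` X| = (1 + x) ^+ #|` A|.
Proof.
elim/finSet_rect: A => A IH; have [->|/fset0Pn[a aA]] := eqVneq A fset0.
  by rewrite fpowerset0 big_seq_fset1 cardfs0 !expr0.
rewrite -{1}(fsetD1K aA) sum_fpowersetU1 ?fsetD11 //.
rewrite [#|` A|](cardfsD1 a) aA add1n exprS -IH ?fproperD1 // mulr_sumr.
rewrite big_seq_cond [RHS]big_seq_cond; apply: eq_bigr => X /andP[].
rewrite fpowersetE => XA _; rewrite cardfsU1.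
have -> : a \notin X by apply/negP => /(fsubsetP XA); rewrite fsetD11.
by rewrite add1n exprS mulrDl mul1r.
Qed.

End Sums.

Section Transfer.
Variable d : nat.
Local Notation V := 'rV[int]_d.
Local Notation D := ('I_d * bool)%type.
Variable par : pred V.
Hypothesis par_stp : forall x s, par (x + stp s) = ~~ par x.
Variable Lam : {fset V}.

(* par is the parity of a site: outside of the volume Lam, the boundary condition
   occupies exactly the sites with par = true, which are called even. *)
Definition occ (I : {fset V}) : pred V :=
  fun v => if v \in Lam then v \in I else par v.

Definition admissible (I : {fset V}) : Prop :=
  forall x s, ~~ (occ I x && occ I (x + stp s)).

Definition evens (W : {fset V}) := [fset x in W | par x].
Definition odds (W : {fset V}) := [fset x in W | ~~ par x].

(* Boundary edges of W join an even site inside to an odd site outside. *)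
Definition interface (W : {fset V}) : Prop :=
  forall x s, (x \in W) != par x -> (x + stp s \in W) = (x \in W).

(** The last clause covers both ends of each boundary edge, since the edge can be read from either
    end. The vacant boundary is what lets the inside move independently of the outside. *)
Definition contour_of (I W : {fset V}) : Prop :=
  [/\ W `<=` Lam, interface W &
    forall x s, (x + stp s \in W) != (x \in W) -> ~~ occ I x].

Definition shift (s : D) (A : {fset V}) : {fset V} := [fset x + stp s | x in A].

Lemma mem_shift s A x : (x \in shift s A) = (x - stp s \in A).
Proof.
apply/imfsetP/idP => [[y /= yA ->]|xA]; first by rewrite addrK.
by exists (x - stp s); rewrite ?subrK.
Qed.

Lemma card_shift s A : #|` shift s A| = #|` A|.
Proof. by rewrite card_imfset //; exact: addIr. Qed.

Lemma par_stpB x s : par (x - stp s) = ~~ par x.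
Proof. by rewrite -stpN par_stp. Qed.

Variable s0 : D.

(* The Peierls map: translating the inside of the contour by one step turns odd
   sites into even ones and makes room for an arbitrary set X of even sites. *)
Definition moved (I W X : {fset V}) : {fset V} :=
  (I `\` W) `|` shift s0 (I `&` W) `|` X.

Section Moved.
Variables I W X : {fset V}.
Hypotheses (IL : I `<=` Lam) (admI : admissible I) (cW : contour_of I W).
Hypothesis (XE : X `<=` evens W `\` shift s0 (odds W)).

Let WL : W `<=` Lam. Proof. by case: cW. Qed.

Lemma occ_boundary x y s : (x \in W) != (y \in W) -> y = x + stp s -> x \notin I.
Proof.
case: cW => _ _ bd xy yE; apply/negP => xI.
have := bd x s; rewrite -yE eq_sym => /(_ xy).
by rewrite /occ (fsubsetP IL _ xI) xI.
Qed.

Lemma shift_in x : x \in I -> x \in W -> x + stp s0 \in W.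
Proof.
move=> xI xW; apply/negPn/negP => nW.
by have := @occ_boundary x _ s0 _ erefl; rewrite xW (negPf nW) xI => /(_ isT).
Qed.

Lemma X_in x : x \in X -> [/\ x \in W, par x & x - stp s0 \notin W].
Proof.
move=> /(fsubsetP XE); rewrite !inE mem_shift !inE par_stpB => /andP[+ /andP[-> px]].
by rewrite px andbT.
Qed.

Lemma mem_moved x :
  (x \in moved I W X) = if x \in W then (x - stp s0 \in I `&` W) || (x \in X)
                        else x \in I.
Proof.
rewrite /moved !in_fsetU in_fsetD mem_shift; case: ifP => [xW|xW] //=.
have -> : x \in X = false by apply/negbTE/negP => /X_in[]; rewrite xW.
have -> : x - stp s0 \in I `&` W = false.
  by apply/negbTE; rewrite inE; apply/negP => /andP[/shift_in h /h]; rewrite subrK xW.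
by rewrite !orbF.
Qed.

Lemma moved_sub : moved I W X `<=` Lam.
Proof.
apply/fsubsetP => x; rewrite mem_moved; case: ifP => [xW _|_]; last exact: (fsubsetP IL).
exact: (fsubsetP WL).
Qed.

Lemma occ_moved x : occ (moved I W X) x =
  if x \in W then (x - stp s0 \in I `&` W) || (x \in X) else occ I x.
Proof.
rewrite /occ mem_moved; case: ifP => xL //; case: ifP => xW //.
by rewrite (fsubsetP WL) in xL.
Qed.

(** Inside [W], an occupied translate next to a site [z] of [X] would pull back to an occupied site
    of [W] adjacent to [z - stp s0], which lies outside [W], against the vacancy of boundary edges.
    Two sites of [X] have equal parity. Across the boundary the outer end is vacant already. *)
Lemma moved_adm : admissible (moved I W X).
Proof.
have occI y : y \in I -> occ I y by move=> yI; rewrite /occ (fsubsetP IL _ yI).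
case: (cW) => _ _ bd; move=> x s; rewrite !occ_moved.
have key y z : z \in X -> y - stp s0 \in I -> y - stp s0 \in W ->
    (exists s', z = y + stp s') -> False.
  move=> zX yI yW [s' zE]; have [_ _ zW] := X_in zX.
  have := @occ_boundary (y - stp s0) (z - stp s0) s'.
  by rewrite yW (negPf zW) yI zE addrAC => /(_ isT erefl).
apply/negP; case: ifP => xW; case: ifP => yW /andP[].
- case/orP => [xI'|xX] /orP[yI'|yX].
  + move: xI' yI'; rewrite !inE => /andP[xI _] /andP[yI _]; have := admI (x - stp s0) s.
    by rewrite addrAC (occI _ xI) (occI _ yI).
  + by move: xI'; rewrite inE => /andP[xI xW']; apply: (key x _ yX xI xW'); exists s.
  + move: yI'; rewrite inE => /andP[yI yW']; apply: (key _ x xX yI yW').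
    by exists (opp s); rewrite stpN addrK.
  + by have [_ px _] := X_in xX; have [_ + _] := X_in yX; rewrite par_stp px.
- move=> _; apply/negP; apply: (bd _ (opp s)).
  by rewrite stpN addrK xW yW.
- by move=> + _; apply/negP; apply: (bd _ s); rewrite xW yW.
- by move=> ox oy; have := admI x s; rewrite ox oy.
Qed.

Lemma card_moved : #|` moved I W X| = (#|` I| + #|` X|)%N.
Proof.
rewrite /moved !cardfsU card_shift.
have -> : (I `\` W) `&` shift s0 (I `&` W) = fset0.
  apply/eqP; rewrite fsetI_eq0; apply/fdisjointP => x.
  rewrite !inE mem_shift inE => /andP[xW xI]; apply/negP => /andP[/shift_in h /h].
  by rewrite subrK (negPf xW).
have -> : (I `\` W `|` shift s0 (I `&` W)) `&` X = fset0.
  apply/eqP; rewrite fsetI_eq0; apply/fdisjointP => x.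
  rewrite !inE mem_shift inE => h; apply/negP => /X_in[xW _ nW].
  by move: h; rewrite xW (negPf nW) andbF.
by have := cardfsID W I; rewrite cardfs0; lia.
Qed.

End Moved.

(** Decoding. On [shift s0 S], a translated occupied odd site is visible in [moved] if it lies in
    [F], because [X] avoids [shift s0 S]; otherwise [key] stores it. This recovers the occupied odd
    sites inside, hence [W] by assumption, then [X] as the part of [moved] in the even sites off
    [shift s0 S], and finally [I] by translating back. *)
Lemma moved_inj (I1 W1 X1 I2 W2 X2 F S : {fset V}) :
  let C I W X := [/\ I `<=` Lam, contour_of I W, F `<=` evens W,
    odds W `<=` S & X `<=` evens W `\` shift s0 S] in
  let key I W := shift s0 (I `&` odds W) `&` (shift s0 S `\` F) in
  C I1 W1 X1 -> C I2 W2 X2 ->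
  (I1 `&` odds W1 = I2 `&` odds W2 -> W1 = W2) ->
  moved I1 W1 X1 = moved I2 W2 X2 -> key I1 W1 = key I2 W2 ->
  I1 = I2 /\ X1 = X2.
Proof.
move=> C key C1 C2 Wdet JJ KK.
have XE I W X : C I W X -> X `<=` evens W `\` shift s0 (odds W).
  move=> [_ _ _ OS XE]; apply: (fsubset_trans XE); apply: fsetDS.
  by apply/fsubsetP => x; rewrite !mem_shift => /(fsubsetP OS).
have mm I W X : C I W X -> forall x, x \in W -> (x \in moved I W X) =
    (x - stp s0 \in I `&` W) || (x \in X).
  by move=> /[dup] c [IL cW _ _ _] x xW; rewrite (mem_moved IL cW (XE _ _ _ c)) xW.
have PP I W X : C I W X -> forall y, (y \in shift s0 (I `&` odds W)) =
    (y \in shift s0 S) && ((y \in F) && (y \in moved I W X) || (y \in key I W)).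
  move=> /[dup] c [IL cW FE OS XS] y.
  case yS: (y \in shift s0 S); last first.
    apply/negbTE; rewrite mem_shift; apply/negP; rewrite inE => /andP[_ /(fsubsetP OS)].
    by rewrite -mem_shift yS.
  rewrite [in RHS]/key in_fsetI in_fsetD yS andbT /=.
  case yF: (y \in F) => /=; last by rewrite andbT.
  have := fsubsetP FE _ yF; rewrite inE /= => /andP[yW py].
  rewrite andbF orbF (mm _ _ _ c _ yW).
  have -> : y \in X = false.
    by apply/negbTE/negP => /(fsubsetP XS); rewrite in_fsetD yS.
  by rewrite mem_shift !inE par_stpB py !andbT orbF.
have EO : I1 `&` odds W1 = I2 `&` odds W2.
  apply/fsetP => x; rewrite -[x](addrK (stp s0)) -!mem_shift.
  by rewrite (PP _ _ _ C1) (PP _ _ _ C2) JJ KK.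
have EW := Wdet EO; subst W2.
have XX : X1 = X2.
  have inX I X : C I W1 X -> forall x, (x \in X) =
      (x \in evens W1 `\` shift s0 S) && (x \in moved I W1 X).
    move=> /[dup] c [IL cW FE OS XS] x; apply/idP/andP.
      move=> xX; have xE := fsubsetP XS _ xX; split => //.
      have xW : x \in W1 by move: xE; rewrite !inE => /andP[_ /andP[]].
      by rewrite (mm _ _ _ c _ xW) xX orbT.
    case; rewrite in_fsetD inE /= => /andP[xS /andP[xW px]].
    rewrite (mm _ _ _ c _ xW) => /orP[|//]; rewrite inE => /andP[_ xsW].
    case/negP: xS; rewrite mem_shift; apply: (fsubsetP OS).
    by rewrite !inE xsW par_stpB px.
  by apply/fsetP => x; rewrite (inX _ _ C1) (inX _ _ C2) JJ.
split => //.
have inI I X : C I W1 X -> forall x, (x \in I) =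
    if x \in W1 then [&& x + stp s0 \in W1, x + stp s0 \in moved I W1 X
                       & x + stp s0 \notin X] else x \in moved I W1 X.
  move=> /[dup] c [IL cW FE OS XS] x; case: ifP => xW; last first.
    by rewrite (mem_moved IL cW (XE _ _ _ c)) xW.
  apply/idP/and3P => [xI|[xsW + xsX]].
    have xsW := shift_in IL cW xI xW.
    split => //; first by rewrite (mm _ _ _ c _ xsW) addrK inE xI xW.
    apply/negP => xX; have [_ _] := X_in (XE _ _ _ c) xX.
    by rewrite addrK xW.
  by rewrite (mm _ _ _ c _ xsW) (negPf xsX) orbF addrK inE => /andP[].
by apply/fsetP => x; rewrite (inI _ _ C1) (inI _ _ C2) JJ XX.
Qed.

Variable R : realFieldType.
Variable lam : R.
Hypothesis lam0 : 0 < lam.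

Definition wt (I : {fset V}) : R := lam ^+ #|` I|.
Definition Zsum : R := \sum_(J <- fpowerset Lam | `[< admissible J >]) wt J.

(** Weighted counting through the injection of ([I], [X]) to the pair of [moved] and key: the sum
    over [X] gives a factor [1 + lam] per freed site, and the key is a subset of [shift s0 S] minus
    [F]. Here [r] bounds the number of freed sites from below and is unrelated to sqrt d. *)
Lemma transfer (Is : seq {fset V}) (Wf : {fset V} -> {fset V}) (F S : {fset V}) (r : nat) :
  uniq Is ->
  (forall I, I \in Is -> [/\ I `<=` Lam, admissible I, contour_of I (Wf I),
     F `<=` evens (Wf I) & odds (Wf I) `<=` S] /\
     (r <= #|` evens (Wf I) `\` shift s0 S|)%N) ->
  {in Is &, forall I1 I2, I1 `&` odds (Wf I1) = I2 `&` odds (Wf I2) -> Wf I1 = Wf I2} ->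
  (1 + lam) ^+ r * \sum_(I <- Is) wt I <= 2 ^+ #|` shift s0 S `\` F| * Zsum.
Proof.
move=> uI HI Wdet.
pose Fr I := fpowerset (evens (Wf I) `\` shift s0 S).
pose K := shift s0 S `\` F.
pose s : seq ({fset V} * {fset V}) := [seq (A, X) | A <- Is, X <- enum_fset (Fr A)].
pose Js : seq {fset V} := [seq J <- enum_fset (fpowerset Lam) | `[< admissible J >]].
pose s' := [seq (J, Y) | J <- Js, Y <- enum_fset (fpowerset K)].
pose f (p : {fset V} * {fset V}) := (moved p.1 (Wf p.1) p.2,
  shift s0 (p.1 `&` odds (Wf p.1)) `&` K).
have sP I X : (I, X) \in s -> I \in Is /\ X `<=` evens (Wf I) `\` shift s0 S.
  case/allpairsPdep => I' [X' [I'Is X'F [-> ->]]]; split => //.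
  by rewrite -fpowersetE.
have L1 : (1 + lam) ^+ r * \sum_(I <- Is) wt I <= \sum_(p <- s) wt (f p).1.
  rewrite /s big_allpairs_dep /= mulr_sumr big_seq_cond [leRHS]big_seq_cond.
  apply: ler_sum => I /andP[IIs _]; have [[IL aI cI FE OS] rE] := HI _ IIs.
  rewrite (eq_big_seq (fun X : {fset V} => wt I * lam ^+ #|` X|)) => [|X].
    rewrite -mulr_sumr sum_fpowerset_expr mulrC ler_wpM2l ?exprn_ge0 ?(ltW lam0) //.
    by rewrite ler_weXn2l // lerDl ltW.
  rewrite fpowersetE => XS; rewrite /= /wt (@card_moved I (Wf I) X) ?exprD //.
  apply: (fsubset_trans XS); apply: fsetDS.
  by apply/fsubsetP => x; rewrite !mem_shift => /(fsubsetP OS).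
apply: (le_trans L1).
have us : uniq s.
  apply: allpairs_uniq_dep => //.
  by case=> I1 X1 [I2 X2] _ _ /=; case=> e1 e2; rewrite e1 e2.
have us' : uniq s'.
  apply: allpairs_uniq => //; first by rewrite filter_uniq ?fset_uniq.
  by case=> I1 X1 [I2 X2] _ _ /=; case=> e1 e2; rewrite e1 e2.
have := @ler_sum_inj R _ _ s s' f (fun q => wt q.1) us us'.
move=> /(_ _ _ _)/le_trans; apply.
- move=> [I1 X1] [I2 X2] /sP[I1s X1E] /sP[I2s X2E] [/= JJ KK].
  have [[IL1 _ cI1 FE1 OS1] _] := HI _ I1s; have [[IL2 _ cI2 FE2 OS2] _] := HI _ I2s.
  by have [-> ->] := @moved_inj I1 (Wf I1) X1 I2 (Wf I2) X2 F S
    (And5 IL1 cI1 FE1 OS1 X1E) (And5 IL2 cI2 FE2 OS2 X2E) (Wdet _ _ I1s I2s) JJ KK.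
- move=> _ /mapP[[I X] /sP[Is1 XS] ->]; have [[IL aI cI FE OS] _] := HI _ Is1.
  have XO : X `<=` evens (Wf I) `\` shift s0 (odds (Wf I)).
    apply: (fsubset_trans XS); apply: fsetDS.
    by apply/fsubsetP => x; rewrite !mem_shift => /(fsubsetP OS).
  apply/allpairsP; exists (f (I, X)); split => //=.
    rewrite mem_filter; apply/andP; split; first by apply/asboolP/moved_adm.
    by rewrite fpowersetE; apply: moved_sub.
  by rewrite fpowersetE fsubsetIr.
- by move=> q; rewrite exprn_ge0 // ltW.
rewrite /s' big_allpairs_dep /= big_filter mulr_sumr; apply: ler_sum => J _.
rewrite big_const_seq count_predT iter_addr_0 -[size _]/(#|` fpowerset K|) card_fpowerset.
by rewrite -[leLHS]mulr_natl natrX.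
Qed.

End Transfer.

(** * Geometry of contours *)

Section Degrees.
Variable d : nat.
Local Notation V := 'rV[int]_d.
Local Notation D := ('I_d * bool)%type.
Variable par : pred V.
Hypothesis par_stp : forall x s, par (x + stp s) = ~~ par x.

Lemma stp_coord (s : D) i : stp s 0 i = if i == s.1 then (-1) ^+ s.2 else 0.
Proof. by rewrite !mxE eqxx /=; case: eqP => _ /=; rewrite ?mulr1 ?mulr0. Qed.

Lemma stp_inj : injective (@stp d).
Proof.
move=> [i b] [j c] /rowP e.
have := e i; rewrite !stp_coord /= eqxx; case: eqP => [<-|_]; last by case: b {e}.
by case: b {e}; case: c.
Qed.

Section OneSet.
Variable W : {fset V}.
Hypothesis iW : interface par W.

Definition gd (x : V) : nat := nb (fun y => (y \in W) != (x \in W)) x.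

(** For an interface the truncated subtraction is harmless when [d > 0]: [sum_gd_evens] shows that
    even sites are at least as many as odd ones, and that there are [2 * d * excess] boundary edges,
    each having one inner even end. *)
Definition excess : nat := #|` evens par W| - #|` odds par W|.

Lemma interface_bdry x s : (x + stp s \in W) != (x \in W) -> (x \in W) = par x.
Proof. by move=> h; apply/eqP; apply: contraNT h => /iW ->. Qed.

Lemma gd_gt0P x : reflect (exists s, (x + stp s \in W) != (x \in W)) (0 < gd x)%N.
Proof. exact: nb_gt0P. Qed.

(** For each direction [f], one of the edges from [x] and from [x + stp e] along [f] is a boundary
    edge: if [x + stp f] is on the side of [x], its parity excludes boundary edges at it, so
    [x + stp e + stp f] is on that side too, opposite to [x + stp e]. *)
Lemma gd_pair x e : (x + stp e \in W) != (x \in W) ->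
  (2 * d <= gd x + gd (x + stp e))%N.
Proof.
move=> xe; rewrite /gd !nbE -big_split /= -card_dir -sum1_card.
apply: leq_sum => f _; have [xf|] := eqVneq (x + stp f \in W) (x \in W); last by [].
have -> : (x + stp e + stp f \in W) = (x \in W).
  rewrite addrAC iW xf // par_stp (interface_bdry xe).
  by case: (par x).
by rewrite eq_sym xe.
Qed.

Lemma sum_gd_evens :
  (\sum_(x <- evens par W) gd x + 2 * d * #|` odds par W| =
   2 * d * #|` evens par W|)%N.
Proof.
have <- : (\sum_(y <- odds par W) nb (mem (evens par W)) y =
          2 * d * #|` odds par W|)%N.
  rewrite mulnC -sum1_size big_distrl /=; apply: eq_big_seq => y.
  rewrite !inE mul1n => /andP[yW py].
  rewrite nbE -card_dir -sum1_card; apply: eq_bigr => s _.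
  by rewrite !inE iW ?yW ?par_stp py //=; move: py; case: (par y).
rewrite -nb_swap -big_split /= mulnC -[in RHS]sum1_size big_distrl /=.
apply: eq_big_seq => x; rewrite !inE mul1n => /andP[xW px].
rewrite /gd !nbE -big_split /= -card_dir -sum1_card; apply: eq_bigr => s _.
by rewrite !inE par_stp px xW; case: (_ \in W).
Qed.

Lemma sum_gd_evensE : (\sum_(x <- evens par W) gd x = 2 * d * excess)%N.
Proof. by rewrite /excess mulnBr -sum_gd_evens addnK. Qed.

Definition outer : {fset V} := [fset y in Nb W | y \notin W].

Lemma sum_gd_outer : (\sum_(y <- outer) gd y = 2 * d * excess)%N.
Proof.
rewrite -sum_gd_evensE.
transitivity (\sum_(y <- outer) nb (mem (evens par W)) y)%N.
  apply: eq_big_seq => y; rewrite !inE => /andP[yN yW].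
  rewrite /gd !nbE; apply: eq_bigr => s _; rewrite !inE (negPf yW) eqbF_neg negbK.
  case yi: (y + stp s \in W) => //=.
  have := @interface_bdry y s; rewrite yi (negPf yW) => /(_ isT) py.
  by rewrite par_stp -py.
rewrite -nb_swap; apply: eq_big_seq => x; rewrite !inE => /andP[xW px].
rewrite /gd !nbE; apply: eq_bigr => s _; rewrite !inE xW mem_Nb //=.
by case: (_ \in W).
Qed.

Lemma sum_gd (A : {fset V}) : (\sum_(x <- A) gd x <= 4 * d * excess)%N.
Proof.
have -> : (4 * d * excess = 2 * d * excess + 2 * d * excess)%N by lia.
rewrite -{1}sum_gd_outer -sum_gd_evensE.
apply: (@leq_trans (\sum_(x <- [fset x in A | x \in outer]) gd x +
                    \sum_(x <- [fset x in A | x \in evens par W]) gd x)).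
  rewrite -!big_fset_condE /= [X in (_ <= X + _)%N]big_mkcond.
  rewrite [X in (_ <= _ + X)%N]big_mkcond -big_split /=; apply: leq_sum => x _.
  case: (posnP (gd x)) => [->//|/gd_gt0P[s xs]].
  have xp := interface_bdry xs; rewrite in_fset [in X in (_ <= _ + X)%N]in_fset !inE.
  rewrite in_Nb -xp; move: xs; case xW: (x \in W) => /=; first by rewrite andbF.
  rewrite eqbF_neg negbK => xs; have -> : [exists s, x + stp s \in W].
    by apply/existsP; exists s.
  by rewrite addn0.
by apply: leq_add; apply: sum_fset_subset; apply/fsubsetP => x; rewrite !inE => /andP[].
Qed.

Lemma card_gd (A : {fset V}) k : (forall x, x \in A -> k <= gd x)%N ->
  (#|` A| * k <= 4 * d * excess)%N.
Proof.
move=> kA; apply: leq_trans (sum_gd A).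
rewrite -sum1_size big_distrl /= big_seq [leqRHS]big_seq.
by apply: leq_sum => x /kA; rewrite mul1n.
Qed.

(** Translating the odd sites of [W] back by [s] puts them among the even ones, and the even sites
    missed are the exits. So equally many edges leave a contour in every direction. *)
Lemma card_exits s : (0 < d)%N ->
  #|` [fset x in W | x + stp s \notin W]| = excess.
Proof.
move=> d0; rewrite /excess -(card_shift (opp s) (odds par W)) -cardfsDS; last first.
  apply/fsubsetP => x; rewrite mem_shift stpN opprK !inE par_stp negbK => /andP[xW px].
  rewrite px andbT; have := iW (x := x + stp s) (opp s).
  by rewrite stpN addrK par_stp px xW => ->.
congr (#|` _|); apply/fsetP => x; rewrite !inE mem_shift stpN opprK !inE par_stp negbK.
case xW: (x \in W) => //=; last by rewrite andbF.
case xs: (x + stp s \in W) => /=; first by case: (par x).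
by have := @interface_bdry x s; rewrite xs xW => /(_ isT) <-.
Qed.

Variable r : nat.
Hypothesis rd : (r <= d)%N.
Hypothesis noiso : forall x, exists s, (x + stp s \in W) = (x \in W).

(** Sites whose parity excludes boundary edges, with at least d / 2 neighbours of almost full
    boundary degree. They cover the heavy sites whose neighbours across the boundary mostly have low
    degree. *)
Definition hubs : {fset V} :=
  [fset z in W `|` Nb (Nb W) | ((z \in W) != par z) &&
     (d <= 2 * nb (fun w => 2 * d < gd w + r) z)%N].

(** Double counting of edges between hubs and sites of degree above [2 * d - r]. The degree sum
    allows at most [4 * excess] such sites, and each has at most [r] hub neighbours because an edge
    at a hub is never a boundary edge. *)
Lemma card_hubs : (0 < d)%N -> (#|` hubs| * d <= 8 * r * excess)%N.
Proof.
move=> d0; pose Bg := [fset w in Nb hubs | (2 * d < gd w + r)%N].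
have Bgle : (#|` Bg| <= 4 * excess)%N.
  rewrite -(leq_pmul2r d0) -mulnA [(excess * d)%N]mulnC mulnA; apply: card_gd => x.
  by rewrite !inE => /andP[_]; lia.
have nbU w : w \in Bg -> (nb (mem hubs) w <= r)%N.
  rewrite !inE => /andP[_ wr].
  suff : (gd w + nb (mem hubs) w <= 2 * d)%N by lia.
  rewrite /gd !nbE -big_split /= -card_dir -sum1_card; apply: leq_sum => s _.
  case: (boolP (w + stp s \in hubs)) => [|_]; last by rewrite addn0 leq_b1.
  rewrite !inE => /andP[_ /andP[zi _]].
  have := iW (opp s) zi; rewrite stpN addrK => ->.
  by rewrite eqxx.
have : (\sum_(z <- hubs) nb (mem Bg) z <= #|` Bg| * r)%N.
  by rewrite nb_swap; apply: sum_fset_ge.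
have : (#|` hubs| * d <= 2 * \sum_(z <- hubs) nb (mem Bg) z)%N.
  rewrite big_distrr /= -sum1_size big_distrl /= big_seq [leqRHS]big_seq.
  apply: leq_sum => z zU; move: (zU); rewrite !inE mul1n => /andP[_ /andP[_ /leq_trans]].
  apply; rewrite leq_mul2l /=; apply: nb_sub => s zs.
  by rewrite !inE zs mem_Nb.
nia.
Qed.

Definition bigs : {fset V} := [fset y in W `|` Nb W | (r <= gd y)%N].
Definition heavy : {fset V} := [fset x in W `|` Nb W | (d <= gd x)%N].

(** If fewer than d / 2 neighbours are in [bigs], at least d / 2 neighbours [x + stp g] across the
    boundary have degree below [r]. For a neighbour [x + stp f] on the side of [x], the edge from
    [x + stp g] along [f] crosses the boundary, and [gd_pair] forces degree above [2 * d - r] at its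
    far end. So [x + stp f] is a hub. *)
Lemma heavy_dichotomy x : (0 < d)%N -> x \in heavy ->
  (d <= 2 * nb (mem bigs) x)%N \/ x \in Nb hubs.
Proof.
move=> d0; rewrite in_fset /= inE => /andP[xB xd].
have inB y : (0 < gd y)%N -> y \in W `|` Nb W.
  move=> /gd_gt0P[s ys]; rewrite in_fsetU in_Nb; move: ys.
  case: (y \in W) => //=; case yW: (_ \in W) => //= _.
  by apply/existsP; exists s.
case: (leqP d (2 * nb (mem bigs) x)) => [|small]; [by left|right].
pose Y := [pred s | ((x + stp s \in W) != (x \in W)) && (gd (x + stp s) < r)%N].
have Yb : (d <= 2 * #|Y|)%N.
  suff : (gd x <= #|Y| + nb (mem bigs) x)%N by lia.
  have -> : #|Y| = (\sum_(s : D) (s \in Y))%N by rewrite -sum1_card big_mkcond.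
  rewrite /gd !nbE -big_split /=; apply: leq_sum => s _.
  rewrite inE /=; case xs: (_ != _) => //=.
  case: (ltnP (gd (x + stp s)) r) => //= rg.
  suff : x + stp s \in bigs by move=> ->.
  rewrite in_fset /= inE rg andbT; apply: inB; apply/gd_gt0P; exists (opp s); rewrite stpN addrK.
  by rewrite eq_sym xs.
have /card_gt0P[e eY] : (0 < #|Y|)%N by lia.
move: (eY); rewrite inE /= => /andP[xe ge].
have [f xf] := noiso x.
have xp := interface_bdry xe.
have zi : (x + stp f \in W) != par (x + stp f) by rewrite xf par_stp xp; case: (par x).
rewrite in_Nb; apply/existsP; exists f; rewrite in_fset /= inE; apply/andP; split.
  move: xB; rewrite !in_fsetU xf => /orP[->//|xN]; apply/orP; right; exact: mem_Nb.
rewrite zi /=; apply: leq_trans Yb _; rewrite leq_mul2l /=.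
apply/subset_leq_card/fintype.subsetP => g; rewrite !inE => /andP[xg gg].
have zg : (x + stp f + stp g \in W) = (x \in W) by rewrite iW.
have := @gd_pair (x + stp g) f; rewrite addrAC zg eq_sym xg => /(_ isT).
rewrite [x + stp f + stp g]addrAC; move: gg.
by move: (gd _) (gd _) => a b; clear; lia.
Qed.

End OneSet.
End Degrees.

(** * Lines, exits and an edge isoperimetric inequality *)

Section Lines.
Variable d : nat.
Local Notation V := 'rV[int]_d.
Local Notation D := ('I_d * bool)%type.

Definition online (i : 'I_d) (x y : V) : bool :=
  [forall j, (j != i) ==> (x 0 j == y 0 j)].

Lemma online_stp i b x k : online i x (x + stp (i, b) *+ k).
Proof.
apply/forallP => j; apply/implyP => ji.
by rewrite mxE mulmxnE stp_coord (negPf ji) mul0rn addr0.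
Qed.

Lemma online_uniq i j x y : x != y -> online i x y -> online j x y -> i = j.
Proof.
move=> xy /forallP xi /forallP xj; apply/eqP; apply: contraR xy => ij.
apply/eqP/rowP => k; have [->|ki] := eqVneq k i; apply/eqP.
  by have /implyP := xj i; apply.
by have /implyP := xi k; apply.
Qed.

Lemma stp_mulrn_inj (s : D) : injective (fun k => stp s *+ k).
Proof.
move=> k l /rowP/(_ s.1); rewrite !mulmxnE stp_coord eqxx.
by case: s.2; rewrite /= ?expr0 ?expr1 => /eqP; rewrite ?mulNrn ?eqr_opp ?eqr_nat => /eqP.
Qed.

Section Exit.
Variables (C : {fset V}) (s : D).

Lemma exit_exists x : exists n, x + stp s *+ n.+1 \notin C.
Proof.
apply: contrapT => all; pose f n := x + stp s *+ n.+1.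
have : (size (map f (iota 0 #|` C|.+1)) <= #|` C|)%N.
  apply: uniq_leq_size.
    rewrite map_inj_uniq ?iota_uniq // => k l /addrI/stp_mulrn_inj.
    by case.
  by move=> _ /mapP[n _ ->]; apply/negPn/negP => nC; apply: all; exists n.
by rewrite size_map size_iota ltnn.
Qed.

(** For [x] in [C], the index of the last site of the run that starts at [x]: the exit edge leads
    from step [exit_time x] to the next one. *)
Definition exit_time x : nat := ex_minn (exit_exists x).

Lemma exit_out x : x + stp s *+ (exit_time x).+1 \notin C.
Proof. by rewrite /exit_time; case: ex_minnP. Qed.

Lemma exit_in x k : x \in C -> (k <= exit_time x)%N -> x + stp s *+ k \in C.
Proof.
rewrite /exit_time; case: ex_minnP => m _ min xC; case: k => [|k] km.
  by rewrite mulr0n addr0.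
by apply/negPn/negP => /min; rewrite leqNgt km.
Qed.

(** Following [s] to the end of a run stays on one line, so sites on distinct lines have distinct
    exits. *)
Lemma transversal_exits (A : {fset V}) : A `<=` C ->
  {in A &, forall x y, online s.1 x y -> x = y} ->
  (#|` A| <= #|` [fset x in C | (x + stp s)%R \notin C]|)%N.
Proof.
move=> /fsubsetP AC tr; pose ex x := x + stp s *+ exit_time x.
suff <- : #|` [fset ex x | x in A]| = #|` A|.
  apply: fsubset_leq_card; apply/fsubsetP => _ /imfsetP[x /= xA ->].
  rewrite !inE; apply/andP; split; first exact: exit_in (AC _ xA) (leqnn _).
  by have := exit_out x; rewrite mulrSr addrA.
apply: card_in_imfset => x y /=; wlog le : x y / (exit_time x <= exit_time y)%N => [hw|] xA yA exy.
  by case: (leqP (exit_time x) (exit_time y)) => [|/ltnW] /hw h; [|apply/esym]; apply: h.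
apply/esym/tr => //; have -> : x = y + stp s *+ (exit_time y - exit_time x).
  by rewrite mulrnBr // addrA; apply/eqP; rewrite -subr_eq opprK; apply/eqP.
by case: (s) => i b; apply: online_stp.
Qed.

End Exit.

(** Pick [h] sites of [C]. Each other site shares a line with [x] for at most one axis, so [x] is
    alone on its line for at least [d - h + 1] axes; and for each axis the lone sites have distinct
    exits. *)
Lemma edge_isoperimetry (C : {fset V}) h : (0 < h)%N -> (h <= #|` C|)%N -> (h <= d)%N ->
  (h * (d - h + 1) <= \sum_(x <- C) nb (fun y => y \notin C) x)%N.
Proof.
move=> h0 hC hd; pose B : {fset V} := [fset x in take h (enum_fset C)].
have uB : uniq (take h (enum_fset C)) by rewrite take_uniq.
have cB : #|` B| = h by rewrite card_fseq undup_id // size_takel.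
have BC : B `<=` C by apply/fsubsetP => x; rewrite inE => /mem_take.
pose lone i x := all (fun y => (y == x) || ~~ online i x y) B.
pose A i := [fset x in B | lone i x].
have L1 : (\sum_(i < d) #|` A i| <= \sum_(x <- C) nb (fun y => y \notin C) x)%N.
  apply: (@leq_trans
    (\sum_(i < d) #|` [fset x in C | (x + stp (i, false))%R \notin C]|)%N).
    apply: leq_sum => i _; apply: transversal_exits.
      by apply: fsubset_trans BC; apply/fsubsetP => x; rewrite inE => /andP[].
    move=> x y; rewrite !inE => /andP[xB /allP lx] /andP[yB _] on.
    have := lx y; rewrite inE => /(_ yB); rewrite on orbF.
    by move/eqP.
  under [leqLHS]eq_bigr => i _.
    rewrite (card_fset_count C (fun x => x + stp (i, false) \notin C)).
    rewrite -sum1_count big_mkcond /=; over.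
  rewrite exchange_big /=; apply: leq_sum => x _.
  rewrite -big_mkcond sum1_card /nb -(card_imset _ (f := fun i : 'I_d => (i, false))).
    by apply/subset_leq_card/fintype.subsetP => _ /imsetP[i + ->]; rewrite !inE.
  by move=> i j [].
apply: leq_trans L1.
under [leqRHS]eq_bigr => i _.
  rewrite (card_fset_count B (lone i)) -sum1_count big_mkcond /=; over.
rewrite exchange_big /= -{1}cB -sum1_size big_distrl /= big_seq [leqRHS]big_seq.
apply: leq_sum => x xB; rewrite mul1n -big_mkcond sum1_card.
pose bad := (\sum_(y <- B `\ x) \sum_(i < d) online i x y)%N.
have badle : (bad <= h.-1)%N.
  have -> : h.-1 = #|` B `\ x| by rewrite -cB (cardfsD1 x B) xB.
  rewrite -sum1_size /bad big_seq [leqRHS]big_seq; apply: leq_sum => y.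
  rewrite !inE => /andP[yx _]; case: (pickP (fun i => online i x y)) => [i oi|no].
    rewrite (bigD1 i) //= oi big1 ?addn0 // => j ji.
    by apply/eqP; rewrite eqb0; apply: contra ji => /(online_uniq _ oi) ->; rewrite // eq_sym.
  by rewrite big1 // => i _; rewrite no.
set N := #|_|; suff : (d <= N + bad)%N by lia.
rewrite /N {N}.
rewrite /bad exchange_big /= -{1}[d]card_ord -sum1_card -[X in (_ <= X + _)%N]sum1_card.
rewrite [X in (_ <= X + _)%N]big_mkcond -big_split /=; apply: leq_sum => i _.
rewrite unfold_in /lone; case: allP => [|nall] //=.
have [y yB] : exists2 y, y \in B & ~~ ((y == x) || ~~ online i x y).
  by apply/allPn/allP.
rewrite negb_or negbK => /andP[yx oy].
rewrite add0n (big_fsetD1 y) /=; last by rewrite in_fsetD1 yx; exact: yB.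
by rewrite oy.
Qed.
End Lines.

(** * Connectedness of a contour and of its covers *)

Section Bond.
Variable d : nat.
Local Notation V := 'rV[int]_d.
Local Notation D := ('I_d * bool)%type.

Fixpoint crossings (P : V -> D -> bool) (x : V) (l : seq D) : bool :=
  if l is s :: l' then P x s (+) crossings P (x + stp s) l' else false.

Lemma crossings_cat P x l l' :
  crossings P x (l ++ l') = crossings P x l (+) crossings P (endp x l) l'.
Proof.
elim: l x => [|s l IH] x; first by rewrite endp_nil.
by rewrite /= IH endp_cons addbA.
Qed.

Section Parity.
Variable P : V -> D -> bool.
Hypothesis Psym : forall x s, P (x + stp s) (opp s) = P x s.
Hypothesis square : forall x s s',
  P x s (+) P (x + stp s) s' = P x s' (+) P (x + stp s') s.

Lemma crossings_front x s l1 l2 :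
  crossings P x (l1 ++ s :: l2) = crossings P x (s :: l1 ++ l2).
Proof.
elim: l1 x => [//|a l1 IH] x; rewrite [LHS]/= IH /=.
by rewrite addrAC addbA square -addbA [x + _ + _]addrAC.
Qed.

Lemma closed_opp (s : D) (l : seq D) : endp 0 (s :: l) = 0 -> opp s \in l.
Proof.
rewrite endp_cons /endp add0r => /rowP/(_ s.1).
rewrite [LHS]mxE summxE stp_coord eqxx [RHS]mxE.
move=> sum0; apply/negPn/negP => nin.
have pos : 0 <= (-1) ^+ s.2 * \sum_(t <- l) stp t 0 s.1.
  rewrite mulr_sumr big_seq; apply: sumr_ge0 => t tl; rewrite stp_coord.
  case: eqP => [e|_]; last by rewrite mulr0.
  have -> : t.2 = s.2; last by rewrite -expr2 sqrr_sign.
  apply/eqP; apply: contraNT nin => ts; suff <- : t = opp s by [].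
  case: t {tl} e ts => i b /= <-; rewrite /opp /=; case: b; by case: s.2.
have : (-1) ^+ s.2 * ((-1) ^+ s.2 + \sum_(t <- l) stp t 0 s.1) = 0 :> int.
  by rewrite sum0 mulr0.
rewrite mulrDr -expr2 sqrr_sign => e; have : (0 : int) < 1 + (-1) ^+ s.2 * \sum_(t <- l) stp t 0 s.1.
  by rewrite ltr_pwDl.
by rewrite e ltxx.
Qed.

(** Induction on the length. Some later step undoes the first one; moving it to the front across
    unit squares keeps the parity by [square], and then the two cancel. *)
Lemma crossings_closed x l : endp x l = x -> crossings P x l = false.
Proof.
have [n ln] := ubnP (size l); elim: n => // n IH in l ln x *.
case: l ln => [|s l] //= ln.
rewrite endp_cons /endp => /eqP; rewrite -addrA -subr_eq0 addrAC subrr add0r => /eqP e.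
have osl : opp s \in l by apply: closed_opp; rewrite endp_cons /endp add0r.
case/path.splitPr: l / osl ln e => l1 l2 ln e.
rewrite crossings_front /= Psym stpN addrK addKb; apply: IH.
  by move: ln; rewrite !size_cat /=; lia.
move: e; rewrite !big_cat big_cons /= stpN /endp big_cat /= => e.
rewrite -[RHS]addr0 -[in RHS]e; congr (_ + _).
by rewrite [RHS]addrCA [stp s + _]addrA subrr add0r.
Qed.
End Parity.

Variable W : {fset V}.
Hypothesis conW : forall x y, x \in W -> y \in W -> reach (mem W) x y.
Hypothesis conWc : forall x y, x \notin W -> y \notin W ->
  reach (fun z => z \notin W) x y.

(** Join an edge of [P] and any other boundary edge into a closed walk by paths inside and outside
    [W], which meet no boundary edge. Its crossing parity vanishes, so [P] contains the second edge
    as well. *)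
Lemma bond_connected (P : V -> D -> bool) :
  (forall x s, P (x + stp s) (opp s) = P x s) ->
  (forall x s s', P x s (+) P (x + stp s) s' = P x s' (+) P (x + stp s') s) ->
  (forall x s, P x s -> (x + stp s \in W) != (x \in W)) ->
  forall x0 s0 x s, P x0 s0 -> (x + stp s \in W) != (x \in W) -> P x s.
Proof.
move=> Psym sq PW.
have flat (Q : pred V) b : (forall z, Q z -> (z \in W) = b) ->
    forall l z, inwalk Q z l -> crossings P z l = false.
  move=> Qb; elim=> [//|t l IH] z /= /andP[Qz w]; rewrite (IH _ w) addbF.
  by apply/negbTE/negP => /PW; rewrite (Qb _ Qz) (Qb _ (inwalk_start w)) eqxx.
have main x0 s0 x s : P x0 s0 -> (x + stp s \in W) != (x \in W) ->
    x0 \in W -> x \in W -> P x s.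
  move=> P0 xs x0W xW; have := PW _ _ P0; rewrite x0W => y0W.
  rewrite xW in xs.
  have [l1 w1 e1] : reach (fun z => z \notin W) (x0 + stp s0) (x + stp s).
    by apply: conWc; [case: (_ \in W) y0W | case: (_ \in W) xs].
  have [l2 w2 e2] := conW xW x0W.
  have := @crossings_closed P Psym sq x0 (s0 :: l1 ++ opp s :: l2).
  rewrite endp_cons endp_cat e1 endp_cons stpN addrK e2 => /(_ erefl).
  rewrite /= crossings_cat e1 /= stpN addrK P0 Psym.
  rewrite (flat _ false _ _ _ w1) ?(flat _ true _ _ _ w2) //=.
    by rewrite addbF; case: (P x s).
  by move=> z /negbTE.
move=> x0 s0 x s P0 xs.
have swap y t : (y + stp t \in W) != (y \in W) -> y \notin W ->
    (y + stp t \in W) /\ (y + stp t + stp (opp t) \in W) != (y + stp t \in W).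
  by rewrite stpN addrK => h yW; move: h; rewrite (negPf yW); case: (_ \in W).
case: (boolP (x0 \in W)) => x0W; case: (boolP (x \in W)) => xW.
- exact: main P0 xs x0W xW.
- rewrite -Psym; have [yW yP] := swap _ _ xs xW; exact: main P0 yP x0W yW.
- have [y0W _] := swap _ _ (PW _ _ P0) x0W.
  by apply: (main _ (opp s0) _ _ _ xs y0W xW); rewrite Psym.
- have [y0W _] := swap _ _ (PW _ _ P0) x0W; have [yW yP] := swap _ _ xs xW.
  by rewrite -Psym; apply: (main _ (opp s0) _ _ _ yP y0W yW); rewrite Psym.
Qed.

Definition near (k : nat) (x y : V) : Prop :=
  exists2 l : seq D, (size l <= k)%N & endp x l = y.

Lemma near_refl k x : near k x x.
Proof. by exists [::]; rewrite ?endp_nil. Qed.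

Lemma near_trans k l x y z : near k x y -> near l y z -> near (k + l) x z.
Proof.
move=> [a ak <-] [b bl <-]; exists (a ++ b); last exact: endp_cat.
by rewrite size_cat leq_add.
Qed.

Lemma near_step x s : near 1 x (x + stp s).
Proof. by exists [:: s]; rewrite ?endp_cons ?endp_nil. Qed.

Lemma near_sym k x y : near k x y -> near k y x.
Proof.
move=> [l lk <-]; exists (rev (map (@opp d) l)); first by rewrite size_rev size_map.
rewrite /endp big_rev big_map /= -addrA -big_split /= big1 ?addr0 // => s _.
by rewrite stpN subrr.
Qed.

Lemma near_le k l x y : (k <= l)%N -> near k x y -> near l x y.
Proof. by move=> kl [a ak e]; exists a => //; apply: leq_trans kl. Qed.

Lemma Nb_near (T : {fset V}) x : x \in Nb T -> exists2 a, a \in T & near 1 a x.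
Proof.
rewrite in_Nb => /existsP[s xT]; exists (x + stp s) => //.
exact/near_sym/near_step.
Qed.

(** Suppose [T] is farther than 4 from the rest of [U]. No unit square meets boundary edges touched
    by both parts, since its corners are within 2 of each other and the cover adds 1 at each end. So
    the boundary edges touched by [T] are all or none of those in a square, an even number, and
    [bond_connected] makes [T] touch the edges near the rest of [U]. *)
Lemma cover_linked (U T : {fset V}) :
  (forall x s, (x + stp s \in W) != (x \in W) -> (x \in Nb U) || (x + stp s \in Nb U)) ->
  (forall a, a \in U -> exists x s, near 1 a x /\ (x + stp s \in W) != (x \in W)) ->
  T `<=` U -> T != fset0 -> T != U ->
  exists a b, [/\ a \in T, b \in U `\` T & near 4 a b].
Proof.
move=> cov bnd TU /fset0Pn[a0 a0T] TnU; apply: contrapT => far.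
have [b0 b0UT] : exists b, b \in U `\` T.
  by apply/fset0Pn; rewrite fsetD_eq0; apply: contra TnU => UT; rewrite eqEfsubset TU.
pose bd x s := (x + stp s \in W) != (x \in W).
pose tch (A : {fset V}) x s := (x \in Nb A) || (x + stp s \in Nb A).
pose P x s := bd x s && tch T x s.
have tch_near A x s : tch A x s -> exists2 a, a \in A &
    near 1 a x \/ near 1 a (x + stp s).
  by case/orP => /Nb_near[a aA ax]; exists a => //; [left|right].
have split_tch x s : bd x s -> tch T x s \/ tch (U `\` T) x s.
  move=> /cov; rewrite /tch !in_Nb.
  have h y : [exists t, y + stp t \in U] ->
      [exists t, y + stp t \in T] \/ [exists t, y + stp t \in U `\` T].
    move=> /existsP[t yU]; case: (boolP (y + stp t \in T)) => yT; [left|right];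
      by apply/existsP; exists t; rewrite ?inE ?yT.
  by case/orP => /h[]; move=> ->; rewrite ?orbT; [left|right|left|right].
have excl (A B : {fset V}) v w : (exists2 a, a \in A & near 1 a v) -> (exists2 b, b \in B & near 1 b w) ->
    near 2 v w -> exists a b, [/\ a \in A, b \in B & near 4 a b].
  move=> [a aA av] [b bB bw] vw; exists a, b; split => //.
  exact: near_trans (near_trans av vw) (near_sym bw).
have sq x s s' : P x s (+) P (x + stp s) s' = P x s' (+) P (x + stp s') s.
  pose Sq := [:: x; x + stp s; x + stp s'; x + stp s + stp s'].
  pose L := [:: (x, s); (x + stp s, s'); (x, s'); (x + stp s', s)].
  have Sq2 v w : v \in Sq -> w \in Sq -> near 2 v w.
    have st y t : near 1 y (y + stp t) by exact: near_step.
    have st' y t : near 1 (y + stp t) y by apply: near_sym.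
    have n2 y t t' : near 2 y (y + stp t + stp t').
      exact: (near_trans (st _ _) (st _ _)).
    rewrite !inE => /or4P[]/eqP-> /or4P[]/eqP->; try exact: near_refl;
      try (by apply: near_le (st _ _)); try (by apply: near_le (st' _ _));
      try exact: n2; try (by apply: near_sym; exact: n2).
    + exact: (near_trans (st' _ _) (st _ _)).
    + exact: (near_trans (st' _ _) (st _ _)).
    + by rewrite addrAC; apply: near_le (st _ _).
    + by rewrite addrAC; apply: near_le (st' _ _).
  have LSq e : e \in L -> e.1 \in Sq /\ e.1 + stp e.2 \in Sq.
    rewrite !inE => /or4P[]/eqP-> /=; rewrite ?eqxx ?orbT //.
    by rewrite [x + stp s' + stp s]addrAC eqxx !orbT.
  case: (boolP (all (fun e => bd e.1 e.2 ==> tch T e.1 e.2) L)) => [/and5P[]|].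
    rewrite /P /=; do 4!move=> /implyP ?; move=> _.
    have PE y t : (bd y t -> tch T y t) -> bd y t && tch T y t = bd y t.
      by case: (bd y t) => //= ->.
    rewrite !PE // /bd [x + stp s' + stp s]addrAC.
    by do 4!case: (_ \in W).
  move=> /allPn[e eL]; rewrite negb_imply => /andP[be nT].
  have [|tU] := split_tch _ _ be; first by rewrite (negPf nT).
  have none f : f \in L -> P f.1 f.2 = false.
    move=> fL; apply/negbTE/negP => /andP[_ tT]; apply: far.
    have [a aT av] := tch_near _ _ _ tT; have [b bU bw] := tch_near _ _ _ tU.
    have [f1 f2] := LSq _ fL; have [e1 e2] := LSq _ eL.
    case: av => av; case: bw => bw.
    - exact: (excl _ _ _ _ (ex_intro2 _ _ a aT av) (ex_intro2 _ _ b bU bw) (Sq2 _ _ f1 e1)).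
    - exact: (excl _ _ _ _ (ex_intro2 _ _ a aT av) (ex_intro2 _ _ b bU bw) (Sq2 _ _ f1 e2)).
    - exact: (excl _ _ _ _ (ex_intro2 _ _ a aT av) (ex_intro2 _ _ b bU bw) (Sq2 _ _ f2 e1)).
    - exact: (excl _ _ _ _ (ex_intro2 _ _ a aT av) (ex_intro2 _ _ b bU bw) (Sq2 _ _ f2 e2)).
  rewrite (none (x, s)) ?(none (x + stp s, s')) ?(none (x, s')) ?(none (x + stp s', s)) //;
    by rewrite !inE eqxx ?orbT.
have Psym x s : P (x + stp s) (opp s) = P x s.
  by rewrite /P /bd /tch stpN addrK eq_sym orbC.
have own (A B : {fset V}) a x s : a \in A -> near 1 a x -> tch B x s ->
    exists a b, [/\ a \in A, b \in B & near 4 a b].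
  move=> aA ax /tch_near[b bB [bx|bx]].
    by apply: (excl _ _ x x); [exists a|exists b|exact: near_refl].
  apply: (excl _ _ x (x + stp s)); [by exists a|by exists b|].
  exact: near_le (near_step _ _).
have [x [s [ax xs]]] := bnd _ (fsubsetP TU _ a0T).
have Pxs : P x s.
  rewrite /P /bd xs /=; have [//|tU] := split_tch _ _ xs.
  by case: far; apply: own a0T ax tU.
have [y [t [by_ yt]]] := bnd _ (fsubsetP (fsubsetDl _ _) _ b0UT).
have : P y t by apply: (bond_connected Psym sq _ Pxs yt) => ? ? /andP[].
move=> /andP[_ tT]; have [b [a [bU aT ab]]] := own _ _ _ _ _ b0UT by_ tT.
by apply: far; exists a, b; split => //; apply: near_sym.
Qed.

End Bond.

(** * Approximating contours *)

Section Counting.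
Variable R : realType.

(** Exponential weighting: [expR (l * (kappa - #|B|))] is at least 1 for the listed sets, and over
    all subsets it sums to [expR (kappa * l)] times a power of [1 + expR (- l)]. In the applications
    [l] is a multiple of log d, so the second term of the exponent is small. *)
Lemma few_subsets (T : choiceType) (A : {fset T}) (kappa l : R) : 0 <= l ->
  exists L : seq {fset T},
    (size L)%:R <= expR (kappa * l + #|` A|%:R * expR (- l)) /\
    forall B : {fset T}, B `<=` A -> #|` B|%:R <= kappa -> B \in L.
Proof.
move=> l0; exists [seq B <- enum_fset (fpowerset A) | #|` B|%:R <= kappa]; split; last first.
  by move=> B BA Bk; rewrite mem_filter Bk /= fpowersetE.
rewrite -sum1_size natr_sum big_filter.
apply: (@le_trans _ _ (\sum_(B <- fpowerset A) expR (kappa * l) * expR (- l) ^+ #|` B|)).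
  rewrite big_mkcond; apply: ler_sum => B _; case: ifP => [Bk|_].
    rewrite -expRM_natl -expRD -[leLHS]expR0 ler_expR mulrN -mulrBl.
    by rewrite mulr_ge0 // subr_ge0.
  by rewrite mulr_ge0 ?exprn_ge0 ?expR_ge0.
rewrite -mulr_sumr sum_fpowerset_expr expRD ler_wpM2l ?expR_ge0 //.
rewrite expRM_natl lerXn2r ?nnegrE ?addr_ge0 ?expR_ge0 //.
exact: expR_ge1Dx.
Qed.

End Counting.

(** * Enumeration of linked sets by walks *)

Section Walks.
Variable d : nat.
Local Notation V := 'rV[int]_d.
Local Notation D := ('I_d * bool)%type.
Local Notation letter := (option D * bool)%type.

Definition jump (o : option D) : V := if o is Some s then stp s else 0.

(** A letter is a step, [None] meaning to stay, and a flag telling whether the site reached is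
    recorded. Staying letters record a site in place, or pad a word to a given length. *)
Fixpoint marks (x : V) (c : seq letter) : seq V :=
  if c is (o, b) :: c' then
    (if b then [:: x + jump o] else [::]) ++ marks (x + jump o) c'
  else [::].

Definition cend (x : V) (c : seq letter) : V := x + \sum_(p <- c) jump p.1.

Lemma cend_cat x c c' : cend x (c ++ c') = cend (cend x c) c'.
Proof. by rewrite /cend big_cat /= addrA. Qed.

Lemma cend_cons x p c : cend x (p :: c) = cend (x + jump p.1) c.
Proof. by rewrite /cend big_cons addrA. Qed.

Lemma marks_cat x c c' : marks x (c ++ c') = marks x c ++ marks (cend x c) c'.
Proof.
elim: c x => [| [w b] c IH] x /=; first by rewrite /cend big_nil addr0.
by rewrite IH catA cend_cons.
Qed.

Lemma marks_unmarked x c : all (fun p : letter => ~~ p.2) c -> marks x c = [::].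
Proof. by elim: c x => [//| [w []] c IH] x //=; apply: IH. Qed.

Lemma mem_marks x c y : y \in marks x c -> exists c1 c2, c = c1 ++ c2 /\ cend x c1 = y.
Proof.
elim: c x => [//| [w b] c IH] x /=; rewrite mem_cat => /orP[|/IH[c1 [c2 [-> <-]]]].
  case: b => //; rewrite inE => /eqP ->; exists [:: (w, true)], c.
  by rewrite /cend big_seq1.
by exists ((w, b) :: c1), c2; rewrite cend_cons.
Qed.

(* Depth-first exploration: a linked set is the set of marked vertices of a
   closed walk which spends at most 2 k + 1 letters on each new vertex. *)
Lemma linked_walk k (v0 : V) (U : {fset V}) :
  (forall T : {fset V}, T `<=` U -> T != U ->
     exists a b, [/\ a \in v0 |` T, b \in U `\` T & near k a b]) ->
  exists c, (size c <= (2 * k + 1) * #|` U|)%N /\ marks v0 c =i U.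
Proof.
move=> lk; suff main n : (n <= #|` U|)%N -> exists T c, [/\ T `<=` U, #|` T| = n,
    (size c <= (2 * k + 1) * n)%N, marks v0 c =i T & cend v0 c = v0].
  have [T [c [TU cT sc mc _]]] := main _ (leqnn _).
  exists c; split => // x; rewrite mc; suff -> : T = U by [].
  by apply/eqP; rewrite eqEfcard TU cT leqnn.
elim: n => [_|n IH nU].
  by exists fset0, [::]; rewrite fsub0set cardfs0 /cend big_nil addr0; split.
have [T [c [TU cT sc mc ec]]] := IH (ltnW nU).
have [|a [b [aT bUT [l lk' lab]]]] := lk _ TU.
  by apply/eqP => e; move: nU; rewrite -cT e ltnn.
have [c1 [c2 [cE c1a]]] : exists c1 c2, c = c1 ++ c2 /\ cend v0 c1 = a.
  move: aT; rewrite !inE => /orP[/eqP ->|]; last by rewrite -mc => /mem_marks.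
  by exists [::], c; rewrite /cend big_nil addr0.
move: bUT; rewrite !inE => /andP[bT bU].
pose go : seq letter := [seq (Some s, false) | s <- l].
pose back : seq letter := [seq (Some (opp s), false) | s <- rev l].
have ego : cend a go = b by rewrite -lab /cend /go big_map.
have eback : cend b back = a.
  rewrite -lab /cend /endp /back big_map big_rev -addrA -big_split /=.
  by rewrite big1 ?addr0 // => s _; rewrite stpN subrr.
exists (b |` T), (c1 ++ go ++ (None, true) :: back ++ c2); split.
- by rewrite fsubUset fsub1set bU.
- by rewrite cardfsU1 bT cT.
- by move: sc; rewrite cE !size_cat /= !size_cat !size_map size_rev; lia.
- move=> x; rewrite marks_cat c1a marks_cat ego /= addr0 marks_cat eback.
  rewrite [marks a go]marks_unmarked ?[marks b back]marks_unmarked; last 2 first.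
  + by rewrite /back all_map; apply/allP.
  + by rewrite /go all_map; apply/allP.
  rewrite /= mem_cat inE !inE -mc cE marks_cat c1a mem_cat.
  by rewrite orbCA orbA.
- rewrite cend_cat c1a cend_cat ego cend_cons /= addr0 cend_cat eback.
  by rewrite -c1a -cend_cat -cE.
Qed.

Lemma linked_list k (v0 : V) n : exists L : seq {fset V},
  (size L <= (4 * d + 2) ^ n)%N /\
  forall U : {fset V},
    (forall T : {fset V}, T `<=` U -> T != U ->
       exists a b, [/\ a \in v0 |` T, b \in U `\` T & near k a b]) ->
    ((2 * k + 1) * #|` U| <= n)%N -> U \in L.
Proof.
exists [seq seq_fset tt (marks v0 (val c)) | c <- enum {: n.-tuple letter}]; split.
  rewrite size_map -cardE card_tuple card_prod card_option card_bool card_dir.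
  by have -> : ((2 * d).+1 * 2 = 4 * d + 2)%N by lia.
move=> U /linked_walk[c [sc mc]] Un.
have sn : size (c ++ nseq (n - size c) (None, false)) == n.
  by rewrite size_cat size_nseq; apply/eqP; lia.
apply/mapP; exists (Tuple sn); first by rewrite mem_enum.
apply/fsetP => x; rewrite seq_fsetE /= marks_cat mem_cat mc.
by rewrite [marks _ (nseq _ _)]marks_unmarked ?orbF //; apply/allP => p /nseqP[->].
Qed.

End Walks.

(** * Small covers of a contour *)

Section Greedy.
Variable d : nat.
Local Notation V := 'rV[int]_d.

(** By double counting some [y] in [M] is adjacent to at least the fraction [d / (2 * #|M|)] of the
    sites still uncovered, so each choice multiplies their number by at most one minus this
    fraction. Denominators are cleared to stay in [nat]. *)
Lemma greedy_cover (X M : {fset V}) k : (0 < d)%N ->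
  (forall x, x \in X -> d <= 2 * nb (mem M) x)%N ->
  exists U : {fset V}, [/\ U `<=` M, (#|` U| <= k)%N &
    (#|` X `\` Nb U| * (2 * #|` M|) ^ k <= #|` X| * (2 * #|` M| - d) ^ k)%N].
Proof.
move=> d0 XM; elim: k => [|k [U [UM Uk Xk]]].
  exists fset0; rewrite fsub0set cardfs0 !expn0 !muln1; split => //.
  exact/fsubset_leq_card/fsubsetDl.
set X' := X `\` Nb U in Xk *.
have [X0|[x0 x0X]] := fset_0Vmem X'.
  by exists U; rewrite -/X' X0 cardfs0; split => //; apply: leqW.
have [y yM hy] : exists2 y, y \in M & (d * #|` X'| <= 2 * #|` M| * nb (mem X') y)%N.
  apply: contrapT => nex.
  have M0 : (0 < #|` M|)%N.
    have := XM x0; move: x0X; rewrite inE => /andP[_ ->] /(_ isT) h.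
    have /nb_gt0P[s sM] : (0 < nb (mem M) x0)%N by lia.
    by rewrite cardfs_gt0; apply/fset0Pn; exists (x0 + stp s).
  have lt1 : (\sum_(y <- M) (2 * #|` M| * nb (mem X') y).+1 <= \sum_(y <- M) d * #|` X'|)%N.
    rewrite big_seq [leqRHS]big_seq; apply: leq_sum => y yM.
    by rewrite ltnNge; apply/negP => h; apply: nex; exists y.
  have ge1 : (d * #|` X'| <= 2 * \sum_(y <- M) nb (mem X') y)%N.
    rewrite nb_swap mulnC -sum1_size big_distrl big_distrr /= big_seq [leqRHS]big_seq.
    by apply: leq_sum => x; rewrite inE mul1n => /andP[_ /XM].
  have : (\sum_(y <- M) (2 * #|` M| * nb (mem X') y).+1 =
     2 * #|` M| * (\sum_(y <- M) nb (mem X') y) + #|` M|)%N.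
    under eq_bigr do rewrite -addn1.
    by rewrite big_split /= -big_distrr /= sum1_size.
  move: lt1; rewrite big_const_seq count_predT iter_addn_0; nia.
exists (y |` U); split.
- by rewrite fsubUset fsub1set yM.
- by rewrite cardfsU1; case: (_ \notin _); rewrite /= ?add0n ?add1n ?ltnS // ltnW.
have XX : (#|` X `\` Nb (y |` U)| + nb (mem X') y <= #|` X'|)%N.
  have -> : nb (mem X') y = #|` [fset y + stp s | s in [pred s | y + stp s \in X']]|.
    by rewrite card_imfset /= -?cardE //; move=> s t /addrI/stp_inj.
  rewrite -(cardfsUI _ [fset _ | _ in _]); set I1 := _ `&` _.
  have -> : I1 = fset0.
    apply/eqP; rewrite fsetI_eq0; apply/fdisjointP => z; rewrite inE => /andP[zN _].
    apply/negP => /imfsetP[s _ zE]; case/negP: zN; rewrite zE.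
    by apply: mem_Nb; rewrite !inE eqxx.
  rewrite cardfs0 addn0; apply: fsubset_leq_card; apply/fsubsetP => z.
  rewrite inE => /orP[|/imfsetP[s /= sX ->]//]; rewrite !inE => /andP[zN ->].
  rewrite andbT; apply: contra zN; rewrite !in_Nb => /existsP[s zs].
  by apply/existsP; exists s; rewrite !inE zs orbT.
rewrite !expnS; apply: (@leq_trans (#|` X'| * (2 * #|` M|) ^ k * (2 * #|` M| - d))).
  suff : (#|` X `\` Nb (y |` U)| * (2 * #|` M|) <= #|` X'| * (2 * #|` M| - d))%N.
    by move=> /(leq_mul (leqnn ((2 * #|` M|) ^ k))); lia.
  rewrite mulnBr; nia.
by move: (leq_mul Xk (leqnn (2 * #|` M| - d))); lia.
Qed.

End Greedy.

Section CoverSet.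
Variable R : realType.
Variable d : nat.
Local Notation V := 'rV[int]_d.
Local Notation D := ('I_d * bool)%type.
Variable par : pred V.
Hypothesis par_stp : forall x s, par (x + stp s) = ~~ par x.

Definition contour (W : {fset V}) : Prop :=
  [/\ interface par W,
      forall x, exists s, (x + stp s \in W) = (x \in W),
      forall x y, x \in W -> y \in W -> reach (mem W) x y
    & forall x y, x \notin W -> y \notin W -> reach (fun z => z \notin W) x y].

Variable r : nat.
Hypotheses (r0 : (0 < r)%N) (rd : (r * r <= d)%N).
Local Notation L := (ln (d%:R : R)).
Hypothesis L1 : 1 <= L.

Let d0 : (0 < d)%N. Proof. by apply: leq_trans rd; rewrite muln_gt0 r0. Qed.
Let rled : (r <= d)%N. Proof. by apply: leq_trans rd; rewrite leq_pmulr. Qed.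
Let dR0 : 0 < d%:R :> R. Proof. by rewrite ltr0n. Qed.
Let rR0 : 0 < r%:R :> R. Proof. by rewrite ltr0n. Qed.
Let expL : expR L = d%:R. Proof. by rewrite lnK // posrE. Qed.

Definition touched (W K : {fset V}) : Prop :=
  forall x s, (x + stp s \in W) != (x \in W) -> (x \in K) || (x + stp s \in K).

(** After [k >= 8 t L / r] greedy choices at most the fraction exp (- k d / (2 |M|)) <= exp (- L) =
    1 / d of [X] is left, because |M| <= 4 d t / r. The last 4 t / d sites receive one neighbour
    each. *)
Lemma bigs_cover (X M : {fset V}) (t : nat) : (0 < t)%N ->
  (#|` M| * r <= 4 * d * t)%N -> (#|` X| <= 4 * t)%N ->
  (forall x, x \in X -> d <= 2 * nb (mem M) x)%N ->
  exists U : {fset V}, [/\ U `<=` M, X `<=` Nb U &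
    #|` U|%:R <= 8 * t%:R * L / r%:R + 1 + 4 * t%:R / d%:R :> R].
Proof.
move=> t0 Mr Xt XM.
have tR0 : 0 < t%:R :> R by rewrite ltr0n.
pose k := (Num.truncn (8 * t%:R * L / r%:R : R)).+1.
have k1 : 8 * t%:R * L / r%:R <= k%:R :> R.
  by rewrite ltW // /k; apply: truncnS_gt.
have k2 : k%:R <= 8 * t%:R * L / r%:R + 1 :> R.
  rewrite /k -natr1 lerD2r truncn_le // divr_ge0 ?mulr_ge0 //.
  exact: le_trans L1.
have [U [UM Uk Xk]] := greedy_cover k d0 XM.
pose f x := odflt 0 (omap (fun s => x + stp s) [pick s : D | x + stp s \in M]).
have fP x : x \in X -> f x \in M /\ x \in Nb [fset f x].
  move=> xX; have /nb_gt0P[s0 s0M] : (0 < nb (mem M) x)%N by have := XM x xX; lia.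
  rewrite /f; case: pickP => [s sM|/(_ s0) no]; last by have : x + stp s0 \in M := s0M; rewrite no.
  by split=> //=; rewrite in_Nb; apply/existsP; exists s; rewrite inE.
exists (U `|` [fset f x | x in X `\` Nb U]); split.
- rewrite fsubUset UM; apply/fsubsetP => _ /imfsetP[x /= + ->].
  by rewrite inE => /andP[_ /fP[]].
- apply/fsubsetP => x xX; rewrite in_Nb; case: (boolP (x \in Nb U)).
    by rewrite in_Nb => /existsP[s xs]; apply/existsP; exists s; rewrite inE xs.
  move=> xU; have [_] := fP x xX; rewrite in_Nb => /existsP[s xs].
  apply/existsP; exists s; rewrite inE; apply/orP; right; move: xs.
  by rewrite inE => /eqP ->; apply/imfsetP; exists x => //=; rewrite inE xU.
have rem : #|` X `\` Nb U|%:R <= 4 * t%:R / d%:R :> R.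
  have [/eqP X0|Xn0] := eqVneq #|` X `\` Nb U| 0%N.
    by rewrite (eqP X0) divr_ge0 ?mulr_ge0 // ltW.
  have M0 : (0 < #|` M|)%N.
    have [X0|[x xX]] := fset_0Vmem X; first by rewrite X0 fset0D cardfs0 in Xn0.
    by have [fM _] := fP x xX; rewrite cardfs_gt0; apply/fset0Pn; exists (f x).
  have M2 : 0 < (2 * #|` M|)%:R :> R by rewrite ltr0n muln_gt0.
  have dM : (d <= 2 * #|` M|)%N.
    have [X0|[x xX]] := fset_0Vmem X; first by rewrite X0 fset0D cardfs0 in Xn0.
    apply: leq_trans (XM x xX) _; rewrite leq_mul2l /=.
    have -> : nb (mem M) x = #|` [fset x + stp s | s in [pred s | x + stp s \in M]]|.
      by rewrite card_imfset /= -?cardE //; move=> s s' /addrI/stp_inj.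
    by apply: fsubset_leq_card; apply/fsubsetP => _ /imfsetP[s + ->].
  have : #|` X `\` Nb U|%:R <= #|` X|%:R * (1 - d%:R / (2 * #|` M|)%:R) ^+ k :> R.
    rewrite -(ler_pM2r (exprn_gt0 k M2)) -mulrA -exprMn mulrBl mul1r divfK ?gt_eqF //.
    by rewrite -natrB // -!natrX -!natrM ler_nat.
  move/le_trans; apply; apply: ler_pM => //.
  - by rewrite exprn_ge0 // subr_ge0 ler_pdivrMr // mul1r ler_nat.
  - by rewrite -natrM ler_nat.
  have -> : (d%:R : R)^-1 = expR (- L) by rewrite expRN expL.
  apply: (@le_trans _ _ (expR (- (d%:R / (2 * #|` M|)%:R)) ^+ k)).
    apply: lerXn2r; rewrite ?nnegrE ?expR_ge0 //; last exact: expR_ge1Dx.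
    by rewrite subr_ge0 ler_pdivrMr // mul1r ler_nat.
  rewrite -expRM_natl ler_expR mulrN lerN2 mulrA ler_pdivlMr //.
  have Mr' : #|` M|%:R * r%:R <= 4 * d%:R * t%:R :> R by rewrite -!natrM ler_nat.
  have k1' : 8 * t%:R * L <= k%:R * r%:R by rewrite -ler_pdivrMr.
  rewrite -(ler_pM2r rR0) natrM.
  apply: (@le_trans _ _ (L * 2 * (4 * d%:R * t%:R))).
    rewrite -!mulrA ler_pM2l ?(lt_le_trans _ L1) // ler_pM2l // !mulrA.
    exact: Mr'.
  have := ler_wpM2r (ltW dR0) k1'; lra.
rewrite cardfsU; apply: (@le_trans _ _ (#|` U|%:R + #|` X `\` Nb U|%:R)).
  rewrite -natrD ler_nat (leq_trans (leq_subr _ _)) // leq_add2l.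
  by apply: leq_trans (leq_imfset_card _ _ _) _.
by apply: lerD => //; apply: le_trans k2; rewrite ler_nat.
Qed.

Lemma heavyP W x s : interface par W -> (x + stp s \in W) != (x \in W) ->
  x \in heavy W \/ x + stp s \in heavy W.
Proof.
move=> iW xs; have := gd_pair par_stp iW xs => h.
have inB y : (0 < gd W y)%N -> y \in W `|` Nb W.
  move=> /gd_gt0P[e]; rewrite in_fsetU in_Nb.
  case: (y \in W) => //=; case yW: (_ \in W) => //= _.
  by apply/existsP; exists e.
case: (leqP d (gd W x)) => hx; [left|right]; rewrite in_fset /= inE inB //=.
- exact: leq_trans hx.
- lia.
- lia.
Qed.

Lemma cover_set W : contour W -> (d <= excess par W)%N ->
  exists U : {fset V}, [/\ touched W (Nb U),
    forall a, a \in U -> exists x s, near 1 a x /\ (x + stp s \in W) != (x \in W)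
  & #|` U|%:R <= 21 * (excess par W)%:R * L / r%:R :> R].
Proof.
move=> [iW noiso _ _]; set t := excess par W => dt.
have t0 : (0 < t)%N by apply: leq_trans dt.
pose X := [fset x in heavy W | (d <= 2 * nb (mem (bigs W r)) x)%N].
have hv : (#|` heavy W| <= 4 * t)%N.
  rewrite -(leq_pmul2r d0) -mulnA [(t * d)%N]mulnC mulnA; apply: card_gd => // x.
  by rewrite in_fset /= inE => /andP[].
have [U1 [U1M XU1 U1c]] : exists U : {fset V}, [/\ U `<=` bigs W r, X `<=` Nb U &
    #|` U|%:R <= 8 * t%:R * L / r%:R + 1 + 4 * t%:R / d%:R :> R].
  apply: bigs_cover => //.
  - by apply: card_gd => // x; rewrite in_fset /= inE => /andP[].
  - apply: leq_trans hv; apply: fsubset_leq_card.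
    by apply/fsubsetP => x; rewrite in_fset /= inE => /andP[].
  - by move=> x; rewrite in_fset /= inE => /andP[].
exists (U1 `|` hubs par W r); split.
- have sub (A B : {fset V}) : A `<=` B -> {subset Nb A <= Nb B}.
    move=> AB x; rewrite !in_Nb => /existsP[s xs].
    by apply/existsP; exists s; apply: (fsubsetP AB).
  have cov x : x \in heavy W -> x \in Nb (U1 `|` hubs par W r).
    move=> xh; have [h|h] := heavy_dichotomy par_stp iW rled noiso d0 xh.
      apply: (sub U1 (U1 `|` hubs par W r) (fsubsetUl _ _) x).
      by apply: (fsubsetP XU1); rewrite in_fset /= inE xh.
    exact: (sub _ (U1 `|` hubs par W r) (fsubsetUr _ _) x h).
  by move=> x s /(heavyP iW)[] /cov ->; rewrite ?orbT.
- move=> a; rewrite inE => /orP[/(fsubsetP U1M)|].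
    rewrite in_fset /= inE => /andP[_ ra].
    have /gd_gt0P[s xs] : (0 < gd W a)%N by apply: leq_trans ra.
    by exists a, s; split => //; apply: near_refl.
  rewrite in_fset /= inE => /andP[_ /andP[_ h]].
  have /nb_gt0P[s /= hs] : (0 < nb (fun w => 2 * d < gd W w + r)%N a)%N by lia.
  have /gd_gt0P[s' xs'] : (0 < gd W (a + stp s)%R)%N by lia.
  by exists (a + stp s), s'; split => //; apply: near_step.
rewrite cardfsU; apply: (@le_trans _ _ (#|` U1|%:R + #|` hubs par W r|%:R)).
  by rewrite -natrD ler_nat leq_subr.
have hh := card_hubs par_stp iW rled d0.
have h1 : #|` hubs par W r|%:R <= 8 * t%:R / r%:R :> R.
  rewrite ler_pdivlMr // -!natrM ler_nat.
  have : (#|` hubs par W r| * (r * r) <= 8 * r * t)%N.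
    by apply: leq_trans hh; rewrite leq_mul2l rd orbT.
  by rewrite -(leq_pmul2l r0); nia.
have tr : 1 <= t%:R / r%:R :> R.
  by rewrite ler_pdivlMr // mul1r ler_nat (leq_trans rled).
have td : t%:R / d%:R <= t%:R / r%:R :> R.
  by rewrite ler_wpM2l // lef_pV2 ?posrE // ler_nat.
have tL : t%:R / r%:R <= t%:R / r%:R * L by rewrite ler_peMr // divr_ge0 // ltW.
(* 21 = 8 + 1 + 4 + 8: greedy choices, rounding, leftover sites and hubs, in units of t L / r. *)
apply: (le_trans (lerD U1c h1)).
have -> : 8 * t%:R * L / r%:R = 8 * (t%:R / r%:R * L) by ring.
have -> : 21 * t%:R * L / r%:R = 21 * (t%:R / r%:R * L) by ring.
rewrite -!mulrA; lra.
Qed.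

End CoverSet.

Section CoverList.
Variable R : realType.
Variable d : nat.
Local Notation V := 'rV[int]_d.
Local Notation D := ('I_d * bool)%type.
Variable par : pred V.
Hypothesis par_stp : forall x s, par (x + stp s) = ~~ par x.

(** The [d] neighbours of [u] in positive directions belong to [W] and lie on distinct lines
    parallel to the first axis, which gives [d] exits along it. *)
Lemma excess_ge_dim W u : interface par W -> u \in W -> ~~ par u ->
  (d <= excess par W)%N.
Proof.
move=> iW uW pu; have [d0|d0] := posnP d; first by rewrite [leqLHS]d0.
pose i0 := Ordinal d0.
pose A := [fset u + stp (i, false) | i in 'I_d].
have cA : #|` A| = d.
  rewrite card_imfset /= -?cardE ?card_ord // => i j /addrI/stp_inj.
  by case.
apply: (@leq_trans #|` A|); first by rewrite cA.
rewrite -(card_exits par_stp iW (i0, false)) //; apply: transversal_exits.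
  apply/fsubsetP => _ /imfsetP[i _ ->]; rewrite iW // uW.
  by case: (par u) pu.
move=> _ _ /imfsetP[i _ ->] /imfsetP[j _ ->] /= /forallP on.
suff -> : i = j by [].
apply/eqP; apply: contraT => ij.
have [ii|ii] := eqVneq i i0; last first.
  have /implyP/(_ ii)/eqP := on i; rewrite !mxE => /addrI; rewrite -!/(stp _) => e.
  by have := e; rewrite !eqxx /= (negPf ij) /= mulr1 mulr0.
have ji : j != i0 by rewrite -ii eq_sym.
have /implyP/(_ ji)/eqP := on j; rewrite !mxE => /addrI.
by rewrite !eqxx /= [j == i]eq_sym (negPf ij) /= mulr1 mulr0.
Qed.

(** The sites from [u] to the exit lie on distinct lines parallel to the second axis, so there are
    at most [excess] of them. This leaves only [t] starting points for the walk that encodes a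
    cover. *)
Lemma ray_exit W u (d1 : (1 < d)%N) : interface par W -> u \in W ->
  exists2 k, (k < excess par W)%N &
    let v := u + stp (Ordinal (ltnW d1), false) *+ k in
    v \in W /\ v + stp (Ordinal (ltnW d1), false) \notin W.
Proof.
set s0 := (_, _) => iW uW; pose n := exit_time W s0 u.
exists n; last first.
  split; first exact: exit_in uW (leqnn _).
  by have := exit_out W s0 u; rewrite mulrSr addrA.
pose s1 : D := (Ordinal d1, false).
pose A := [fset u + stp s0 *+ val k | k in 'I_n.+1].
have cA : #|` A| = n.+1.
  rewrite card_imfset /= -?cardE ?card_ord // => i j /addrI/stp_mulrn_inj e.
  exact: ord_inj e.
rewrite -cA -(card_exits par_stp iW s1) ?(ltnW d1) //; apply: transversal_exits.
  apply/fsubsetP => _ /imfsetP[k _ ->]; apply: (exit_in (k := val k)) => //.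
  by rewrite -ltnS; exact: ltn_ord.
move=> x y /imfsetP[i _ ->] /imfsetP[j _ ->] /= on; apply/eqP.
case: eqP => // /eqP ne; have := online_uniq ne on.
suff h : online s0.1 (u + stp s0 *+ val i) (u + stp s0 *+ val j).
  by move=> /(_ _ h) /(congr1 val).
apply/forallP => k; apply/implyP => k0.
by rewrite !mxE !mulmxnE !stp_coord (negPf k0) !mul0rn.
Qed.

Variable r : nat.
Hypotheses (r0 : (0 < r)%N) (rd : (r * r <= d)%N) (d5 : (5 <= d)%N).
Local Notation L := (ln (d%:R : R)).
Hypothesis L1 : 1 <= L.

Let d0 : (0 < d)%N. Proof. exact: leq_trans d5. Qed.
Let rled : (r <= d)%N. Proof. by apply: leq_trans rd; rewrite leq_pmulr. Qed.
Let dR0 : 0 < d%:R :> R. Proof. by rewrite ltr0n. Qed.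
Let rR0 : 0 < r%:R :> R. Proof. by rewrite ltr0n. Qed.
Let expL : expR L = d%:R. Proof. by rewrite lnK // posrE. Qed.

Lemma cover_list (u : V) (t : nat) : ~~ par u -> (d <= t)%N ->
  exists LU : seq {fset V},
    (size LU)%:R <= expR (400 * (t%:R * L ^+ 2 / r%:R)) /\
    forall W, contour par W -> u \in W -> excess par W = t ->
      exists U, [/\ U \in LU, touched W (Nb U) &
        #|` U|%:R <= 21 * t%:R * L / r%:R :> R].
Proof.
move=> pu dt; have d1 : (1 < d)%N by apply: leq_trans d5.
pose s0 : D := (Ordinal (ltnW d1), false).
(* A walk spends 2 * 4 + 1 = 9 letters per site of [U], as the sites are linked at distance 4. *)
pose N := (Num.truncn (9 * (21 * t%:R * L / r%:R) : R)).
pose Lk k := projT1 (cid (linked_list 4 (u + stp s0 *+ k) N)).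
have LkP k := projT2 (cid (linked_list 4 (u + stp s0 *+ k) N)).
exists (flatten [seq Lk k | k <- iota 0 t]); split; last first.
  move=> W cW uW Wt; have [iW noiso cn cnc] := cW.
  have [|U [tU bU cU]] := cover_set par_stp r0 rd L1 cW; first by rewrite Wt.
  exists U; rewrite -Wt; split => //; rewrite Wt in cU *.
  have [k + /= [vW vs]] := ray_exit d1 iW uW; rewrite Wt => kt.
  apply/flattenP; exists (Lk k); first by apply/map_f; rewrite mem_iota.
  have [_] := LkP k; apply; last first.
    rewrite -/N /N; suff : ((2 * 4 + 1) * #|` U|)%:R <= 9 * (21 * t%:R * L / r%:R) :> R.
      by move=> h; rewrite truncn_ge_nat // (le_trans _ h).
    by rewrite natrM ler_pM2l.
  move=> T TU TnU; have [T0|Tn0] := eqVneq T fset0.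
    have h b : near 4 (u + stp s0 *+ k) b -> b \in U ->
        exists a b, [/\ a \in (u + stp s0 *+ k) |` T, b \in U `\` T & near 4 a b].
      move=> nb bU'; exists (u + stp s0 *+ k), b.
      by rewrite T0 fsetD0 !inE eqxx.
    have : (u + stp s0 *+ k + stp s0 \in W) != (u + stp s0 *+ k \in W).
      by rewrite vW (negPf vs).
    move=> /tU/orP[]/Nb_near[b bU' nb]; apply: (h b) => //.
      exact: near_le (near_sym nb).
    by apply: near_le (near_trans (near_step _ _) (near_sym nb)).
  have [a [b [aT bT ab]]] := cover_linked cn cnc tU bU TU Tn0 TnU.
  by exists a, b; split => //; rewrite inE aT orbT.
have t0 : (0 < t)%N by apply: leq_trans dt.
have tR0 : 0 < t%:R :> R by rewrite ltr0n.
have size_le : (size (flatten [seq Lk k | k <- iota 0 t]) <= t * (4 * d + 2) ^ N)%N.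
  rewrite size_flatten /shape -map_comp sumnE big_map.
  rewrite -{2}(size_iota 0 t) -sum1_size big_distrl /=; apply: leq_sum => k _.
  by rewrite mul1n; have [] := LkP k.
apply: (@le_trans _ _ (t%:R * (d%:R ^+ 2) ^+ N)).
  rewrite -natrX -natrX -natrM ler_nat (leq_trans size_le) // leq_mul2l.
  have [->|N0] := posnP N; first by rewrite !expn0 orbT.
  (* The alphabet has [4 * d + 2] letters, at most [d ^ 2] from [d = 5] on. *)
  by rewrite leq_exp2r //; apply/orP; right; nia.
set q := t%:R / r%:R * L.
have q0 : 0 <= q by rewrite mulr_ge0 ?divr_ge0 ?(le_trans _ L1).
have tq : t%:R <= expR (2 * q).
  have -> : t%:R = d%:R * (t%:R / d%:R) :> R by rewrite mulrC divfK ?gt_eqF.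
  rewrite -[X in X * _]expL; apply: (@le_trans _ _ (expR L * expR (t%:R / d%:R))).
    rewrite ler_wpM2l ?expR_ge0 //; apply: le_trans (expR_ge1Dx _).
    by rewrite lerDr.
  rewrite -expRD ler_expR.
  have a1 : 1 <= t%:R / r%:R :> R.
    by rewrite ler_pdivlMr // mul1r ler_nat (leq_trans rled).
  have a2 : t%:R / d%:R <= t%:R / r%:R :> R.
    by rewrite ler_wpM2l // lef_pV2 ?posrE // ler_nat.
  have a3 : L <= q by rewrite /q ler_peMl // (le_trans _ L1).
  have a4 : t%:R / r%:R <= q by rewrite /q ler_peMr // (le_trans _ a1).
  lra.
have NN : N%:R <= 189 * q.
  apply: (@le_trans _ _ (9 * (21 * t%:R * L / r%:R))).
    by rewrite /N truncn_le // !mulr_ge0 ?invr_ge0 // (le_trans _ L1).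
  by rewrite /q; lra.
apply: (@le_trans _ _ (expR (2 * q) * expR (N%:R * (2 * L)))).
  by rewrite expRM_natl; apply: ler_pM => //; rewrite ?exprn_ge0 // expRM_natl expL.
rewrite -expRD ler_expR.
have -> : t%:R * L ^+ 2 / r%:R = q * L by rewrite /q; ring.
(* The total is 2 + 2 * 189 = 380 multiples of [q * L], below 400. *)
have b1 : q <= q * L by rewrite ler_peMr.
have b2 : N%:R * (2 * L) <= 189 * q * (2 * L).
  by rewrite ler_wpM2r // mulr_ge0 // (le_trans _ L1).
lra.
Qed.

End CoverList.

(** * Components of the complement of a cover *)

Section Components.
Variable d : nat.
Local Notation V := 'rV[int]_d.
Local Notation D := ('I_d * bool)%type.
Hypothesis d0 : (0 < d)%N.
Variable K : {fset V}.

Definition creach (x y : V) : Prop := reach (fun z => z \notin K) x y.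

(* Junk value fset0 when the component of x in the complement of K is infinite. *)
Definition comp (x : V) : {fset V} :=
  xget fset0 (fun A : {fset V} => forall y, y \in A <-> creach x y).

Definition fincomp (x : V) : Prop := forall y, y \in comp x <-> creach x y.

Lemma compE x (A : {fset V}) : (forall y, y \in A <-> creach x y) -> comp x = A.
Proof.
move=> AP; have cP : fincomp x.
  exact: (@xgetPex _ fset0 (fun B : {fset V} => forall y, y \in B <-> creach x y)
    (ex_intro _ A AP)).
by apply/fsetP => y; apply/idP/idP => [/cP/AP|/AP/cP].
Qed.

Lemma comp_eq x y : fincomp x -> y \in comp x -> comp y = comp x /\ fincomp y.
Proof.
move=> fx yx; have E : forall z, z \in comp x <-> creach y z.
  move=> z; split => [/fx xz|yz].
    by apply: reach_trans xz; apply: reach_sym; apply/fx.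
  by apply/fx; apply: reach_trans yz; apply/fx.
by have yE := compE E; split => // z; rewrite yE; apply: E.
Qed.

Lemma comp_refl x : fincomp x -> x \notin K -> x \in comp x.
Proof. by move=> fx xK; apply: (proj2 (fx x)); apply: (@reach_refl _ (fun z => z \notin K)). Qed.

Lemma comp_notin x y : fincomp x -> y \in comp x -> y \notin K.
Proof. by move=> fx /fx/reach_end. Qed.

Lemma comp_nb x y s : fincomp x -> y \in comp x -> y + stp s \notin comp x ->
  y + stp s \in K.
Proof.
move=> fx yx; apply: contraNT => yK; apply/fx.
apply: (@reach_trans _ _ _ y); first exact/fx.
by apply: reach_step => //; apply: comp_notin yx.
Qed.

Lemma comp_touch x : fincomp x -> x \notin K -> exists2 z, z \in comp x & z \in Nb K.
Proof.
move=> fx xK; pose s : D := (Ordinal d0, false).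
have xx := comp_refl fx xK; exists (x + stp s *+ exit_time (comp x) s x).
  exact: exit_in xx (leqnn _).
rewrite in_Nb; apply/existsP; exists s; apply: (comp_nb fx).
  exact: exit_in xx (leqnn _).
by have := exit_out (comp x) s x; rewrite mulrSr addrA.
Qed.

Definition rep (x : V) : V := head 0 [seq z <- comp x | z \in Nb K].

Lemma repP x : fincomp x -> x \notin K -> rep x \in comp x /\ rep x \in Nb K.
Proof.
move=> fx xK; have [z zx zN] := comp_touch fx xK.
have : rep x \in [seq z <- comp x | z \in Nb K].
  rewrite /rep; have : z \in [seq z <- comp x | z \in Nb K] by rewrite mem_filter zN.
  by case: [seq _ <- _ | _] => //= a l _; rewrite inE eqxx.
by rewrite mem_filter => /andP[].
Qed.

Definition threshold : nat := uphalf d.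

Definition smalls : {fset V} :=
  \bigcup_(z <- Nb K | `[< fincomp z >] && (#|` comp z| < threshold)%N) comp z.

(** A site in a component with fewer than d / 2 sites has at least [d] of its [2 * d] neighbours in
    [K], while a site of [K] has only [2 * d] edges. *)
Lemma card_smalls : (#|` smalls| <= 2 * #|` K|)%N.
Proof.
have dn : (0 < d)%N := d0.
suff : (#|` smalls| * d <= \sum_(y <- smalls) nb (mem K) y)%N.
  rewrite nb_swap => h; rewrite -(leq_pmul2r dn); apply: leq_trans h _.
  apply: (@leq_trans (#|` K| * (2 * d))); last by lia.
  by apply: sum_fset_ge => x _; apply: nb_le.
rewrite -sum1_size big_distrl /= big_seq [leqRHS]big_seq; apply: leq_sum => y.
rewrite mul1n => /bigfcupP[z /andP[_ /andP[/asboolP fz cz]] yz].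
have [yE fy] := comp_eq fz yz.
have h1 : (nb (predC (mem K)) y < threshold)%N.
  apply: leq_ltn_trans cz.
  have -> : nb (predC (mem K)) y =
      #|` [fset y + stp s | s in [pred s | y + stp s \notin K]]|.
    by rewrite card_imfset /= -?cardE //; move=> s t /addrI/stp_inj.
  apply: fsubset_leq_card; apply/fsubsetP => _ /imfsetP[s /= ys ->].
  rewrite -yE; apply/fy; apply: reach_step => //; exact: comp_notin yz.
have h2 := nbC (mem K) y; have h3 := odd_double_half d.
move: h1; rewrite /threshold uphalf_half.
move: (nb _ y) (nb _ y) h2 (leq_b1 (odd d)) h3 => a b; lia.
Qed.

Section Inside.
Variable W : {fset V}.
Hypothesis tW : touched W K.

Lemma creach_side x y : creach x y -> (y \in W) = (x \in W).
Proof.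
apply: (@reach_ind _ (fun z => z \notin K) (fun z => (z \in W) = (x \in W))) => //.
move=> z s <- zK zsK; apply/eqP; apply: contraT => /tW.
by rewrite (negPf zK) (negPf zsK).
Qed.

Lemma fincomp_in x : x \in W -> fincomp x.
Proof.
move=> xW; apply: (@xgetPex _ fset0
  (fun B : {fset V} => forall y, y \in B <-> creach x y)).
exists [fset y in W | `[< creach x y >]] => y.
rewrite !inE /=; split => [/andP[_ /asboolP]//|xy].
by rewrite (creach_side xy) xW; apply/asboolP.
Qed.

Lemma comp_sub x : x \in W -> comp x `<=` W.
Proof.
move=> xW; apply/fsubsetP => y /(fincomp_in xW)/creach_side ->.
exact: xW.
Qed.

Definition reps : {fset V} :=
  [fset rep x | x in [fset x in W | (x \notin K) && (threshold <= #|` comp x|)%N]].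

(** By [edge_isoperimetry] a component with at least d / 2 sites sends at least d^2 / 4 edges to
    [K]; distinct components use distinct edges, out of [2 * d] per site of [K]. *)
Lemma card_reps : (#|` reps| * d <= 8 * #|` K|)%N.
Proof.
have repsP z : z \in reps -> [/\ z \in W, z \notin K, (threshold <= #|` comp z|)%N,
    forall y, y \in comp z -> rep y = z & z \in Nb K].
  move=> /imfsetP[x /=]; rewrite !inE => /andP[xW /andP[xK hx]] ->.
  have fx := fincomp_in xW; have [rx rN] := repP fx xK.
  have [rE _] := comp_eq fx rx.
  split; rewrite ?rE //; first exact: (fsubsetP (comp_sub xW)).
    exact: comp_notin rx.
  by move=> y yr; rewrite /rep (comp_eq fx yr).1.
pose bk := [fset y in W | y \notin K].
have L1 : (\sum_(y <- bk) nb (mem K) y <= #|` K| * (2 * d))%N.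
  by rewrite nb_swap; apply: sum_fset_ge => x _; apply: nb_le.
have L2 : (\sum_(z <- reps) \sum_(y <- comp z) nb (mem K) y <=
           \sum_(y <- bk) nb (mem K) y)%N.
  apply: (@leq_trans (\sum_(z <- reps) \sum_(y <- bk) (rep y == z) * nb (mem K) y)).
    rewrite big_seq [leqRHS]big_seq; apply: leq_sum => z zr.
    have [zW zK _ ry _] := repsP _ zr.
    rewrite big_seq (eq_bigr (fun y => (rep y == z) * nb (mem K) y)%N); last first.
      by move=> y /ry ->; rewrite eqxx mul1n.
    rewrite -big_seq; apply: sum_fset_subset; apply/fsubsetP => y yz.
    by rewrite !inE (fsubsetP (comp_sub zW) _ yz) (comp_notin (fincomp_in zW) yz).
  rewrite exchange_big /=; apply: leq_sum => y _; rewrite -big_distrl /=.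
  rewrite -[leqRHS]mul1n leq_mul2r; apply/orP; right.
  have -> : (\sum_(z <- reps) (rep y == z) = count_mem (rep y) reps)%N.
    rewrite -sum1_count [RHS]big_mkcond; apply: eq_bigr => z _ /=.
    by rewrite eq_sym; case: (_ == _).
  by rewrite count_uniq_mem ?fset_uniq // leq_b1.
have L3 : (#|` reps| * (threshold * (d - threshold + 1)) <=
           \sum_(z <- reps) \sum_(y <- comp z) nb (mem K) y)%N.
  rewrite -sum1_size big_distrl /= big_seq [leqRHS]big_seq; apply: leq_sum => z zr.
  have [zW zK hz _ _] := repsP _ zr; rewrite mul1n.
  apply: (@leq_trans (\sum_(y <- comp z) nb (fun w => w \notin comp z) y)).
    apply: edge_isoperimetry => //; first by rewrite uphalf_gt0.
    by rewrite /threshold leq_uphalf_double; lia.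
  rewrite big_seq [leqRHS]big_seq; apply: leq_sum => y yz; apply: nb_sub => s.
  exact: comp_nb (fincomp_in zW) yz.
have h : (d * d <= 4 * (threshold * (d - threshold + 1)))%N.
  have := odd_double_half d; rewrite /threshold uphalf_half.
  case: (odd d); set k := d./2; rewrite -addnn; nia.
nia.
Qed.

Definition bulk (Rp : {fset V}) (par : pred V) : {fset V} :=
  [fset y in \bigcup_(z <- Rp) comp z | par y].

Lemma reps_sub : reps `<=` Nb K.
Proof.
apply/fsubsetP => z /imfsetP[x /=]; rewrite !inE => /andP[xW /andP[xK hx]] ->.
exact: (repP (fincomp_in xW) xK).2.
Qed.

Lemma bulk_sub par : bulk reps par `<=` evens par W.
Proof.
apply/fsubsetP => y; rewrite in_fset /= inE => /andP[/bigfcupP[z /andP[zr _] yz] py].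
rewrite !inE py andbT; move: zr => /imfsetP[x /=]; rewrite !inE => /andP[xW /andP[xK hx]] zE.
have fx := fincomp_in xW; have [rx rN] := repP fx xK.
move: yz; rewrite zE (comp_eq fx rx).1; exact: (fsubsetP (comp_sub xW)).
Qed.

Lemma bulk_rest par : evens par W `\` bulk reps par `<=` K `|` smalls.
Proof.
apply/fsubsetP => y; rewrite in_fsetD in_fset /= inE => /andP[yb].
rewrite !inE => /andP[yW py]; apply/orP.
case: (boolP (y \in K)) => yK; [by left|right].
have fy := fincomp_in yW; have [ry rN] := repP fy yK.
have [rE fr] := comp_eq fy ry.
case: (ltnP #|` comp y| threshold) => hy.
  apply/bigfcupP; exists (rep y); last by rewrite rE; apply: comp_refl.
  by rewrite rN rE hy andbT; apply/asboolP.
case/negP: yb; rewrite py andbT; apply/bigfcupP; exists (rep y).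
  by rewrite andbT; apply/imfsetP; exists y; rewrite //= !inE yW yK.
by rewrite rE; apply: comp_refl.
Qed.

End Inside.
End Components.

(** A cover [K] of the boundary edges leaves each component of its complement on one side. Only the
    large components inside are named, through their representatives; the small ones and [K] stay
    undecided, at most [3 * #|K|] sites. *)
Lemma bulk_list (R : realType) (d : nat) (par : pred 'rV[int]_d) (K : {fset 'rV[int]_d})
    (kappa l : R) : (0 < d)%N -> 0 <= l -> 8 * #|` K|%:R <= kappa * d%:R ->
  exists L : seq {fset 'rV[int]_d},
    (size L)%:R <= expR (kappa * l + 2 * d%:R * #|` K|%:R * expR (- l)) /\
    forall W, touched W K -> exists F, [/\ F \in L, F `<=` evens par W &
      evens par W `\` F `<=` K `|` smalls K].
Proof.
move=> d0 l0 hK; have [L [sL LP]] := few_subsets (Nb K) kappa l0.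
exists [seq bulk K Rp par | Rp <- L]; split.
  rewrite size_map; apply: (le_trans sL); rewrite ler_expR lerD2l ler_wpM2r ?expR_ge0 //.
  apply: (@le_trans _ _ (#|` K| * (2 * d))%:R); first by rewrite ler_nat card_Nb.
  by rewrite !natrM mulrC.
move=> W tW; exists (bulk K (reps K W) par); split.
- apply/map_f/LP; first exact: reps_sub.
  rewrite -(ler_pM2r (x := d%:R)) ?ltr0n //; apply: le_trans hK.
  by rewrite -!natrM ler_nat; apply: card_reps.
- exact: bulk_sub.
- exact: bulk_rest.
Qed.

(** * Refining an approximation *)

Section Refine.
Variable d : nat.
Local Notation V := 'rV[int]_d.
Local Notation D := ('I_d * bool)%type.
Variable par : pred V.
Hypothesis par_stp : forall x s, par (x + stp s) = ~~ par x.
Hypothesis d0 : (0 < d)%N.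

Lemma nb_card (A : {fset V}) y :
  nb (mem A) y = #|` [fset y + stp s | s in [pred s | y + stp s \in A]]|.
Proof. by rewrite card_imfset /= -?cardE //; move=> s t /addrI/stp_inj. Qed.

Lemma nb_mem (A : {fset V}) y : (nb (mem A) y + nb (predC (mem A)) y = 2 * d)%N.
Proof. exact: nbC. Qed.

Lemma Nb_subset (A B : {fset V}) : A `<=` B -> Nb A `<=` Nb B.
Proof.
move=> AB; apply/fsubsetP => x; rewrite !in_Nb => /existsP[s xs].
by apply/existsP; exists s; apply: (fsubsetP AB).
Qed.

(** While some site of [P] sees more than [th] of the remaining sites of [G], add it to [Y] and
    delete its neighbours; each round deletes more than [th]. *)
Lemma hitting_set th (P G : {fset V}) : exists Y : {fset V},
  [/\ Y `<=` P `&` Nb G, (#|` Y| * th <= #|` G|)%N &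
    forall y, y \in P -> (nb (mem (G `\` Nb Y)) y <= th)%N].
Proof.
have [n] := ubnP #|` G|; elim: n G => // n IH G Gn.
have [[y yP yG]|none] := pselect (exists2 y, y \in P & (th < nb (mem G) y)%N); last first.
  exists fset0; rewrite cardfs0 mul0n fsub0set; split => // y yP.
  apply: (@leq_trans (nb (mem G) y)); first by apply: nb_sub => s; rewrite !inE => /andP[].
  by rewrite leqNgt; apply/negP => h; apply: none; exists y.
pose G' := G `\` Nb [fset y].
have cG : (#|` G'| + nb (mem G) y <= #|` G|)%N.
  rewrite nb_card -(cardfsID (Nb [fset y]) G) addnC leq_add2r.
  apply: fsubset_leq_card; apply/fsubsetP => _ /imfsetP[s /= ys ->].
  by rewrite inE (ys : _ \in G) mem_Nb // inE.
have [|Y [YP Yc Yh]] := IH G'; first by lia.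
exists (y |` Y); split.
- rewrite fsubUset fsub1set inE yP /=; apply/andP; split.
    have /nb_gt0P[s ys] : (0 < nb (mem G) y)%N by lia.
    by rewrite in_Nb; apply/existsP; exists s.
  apply: (fsubset_trans YP); apply: fsetIS; apply: Nb_subset; exact: fsubsetDl.
- rewrite cardfsU1; move: (leq_b1 (y \notin Y)); nia.
move=> z zP; apply: leq_trans (Yh z zP); apply: nb_sub => s /=.
rewrite !in_fsetD => /andP[zN ->]; rewrite andbT; apply/andP; split.
  apply: contra zN; apply: (fsubsetP (Nb_subset _)); exact: fsubsetUr.
by apply: contra zN; apply: (fsubsetP (Nb_subset _)); exact: fsubsetUl.
Qed.

(** [th] is the tolerated ambiguity: of an odd candidate towards sites not known to be inside, and
    of an undecided even site towards candidates. It is used with the value [d], then [r]. *)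
Definition approx (th : nat) (W F S : {fset V}) : Prop :=
  [/\ F `<=` evens par W, odds par W `<=` S,
     forall y, y \in S -> ~~ par y /\ (nb (predC (mem F)) y <= th)%N
   & forall v, par v -> v \notin F -> (nb (mem S) v <= th)%N].

Definition nearby (S F : {fset V}) : {fset V} := [fset v in Nb S `\` F | par v].

Section ApproxFacts.
Variable W : {fset V}.
Hypotheses (iW : interface par W)
  (noiso : forall x, exists s, (x + stp s \in W) = (x \in W)).
Local Notation t := (excess par W).

Lemma evens_Nb_odds : evens par W `<=` Nb (odds par W).
Proof.
apply/fsubsetP => x; rewrite !inE => /andP[xW px]; have [s xs] := noiso x.
by rewrite in_Nb; apply/existsP; exists s; rewrite !inE xs xW par_stp px.
Qed.

Lemma odds_nb y s : y \in odds par W -> y + stp s \in evens par W.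
Proof.
by rewrite !inE => /andP[yW py]; rewrite iW ?yW ?par_stp.
Qed.

(** Sites misplaced by an approximation see mostly the other side of the boundary, so their degree
    is at least [d], and the degree sum leaves room for [4 * t] of them. *)
Lemma wrong_degree (A : {fset V}) th : (th <= d)%N ->
  (forall x, x \in A -> (2 * d <= gd W x + th)%N) -> (#|` A| <= 4 * t)%N.
Proof.
move=> thd h; rewrite -(leq_pmul2r d0) -mulnA [(t * d)%N]mulnC mulnA.
by apply: (card_gd par_stp iW) => x /h; lia.
Qed.

Lemma outside_wrong (S F : {fset V}) th : (th <= d)%N -> F `<=` evens par W ->
  (forall y, y \in S -> ~~ par y /\ (nb (predC (mem F)) y <= th)%N) ->
  (#|` S `\` odds par W| <= 4 * t)%N.
Proof.
move=> thd FE SP; apply: (wrong_degree thd) => y; rewrite !inE => /andP[yO /SP[py yF]].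
have yW : y \notin W by move: yO; rewrite py andbT.
have := nb_mem F y; suff : (nb (mem F) y <= gd W y)%N by lia.
apply: nb_sub => s /(fsubsetP FE); rewrite !inE => /andP[-> _].
by rewrite (negPf yW).
Qed.

Lemma inside_wrong (S F : {fset V}) th : (th <= d)%N -> odds par W `<=` S ->
  (forall v, par v -> v \notin F -> (nb (mem S) v <= th)%N) ->
  (#|` evens par W `\` F| <= 4 * t)%N.
Proof.
move=> thd OS FP; apply: (wrong_degree thd) => v; rewrite !inE => /andP[vF /andP[vW pv]].
have := nb_mem S v; have := FP v pv vF.
suff : (nb (predC (mem S)) v <= gd W v)%N by lia.
apply: nb_sub => s /= vs; rewrite vW eqb_id; apply: contra vs => vsW.
by apply: (fsubsetP OS); rewrite !inE vsW par_stp pv.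
Qed.

(** A true odd site has all its neighbours in [evens par W], so its edges out of [F] end in the at
    most [4 * t] even sites missed, each receiving at most [th]. The at most [4 * t] false
    candidates have at most [th] such edges each. *)
Lemma approx_edges th F S : (th <= d)%N -> approx th W F S ->
  (\sum_(y <- S) nb (predC (mem F)) y <= 8 * t * th)%N.
Proof.
move=> thd [FE OS SP FP]; rewrite (big_fsetID _ (mem (odds par W))) /=.
have -> : (8 * t * th = 4 * t * th + 4 * t * th)%N by lia.
apply: leq_add.
  have -> : [fset x in S | x \in odds par W] = odds par W.
    apply/fsetP => x; rewrite in_fset /= inE andbC; case: (boolP (x \in odds par W)) => //=.
    exact: (fsubsetP OS).
  apply: (@leq_trans (\sum_(y <- odds par W) nb (mem (evens par W `\` F)) y)%N).
    rewrite big_seq [leqRHS]big_seq; apply: leq_sum => y yO; apply: nb_sub => s /= ys.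
    by rewrite inE ys odds_nb.
  rewrite nb_swap; apply: (@leq_trans (#|` evens par W `\` F| * th)).
    apply: sum_fset_ge => v; rewrite 3!inE => /andP[vF /andP[vW pv]].
    apply: leq_trans (FP v pv vF); apply: nb_sub => s; exact: (fsubsetP OS).
  by rewrite leq_mul2r (inside_wrong thd OS FP) orbT.
apply: (@leq_trans (#|` S `\` odds par W| * th)).
  have -> : [fset x in S | x \notin odds par W] = S `\` odds par W.
    by apply/fsetP => x; rewrite !inE andbC.
  by apply: sum_fset_ge => y; rewrite inE => /andP[_ /SP[]].
by rewrite leq_mul2r (outside_wrong thd FE SP) orbT.
Qed.

Lemma card_nearby S F : (#|` nearby S F| <= \sum_(y <- S) nb (predC (mem F)) y)%N.
Proof.
apply: (@leq_trans (\sum_(y <- S) nb (mem (nearby S F)) y)); last first.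
  apply: leq_sum => y _; apply: nb_sub => s /=; rewrite in_fset /= inE inE.
  by move=> /andP[/andP[]].
rewrite nb_swap -sum1_size big_seq [leqRHS]big_seq; apply: leq_sum => v.
rewrite in_fset /= inE in_fsetD => /andP[/andP[_ vN] _].
by apply/nb_gt0P; move: vN; rewrite in_Nb => /existsP[s vs]; exists s.
Qed.

Lemma approx_nearby th F S : approx th W F S -> evens par W `\` F `<=` nearby S F.
Proof.
move=> [FE OS SP FP]; apply/fsubsetP => v; rewrite in_fsetD => /andP[vF vE].
rewrite in_fset /= inE in_fsetD vF /=; apply/andP; split; last first.
  by move: vE; rewrite !inE => /andP[].
exact: (fsubsetP (fsubset_trans evens_Nb_odds (Nb_subset OS))).
Qed.

Lemma approx_card th F S : (th <= d)%N -> approx th W F S ->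
  (#|` S| * (2 * d) <= #|` F| * (2 * d) + 8 * t * th)%N.
Proof.
move=> thd aF; apply: leq_trans (leq_add (leqnn _) (approx_edges thd aF)).
rewrite mulnC -sum1_size big_distrr /=.
apply: (@leq_trans (\sum_(y <- S) nb (mem F) y + \sum_(y <- S) nb (predC (mem F)) y)).
  by rewrite -big_split /=; apply: leq_sum => y _; rewrite nb_mem muln1.
by rewrite leq_add2r nb_swap; apply: sum_fset_ge => x _; apply: nb_le.
Qed.

(* The two greedy stages: Y enlarges the even part, then Vs shrinks the odd part. *)
Definition stage1S th (F1 : {fset V}) :=
  [fset y in Nb F1 | ~~ par y && (nb (predC (mem F1)) y <= th)%N].
Definition stage2S (S1 Vs : {fset V}) := S1 `\` Nb Vs.
Definition stage2F th (F1 S2 : {fset V}) :=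
  F1 `|` [fset v in Nb S2 | par v && (th < nb (mem S2) v)%N].

(** Both moves are safe: [Y] consists of odd sites of [W], so its neighbours are inside and may join
    [F]; [Vs] consists of even sites outside [W], so its neighbours are outside and may leave [S].
    By the hitting property true odd sites pass the test in [stage1S], and an even site with more
    than [th] neighbours in [S2] can only be inside. The sites hit by [Vs] are false candidates, at
    most [4 * t]. *)
Lemma refine th F0 : (th <= d)%N -> F0 `<=` evens par W ->
  exists Y Vs, let F1 := F0 `|` Nb Y in let S1 := stage1S th F1 in
    let S2 := stage2S S1 Vs in
    [/\ Y `<=` Nb (evens par W `\` F0), (#|` Y| * th <= #|` evens par W `\` F0|)%N,
        Vs `<=` nearby S1 F1, (#|` Vs| * th <= 4 * t)%N
      & (#|` nearby S1 F1| <= 2 * d * (4 * t + #|` evens par W `\` F0|))%N /\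
        approx th W (stage2F th F1 S2) S2].
Proof.
move=> thd F0E; have [Y [YP Yc Yh]] := hitting_set th (odds par W) (evens par W `\` F0).
pose F1 := F0 `|` Nb Y; pose S1 := stage1S th F1.
have YO : Y `<=` odds par W by apply: fsubset_trans YP (fsubsetIl _ _).
have F1E : F1 `<=` evens par W.
  rewrite fsubUset F0E; apply/fsubsetP => v; rewrite in_Nb => /existsP[s /(fsubsetP YO)].
  by move=> /odds_nb => /(_ (opp s)); rewrite stpN addrK.
have OS1 : odds par W `<=` S1.
  apply/fsubsetP => y yO.
  have yF : (nb (predC (mem F1)) y <= th)%N.
    apply: leq_trans (Yh y yO); apply: nb_sub => s /=; rewrite 3!inE negb_or => /andP[-> ->].
    by rewrite odds_nb.
  rewrite in_fset /= inE yF andbT; apply/andP; split; last by move: yO; rewrite !inE => /andP[].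
  have /nb_gt0P[s ys] : (0 < nb (mem F1) y)%N by have := nb_mem F1 y; lia.
  by rewrite in_Nb; apply/existsP; exists s.
have S1P y : y \in S1 -> ~~ par y /\ (nb (predC (mem F1)) y <= th)%N.
  by rewrite in_fset /= inE => /andP[_ /andP[]].
have [Vs [VP Vc Vh]] := hitting_set th (nearby S1 F1 `\` evens par W) (S1 `\` odds par W).
have VE : Vs `<=` nearby S1 F1 `\` evens par W by apply: fsubset_trans VP (fsubsetIl _ _).
have Vout v s : v \in Vs -> v + stp s \notin W.
  move=> /(fsubsetP VE); rewrite in_fsetD [v \in nearby _ _]in_fset /= inE.
  move=> /andP[vE /andP[_ pv]]; have vW : v \notin W by move: vE; rewrite !inE pv andbT.
  by rewrite iW ?(negPf vW) ?pv.
pose S2 := stage2S S1 Vs.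
have OS2 : odds par W `<=` S2.
  apply/fsubsetP => y yO; rewrite in_fsetD (fsubsetP OS1 _ yO) andbT.
  rewrite in_Nb; apply/existsP => -[s ys].
  have := Vout _ (opp s) ys; rewrite stpN addrK.
  by move: yO; rewrite !inE => /andP[->].
have S2P y : y \in S2 -> ~~ par y /\ (nb (predC (mem F1)) y <= th)%N.
  by rewrite inE => /andP[_ /S1P].
have out v : par v -> v \notin W -> (nb (mem S2) v <= th)%N.
  move=> pv vW; have vF1 : v \notin F1.
    by apply: contra vW => /(fsubsetP F1E); rewrite !inE => /andP[].
  case: (boolP (v \in Nb S1)) => vS.
    apply: (@leq_trans (nb (mem (S1 `\` odds par W `\` Nb Vs)) v)).
      apply: nb_sub => s /=; rewrite !in_fsetD => /andP[-> ->]; rewrite andbT /=.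
      by rewrite !inE iW ?(negPf vW) ?pv.
    apply: Vh; rewrite in_fsetD; apply/andP; split; first by rewrite !inE (negPf vW).
    by rewrite in_fset /= inE in_fsetD vF1 vS pv.
  rewrite leqNgt; apply/negP => h; have /nb_gt0P[s /= vs] := leq_ltn_trans (leq0n th) h.
  case/negP: vS; rewrite in_Nb; apply/existsP; exists s.
  by move: vs; rewrite inE => /andP[].
exists Y, Vs; split => //.
- exact: fsubset_trans YP (fsubsetIr _ _).
- exact: fsubset_trans VE (fsubsetDl _ _).
- exact: leq_trans Vc (outside_wrong thd F1E S1P).
split.
  apply: leq_trans (card_nearby _ _) _; rewrite (big_fsetID _ (mem (odds par W))) /=.
  have oc := outside_wrong thd F1E S1P.
  rewrite mulnDr addnC; apply: leq_add.
    apply: (@leq_trans (#|` S1 `\` odds par W| * (2 * d))); last by nia.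
    have -> : [fset x in S1 | x \notin odds par W] = S1 `\` odds par W.
      by apply/fsetP => x; rewrite !inE andbC.
    by apply: sum_fset_ge => y _; apply: nb_le.
  have -> : [fset x in S1 | x \in odds par W] = odds par W.
    apply/fsetP => x; rewrite in_fset /= inE andbC; case: (boolP (x \in odds par W)) => //=.
    exact: (fsubsetP OS1).
  apply: (@leq_trans (\sum_(y <- odds par W) nb (mem (evens par W `\` F0)) y)%N).
    rewrite big_seq [leqRHS]big_seq; apply: leq_sum => y yO; apply: nb_sub => s /=.
    rewrite in_fsetU negb_or => /andP[yF _].
    by rewrite in_fsetD yF odds_nb.
  rewrite nb_swap mulnC; apply: sum_fset_ge => y _; exact: nb_le.
split.
- rewrite fsubUset F1E; apply/fsubsetP => v; rewrite in_fset /= inE => /andP[_ /andP[pv vS]].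
  rewrite !inE pv andbT; apply/negPn/negP => vW.
  by have := out v pv vW; rewrite leqNgt vS.
- exact: OS2.
- move=> y yS; have [py yF] := S2P y yS; split => //; apply: leq_trans yF.
  apply: nb_sub => s /=; apply: contra => h; rewrite /stage2F in_fsetU.
  by apply/orP; left.
- move=> v pv; rewrite in_fsetU negb_or => /andP[vF1]; rewrite in_fset /= inE pv /=.
  case: (boolP (v \in Nb S2)) => /= [_|vN _]; first by rewrite -leqNgt.
  rewrite leqNgt; apply/negP => h; have /nb_gt0P[s /= vs] : (0 < nb (mem S2) v)%N by exact: leq_ltn_trans h.
  by case/negP: vN; rewrite in_Nb; apply/existsP; exists s.
Qed.

End ApproxFacts.

Lemma refine_list (R : realType) (t th : nat) (F0 T0 : {fset V}) (kappa N l : R) :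
  (th <= d)%N -> (0 < th)%N -> 0 <= l -> #|` T0|%:R <= N -> 4 * t%:R <= N ->
  4 * t%:R <= kappa * th%:R ->
  exists Lst : seq ({fset V} * {fset V}),
    (size Lst)%:R <= expR (2 * kappa * l + 6 * d%:R * N * expR (- l)) /\
    forall W, contour par W -> excess par W = t -> F0 `<=` evens par W ->
      evens par W `\` F0 `<=` T0 -> #|` evens par W `\` F0|%:R <= kappa * th%:R ->
      exists p, p \in Lst /\ approx th W p.1 p.2.
Proof.
move=> thd th0 l0 TN tN tk; have [LY [sY YP]] := few_subsets (Nb T0) kappa l0.
pose F1 Y := F0 `|` Nb Y; pose S1 Y := stage1S th (F1 Y).
(* For a [Y] that does not come from a contour the second candidate set may be huge; such [Y] get an
   empty list. *)
pose ok Y := #|` nearby (S1 Y) (F1 Y)|%:R <= 4 * d%:R * N.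
pose LV Y := if ok Y then projT1 (cid (few_subsets (nearby (S1 Y) (F1 Y)) kappa l0))
             else [::].
pose mk Y Vs := (stage2F th (F1 Y) (stage2S (S1 Y) Vs), stage2S (S1 Y) Vs).
exists (flatten [seq [seq mk Y Vs | Vs <- LV Y] | Y <- LY]); split; last first.
  move=> W [iW noiso _ _] Wt F0E ET Ek.
  have [Y [Vs [YN Yc VN Vc [nc ap]]]] := refine iW thd F0E.
  have th0R : 0 < th%:R :> R by rewrite ltr0n.
  have okY : ok Y.
    rewrite /ok; apply: (@le_trans _ _ (2 * d * (4 * t + #|` T0|))%:R).
      rewrite ler_nat; apply: leq_trans nc _; rewrite Wt leq_mul2l leq_add2l.
      by rewrite fsubset_leq_card // orbT.
    rewrite natrM natrM natrD natrM -!mulrA.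
    have -> : 4 * (d%:R * N) = 2 * (d%:R * (N + N)) by ring.
    by rewrite ler_pM2l // ler_wpM2l // lerD.
  exists (mk Y Vs); split => //; apply/flattenP.
  exists [seq mk Y Vs | Vs <- LV Y].
    apply/map_f/YP; first by apply: fsubset_trans YN (Nb_subset ET).
    rewrite -(ler_pM2r th0R); apply: le_trans Ek.
    by rewrite -natrM ler_nat.
  apply: map_f; rewrite /LV okY; have [_] := projT2 (cid (few_subsets (nearby (S1 Y) (F1 Y)) kappa l0)).
  apply => //; rewrite -(ler_pM2r th0R); apply: le_trans tk.
  by rewrite -!natrM ler_nat -Wt.
rewrite size_flatten /shape -map_comp sumnE big_map natr_sum.
have sV Y : (size (LV Y))%:R <= expR (kappa * l + 4 * d%:R * N * expR (- l)).
  rewrite /LV; case: ifP => okY; last by rewrite expR_ge0.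
  have [h _] := projT2 (cid (few_subsets (nearby (S1 Y) (F1 Y)) kappa l0)).
  by apply: (le_trans h); rewrite ler_expR lerD2l ler_wpM2r ?expR_ge0.
apply: (@le_trans _ _ ((size LY)%:R * expR (kappa * l + 4 * d%:R * N * expR (- l)))).
  rewrite -sum1_size natr_sum mulr_suml; apply: ler_sum => Y _.
  by rewrite /= size_map mul1r.
have -> : 2 * kappa * l + 6 * d%:R * N * expR (- l) =
  (kappa * l + 2 * d%:R * N * expR (- l)) + (kappa * l + 4 * d%:R * N * expR (- l)) by ring.
rewrite [leRHS]expRD ler_wpM2r ?expR_ge0 //; apply: (le_trans sY).
rewrite ler_expR lerD2l ler_wpM2r ?expR_ge0 //.
apply: (@le_trans _ _ (#|` T0| * (2 * d))%:R); first by rewrite ler_nat card_Nb.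
by rewrite natrM mulrC natrM ler_wpM2l // mulr_ge0.
Qed.

End Refine.

(** * Counting by successive labels *)

Section Listed.
Variables (R : realType) (X : Type).

Definition listed (A : eqType) (c : R) (C : X -> Prop) (good : X -> A -> Prop) :=
  exists L : seq A, (size L)%:R <= expR c /\
    forall x, C x -> exists2 a, a \in L & good x a.

Lemma listed_bind (A B : eqType) c1 c2 C (good1 : X -> A -> Prop)
    (good2 : X -> B -> Prop) :
  listed c1 C good1 ->
  (forall a, listed c2 (fun x => C x /\ good1 x a) good2) ->
  listed (c1 + c2) C good2.
Proof.
move=> [L1 [s1 P1]] /choice[f fP].
exists (flatten (map f L1)); split; last first.
  move=> x Cx; have [a aL ga] := P1 x Cx; have [_ /(_ x (conj Cx ga))[b bL gb]] := fP a.
  by exists b => //; apply/flattenP; exists (f a) => //; apply: map_f.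
rewrite size_flatten /shape -map_comp sumnE big_map natr_sum expRD.
apply: (@le_trans _ _ ((size L1)%:R * expR c2)); last by rewrite ler_wpM2r ?expR_ge0.
rewrite -sum1_size natr_sum mulr_suml; apply: ler_sum => a _.
by rewrite mul1r; have [] := fP a.
Qed.

(** An empty class needs no label; otherwise a member of the class may be used to bound sizes that
    depend only on the labels already chosen. *)
Lemma listed_assume (A : eqType) c C (good : X -> A -> Prop) :
  ((exists x, C x) -> listed c C good) -> listed c C good.
Proof.
have [ex|nex] := pselect (exists x, C x); first by apply.
by move=> _; exists [::]; rewrite expR_ge0; split => // x Cx; case: nex; exists x.
Qed.

End Listed.

Section ApproxList.
Variable R : realType.
Variable d : nat.
Local Notation V := 'rV[int]_d.
Local Notation D := ('I_d * bool)%type.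
Variable par : pred V.
Hypothesis par_stp : forall x s, par (x + stp s) = ~~ par x.
Variable r : nat.
Hypotheses (r0 : (0 < r)%N) (rd : (r * r <= d)%N) (d5 : (5 <= d)%N).
Local Notation L := (ln (d%:R : R)).
Hypothesis L1 : 1 <= L.

Let d0 : (0 < d)%N. Proof. exact: leq_trans d5. Qed.
Let rled : (r <= d)%N. Proof. by apply: leq_trans rd; rewrite leq_pmulr. Qed.
Let dR0 : 0 < d%:R :> R. Proof. by rewrite ltr0n. Qed.
Let rR0 : 0 < r%:R :> R. Proof. by rewrite ltr0n. Qed.
Let L0 : 0 <= L. Proof. exact: le_trans L1. Qed.
Let expL : expR L = d%:R. Proof. by rewrite lnK // posrE. Qed.
Let exp3L : expR (- (3 * L)) = (d%:R ^+ 3)^-1.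
Proof. by rewrite expRN mulrC expRM_natr expL. Qed.

Definition through (u : V) (t : nat) (W : {fset V}) : Prop :=
  [/\ contour par W, u \in W & excess par W = t].

(** The refinement has two stages because the components leave up to [6 * d * m] even sites
    undecided: hitting these at [th = r] would allow [6 * d * m / r] names, at least of order
    [t * L]. The stage [th = d] needs [6 * m] names and leaves at most [4 * t] sites missing, after
    which [4 * t / r] names suffice for [th = r]. *)
Lemma approx_list (u : V) (t : nat) : ~~ par u -> (d <= t)%N ->
  @listed R {fset V} ({fset V} * {fset V})%type (4000 * (t%:R * L ^+ 2 / r%:R))
    (through u t) (fun W p => approx par r W p.1 p.2).
Proof.
move=> pu dt; set q := t%:R * L ^+ 2 / r%:R.
have t0 : (0 < t)%N by apply: leq_trans dt.
have tR0 : 0 < t%:R :> R by rewrite ltr0n.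
pose p : R := t%:R * L / r%:R.
have p0 : 0 <= p by rewrite !mulr_ge0 ?invr_ge0 //; exact: ltW.
have qE : q = p * L by rewrite /q /p; ring.
have pq : p <= q by rewrite qE ler_peMr.
pose m : R := 21 * p.
have m0 : 0 <= m by rewrite mulr_ge0.
have trp : t%:R / r%:R <= p by rewrite /p mulrAC ler_peMr // divr_ge0.
have td : t%:R <= p * d%:R.
  have -> : p * d%:R = t%:R * (L * (d%:R / r%:R)) by rewrite /p; ring.
  rewrite ler_peMr ?(ltW tR0) // mulr_ege1 //.
  by rewrite ler_pdivlMr // mul1r ler_nat.
have ddd : d%:R ^+ 3 = d%:R * d%:R * d%:R :> R by rewrite !exprS expr0; ring.
(* The budget for cover, components, coarse stage and fine stage. With [l = 3 * L] the factor
   [expR (- l)] is d^-3, which beats the d^2 coming from the candidate sets. *)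
have -> : 4000 * q = 400 * q + ((48 * m * L + 4 * m) +
    ((36 * m * L + 36 * m) + (4000 * q - 400 * q - 84 * m * L - 40 * m))) by ring.
apply: (@listed_bind _ _ {fset V} _ _ _ _ (fun W U => touched W (Nb U) /\ #|` U|%:R <= m)).
  have [LU [sU UP]] := cover_list (R := R) par_stp r0 rd d5 L1 pu dt.
  exists LU; split => // W [cW uW Wt]; have [U [UL tU cU]] := UP W cW uW Wt.
  exists U => //; split => //; apply: (le_trans cU).
  by rewrite /m /p !mulrA.
move=> U; apply: listed_assume => -[_ [_ [_ cU]]].
pose K := Nb U; have cK : #|` K|%:R <= 2 * d%:R * m.
  apply: (@le_trans _ _ (#|` U| * (2 * d))%:R); first by rewrite ler_nat card_Nb.
  by rewrite natrM mulrC natrM ler_wpM2l // mulr_ge0.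
apply: (@listed_bind _ _ {fset V} _ _ _ _ (fun W F => F `<=` evens par W /\
    evens par W `\` F `<=` K `|` smalls K)).
  have [||Lb [sb bP]] := bulk_list par (K := K) (kappa := 16 * m) (l := 3 * L) d0.
  - by rewrite mulr_ge0.
  - have -> : 16 * m * d%:R = 8 * (2 * d%:R * m) by ring.
    by rewrite ler_pM2l.
  exists Lb; split; last first.
    by move=> W [[cW uW Wt] [tU _]]; have [F [FL FE EF]] := bP W tU; exists F.
  apply: (le_trans sb); rewrite ler_expR exp3L.
  have -> : 16 * m * (3 * L) = 48 * m * L by ring.
  rewrite lerD2l ler_pdivrMr ?exprn_gt0 // ddd.
  apply: (@le_trans _ _ (2 * d%:R * (2 * d%:R * m))); first by rewrite ler_wpM2l ?mulr_ge0.
  have : m * (d%:R * d%:R) * 1 <= m * (d%:R * d%:R) * d%:R.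
    by rewrite ler_wpM2l ?mulr_ge0 // ler1n.
  lra.
move=> F0; set T0 := K `|` smalls K.
have cT : #|` T0|%:R <= 6 * d%:R * m.
  apply: (@le_trans _ _ (3 * #|` K|%:R)); last by lra.
  rewrite -natrM ler_nat; rewrite /T0 cardfsU.
  by rewrite (leq_trans (leq_subr _ _)) // mulSn leq_add2l card_smalls.
have tm : 4 * t%:R <= 6 * d%:R * m by rewrite /m; lra.
apply: (@listed_bind _ _ ({fset V} * {fset V})%type _ _ _ _
    (fun W p => approx par d W p.1 p.2)).
  have [||Lr [sr rP]] := @refine_list d par par_stp d0 R t d F0 T0 (6 * m) (6 * d%:R * m)
    (3 * L) (leqnn d) d0 _ cT tm.
  - by rewrite mulr_ge0.
  - by move: tm; lra.
  exists Lr; split; last first.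
    move=> W [[[cW uW Wt] [tU _]] [FE ET]]; have [|p' [pL pa]] := rP W cW Wt FE ET; last by exists p'.
    apply: (@le_trans _ _ #|` T0|%:R); first by rewrite ler_nat fsubset_leq_card.
    by move: cT; lra.
  apply: (le_trans sr); rewrite ler_expR exp3L.
  have -> : 2 * (6 * m) * (3 * L) = 36 * m * L by ring.
  rewrite lerD2l ler_pdivrMr ?exprn_gt0 // ddd.
  have : m * (d%:R * d%:R) * 1 <= m * (d%:R * d%:R) * d%:R.
    by rewrite ler_wpM2l ?mulr_ge0 // ler1n.
  lra.
move=> [F S]; apply: listed_assume => -[W0 [[[[cW0 _ Wt0] _] _] /= aW0]].
have [iW0 noiso0 _ _] := cW0.
have cN : #|` nearby par S F|%:R <= 8 * t%:R * d%:R :> R.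
  rewrite -!natrM ler_nat -Wt0; apply: leq_trans (card_nearby _ _ _) _.
  exact: (approx_edges par_stp d0 iW0 (leqnn d) aW0).
have [|||Lr [sr rP]] := @refine_list d par par_stp d0 R t r F (nearby par S F)
   (4 * t%:R / r%:R) (8 * t%:R * d%:R) (3 * L) rled r0 _ cN.
- by rewrite mulr_ge0.
- have : t%:R * 1 <= t%:R * d%:R :> R by rewrite ler_wpM2l ?ler1n ?ltW.
  by have := ltW tR0; lra.
- by rewrite divfK ?gt_eqF.
exists Lr; split; last first.
  move=> W [[[[cW uW Wt] [tU _]] [FE ET]] /= aW].
  have [iW noiso _ _] := cW; have [FE' OS SP FP] := aW.
  have [|p' [pL pa]] := rP W cW Wt FE' (approx_nearby par_stp noiso aW); last by exists p'.
  rewrite divfK ?gt_eqF // -natrM ler_nat -Wt.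
  exact: (inside_wrong par_stp d0 iW (leqnn d) OS FP).
apply: (le_trans sr); rewrite ler_expR exp3L.
have h1 : 6 * d%:R * (8 * t%:R * d%:R) / d%:R ^+ 3 <= 48 * p :> R.
  rewrite ler_pdivrMr ?exprn_gt0 // ddd.
  have : t%:R * (d%:R * d%:R) <= p * d%:R * (d%:R * d%:R) :> R.
    by rewrite ler_wpM2r ?mulr_ge0.
  lra.
have h2 : 2 * (4 * t%:R / r%:R) * (3 * L) = 24 * p by rewrite /p; ring.
by rewrite h2 /m; move: h1; rewrite qE in pq *; lra.
Qed.

End ApproxList.

(** * The Peierls bound *)

Section Box.
Variable d : nat.
Local Notation V := 'rV[int]_d.
Local Notation D := ('I_d * bool)%type.

Definition box (n : nat) : {fset V} :=
  seq_fset tt [seq (\row_i ((f i : nat)%:Z - n%:Z) : V)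
              | f : {ffun 'I_d -> 'I_(n + n).+1} <- enum {: {ffun 'I_d -> 'I_(n + n).+1}}].

Lemma in_box n (x : V) : (x \in box n) = [forall i, `|x 0 i| <= n%:Z].
Proof.
rewrite seq_fsetE; apply/mapP/forallP => [[f _ -> i]|h] /=.
  by rewrite mxE; have := ltn_ord (f i); move: (nat_of_ord (f i)) => a; lia.
have hf i : (absz (x 0 i + n%:Z)%R < (n + n).+1)%N by have := h i; lia.
exists [ffun i => Ordinal (hf i)]; [exact: mem_enum|apply/rowP => i; rewrite mxE ffunE /=].
by have := h i; move: (x 0 i) => a ha; rewrite gez0_abs; lia.
Qed.

Lemma notin_boxP n (x : V) : reflect (exists i, n%:Z < `|x 0 i|) (x \notin box n).
Proof.
rewrite in_box negb_forall; apply: (iffP existsP) => -[i h]; exists i; move: h.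
  by rewrite -ltNge.
by rewrite ltNge.
Qed.

Lemma box_exhaust (A : {fset V}) : exists n0, forall n, (n0 <= n)%N -> A `<=` box n.
Proof.
exists (\sum_(x <- A) \sum_(i < d) absz (x 0 i)%R)%N => n hn.
apply/fsubsetP => x xA; rewrite in_box; apply/forallP => i.
have : (absz (x 0 i)%R <= n)%N; last by move: (x 0 i) => a; lia.
apply: leq_trans hn; rewrite (big_fsetD1 x) //= (bigD1 i) //=; lia.
Qed.

Lemma line_reach (P : pred V) x (s : D) k :
  (forall j, (j <= k)%N -> P (x + stp s *+ j)) -> reach P x (x + stp s *+ k).
Proof.
elim: k => [|k IH] h.
  by rewrite mulr0n addr0; apply: reach_refl; have := h 0%N isT; rewrite mulr0n addr0.
apply: (reach_trans (IH (fun j jk => h j (leqW jk)))).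
rewrite mulrSr addrA; apply: reach_step; first exact: h (leqnSn k).
by have := h k.+1 (leqnn _); rewrite mulrSr addrA.
Qed.

Definition corner (n : nat) : V := \row__ n.+1%:Z.

(* While one coordinate keeps a point outside of the box, the others are free. *)
Lemma set_coord n (x : V) i j (a : int) : n%:Z < `|x 0 i| -> j != i ->
  reach (fun z => z \notin box n) x (\row_k (if k == j then a else x 0 k)).
Proof.
move=> xi ji; pose b := a < x 0 j; pose k := absz (a - x 0 j)%R.
have -> : (\row_k (if k == j then a else x 0 k)) = x + stp (j, b) *+ k :> V.
  apply/rowP => l; rewrite [LHS]mxE [RHS]mxE mulmxnE stp_coord /=.
  case: eqP => [->|_]; last by rewrite mul0rn addr0.
  rewrite /b /k; case: ltP => h; rewrite ?expr1 ?expr0 -mulr_natr natz; lia.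
apply: line_reach => m _; apply/notin_boxP; exists i.
by rewrite mxE mulmxnE stp_coord /= [i == j]eq_sym (negPf ji) mul0rn addr0.
Qed.

(** The guarding coordinate [i] allows another one, [j], to be set to [n + 1]; then [j] guards while
    all the others are set. Hence the need for a second axis. *)
Lemma outside_corner n (x : V) : (1 < d)%N -> x \notin box n ->
  reach (fun z => z \notin box n) x (corner n).
Proof.
move=> d1 /notin_boxP[i xi].
have [j ji] : exists j : 'I_d, j != i.
  have [i0|i0] := eqVneq i (Ordinal (ltnW d1)); last by exists (Ordinal (ltnW d1)); rewrite eq_sym.
  by exists (Ordinal d1); rewrite i0.
apply: (reach_trans (set_coord n.+1%:Z xi ji)).
set y : V := \row__ _; have yj : y 0 j = n.+1%:Z by rewrite mxE eqxx.
have yj' : n%:Z < `|y 0 j| by rewrite yj; lia.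
clearbody y; clear -yj yj'.
suff h (s : seq 'I_d) : reach (fun z => z \notin box n) y
    (\row_k (if (k \in s) then n.+1%:Z else y 0 k)).
  have := h (enum 'I_d); congr reach; apply/rowP => k; rewrite !mxE.
  by rewrite mem_enum.
elim: s => [|i s IH].
  have -> : (\row_k (if k \in [::] then n.+1%:Z else y 0 k)) = y.
    by apply/rowP => k; rewrite mxE in_nil.
  by apply: reach_refl; apply/notin_boxP; exists j.
apply: (reach_trans IH); set z : V := \row__ _.
have zj : z 0 j = n.+1%:Z by rewrite mxE yj if_same.
have [ij|ij] := eqVneq i j.
  have -> : (\row_k (if k \in i :: s then n.+1%:Z else y 0 k)) = z.
    apply/rowP => k; rewrite !mxE inE; case: eqP => //= ->.
    by rewrite ij yj if_same.
  by apply: reach_refl; apply/notin_boxP; exists j; rewrite zj; lia.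
have zj' : n%:Z < `|z 0 j| by rewrite zj; lia.
have := set_coord n.+1%:Z zj' ij; congr reach; apply/rowP => k.
by rewrite !mxE inE; case: (k == i).
Qed.

Lemma corner_step n (d0 : (0 < d)%N) :
  corner n + stp (Ordinal d0, false) \notin box n.
Proof.
apply/notin_boxP; exists (Ordinal d0); rewrite mxE stp_coord eqxx mxE /= expr0; lia.
Qed.

End Box.

Lemma reach_reach (d : nat) (P : pred 'rV[int]_d) x y :
  reach P x y -> reach (fun z => `[< reach P z y >]) x y.
Proof.
move=> [l w e]; exists l => //; elim: l x w e => [|s l IH] x w e.
  rewrite /= andbT; apply/asboolP; exists [::] => //.
move: (w) => /= /andP[px wl]; rewrite (IH _ wl) -?endp_cons // andbT.
by apply/asboolP; exists (s :: l).
Qed.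

(** * The contour around an occupied odd site *)

Section Peierls.
Variable d : nat.
Local Notation V := 'rV[int]_d.
Local Notation D := ('I_d * bool)%type.
Variable par : pred V.
Hypothesis par_stp : forall x s, par (x + stp s) = ~~ par x.
Hypothesis d1 : (1 < d)%N.
Variable n : nat.
Local Notation Lam := (box d n).
Local Notation corner := (corner d n).
Variable u : V.
Hypothesis pu : ~~ par u.

Let d0 : (0 < d)%N. Proof. exact: ltnW. Qed.

Definition thick (P : pred V) : pred V := fun x => P x || [exists s, P (x + stp s)].
Definition cluster (P : pred V) : pred V := fun x => `[< reach (thick P) u x >].
(** [corner] plays the role of infinity: the filling is the cluster together with the holes of its
    complement, so that the outside is connected. *)
Definition filling (P : pred V) : {fset V} :=
  [fset x in Lam | ~~ `[< reach (predC (cluster P)) x corner >]].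

Definition odd_part (I : {fset V}) : pred V := fun x => (x \in I) && ~~ par x.

Section Contour.
Variable P : pred V.
Hypothesis Podd : forall x, P x -> ~~ par x.
Hypothesis Pu : P u.
Hypothesis PLam : forall x, thick P x -> x \in Lam.

Let W := filling P.

Lemma cluster_thick x : cluster P x -> thick P x.
Proof. by move=> /asboolP/reach_end. Qed.

Lemma cluster_u : cluster P u.
Proof. by apply/asboolP/reach_refl; rewrite /thick Pu. Qed.

Lemma cluster_step x s : cluster P x -> thick P (x + stp s) -> cluster P (x + stp s).
Proof.
move=> /asboolP ux xs; apply/asboolP/(reach_trans ux)/reach_step => //.
exact: reach_end ux.
Qed.

Lemma fillingE x : (x \in W) = ~~ `[< reach (predC (cluster P)) x corner >].
Proof.
rewrite /W /filling !inE /=; case: (boolP (x \in Lam)) => //= xL.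
apply/esym/negbTE; rewrite negbK; apply/asboolP.
apply: reach_sub (outside_corner d1 xL) => z /=; apply: contra => /cluster_thick.
exact: PLam.
Qed.

Lemma cluster_in x : cluster P x -> x \in W.
Proof.
by move=> cx; rewrite fillingE; apply/asboolP => /reach_start /=; rewrite cx.
Qed.

Lemma notin_filling x : x \notin W -> ~~ cluster P x.
Proof. by apply: contra; exact: cluster_in. Qed.

Lemma inner_bdry x s : x \in W -> x + stp s \notin W -> cluster P x.
Proof.
move=> xW; rewrite fillingE negbK => /asboolP ys; apply: contraT => cx.
move: xW; rewrite fillingE => /asboolP[]; apply: (reach_trans _ ys).
apply: reach_step => //=; exact: reach_start ys.
Qed.

Lemma odd_cluster x : ~~ par x -> cluster P x -> P x.
Proof.
move=> px /cluster_thick/orP[//|/existsP[s /Podd]].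
by rewrite par_stp px.
Qed.

(** An odd site of the cluster carries [P], so its neighbours are thick and join the cluster: only
    even sites can face the outside. *)
Lemma inner_even x s : x \in W -> x + stp s \notin W -> par x.
Proof.
move=> xW ys; apply: contraT => px.
have cx := inner_bdry xW ys; have Px := odd_cluster px cx.
case/negP: ys; apply/cluster_in/cluster_step => //.
by apply/orP; right; apply/existsP; exists (opp s); rewrite stpN addrK.
Qed.

Lemma filling_interface : interface par W.
Proof.
move=> x s; case: (boolP (x \in W)) => xW px.
  by apply/negPn/negP => /(inner_even xW) pp; rewrite pp in px.
apply/negbTE/negP => ys; have := @inner_even (x + stp s) (opp s) ys.
by rewrite stpN addrK => /(_ xW); rewrite par_stp; move: px; case: (par x).
Qed.

Lemma even_cluster x : par x -> cluster P x -> exists2 s, P (x + stp s) & cluster P (x + stp s).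
Proof.
move=> px /[dup] cx /cluster_thick/orP[/Podd|/existsP[s Ps]]; first by rewrite px.
by exists s => //; apply: cluster_step => //; rewrite /thick Ps.
Qed.

Lemma filling_contour : contour par W.
Proof.
split.
- exact: filling_interface.
- move=> x; case: (boolP (x \in W)) => xW.
    pose s0 : D := (Ordinal d0, false).
    case: (boolP (x + stp s0 \in W)) => xs; first by exists s0.
    have [s _ cs] := even_cluster (inner_even xW xs) (inner_bdry xW xs).
    by exists s; rewrite cluster_in.
  suff [s xs] : exists s, x + stp s \notin W by exists s; rewrite (negPf xs).
  have := xW; rewrite fillingE negbK => /asboolP[[|s l] w e].
    rewrite endp_nil in e; exists (Ordinal d0, false); rewrite e.
    by apply/negP; rewrite !inE => /andP[]; rewrite (negPf (corner_step n d0)).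
  exists s; rewrite fillingE negbK; apply/asboolP; exists l; last by rewrite -endp_cons.
  by move: w => /= /andP[].
- suff h x : x \in W -> reach (mem W) x u.
    by move=> x y xW yW; apply: reach_trans (h x xW) (reach_sym (h y yW)).
  move=> xW; pose s0 : D := (Ordinal d0, false).
  pose k := exit_time W s0 x.
  have ki j : (j <= k)%N -> x + stp s0 *+ j \in W by exact: exit_in.
  apply: (reach_trans (line_reach ki)).
  have : cluster P (x + stp s0 *+ k).
    apply: (inner_bdry (s := s0)); first exact: ki.
    by have := exit_out W s0 x; rewrite mulrSr addrA.
  move=> /asboolP/reach_sym/reach_reach; apply: reach_sub => z /asboolP/reach_sym uz.
  by apply: cluster_in; apply/asboolP.
- suff h x : x \notin W -> reach (fun z => z \notin W) x corner.
    by move=> x y xW yW; apply: reach_trans (h x xW) (reach_sym (h y yW)).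
  rewrite fillingE negbK => /asboolP/reach_reach; apply: reach_sub => z zz.
  by rewrite fillingE negbK.
Qed.

(** The sites of [P] outside the filling belong to other clusters, so erasing them changes nothing.
    Hence the occupied odd sites inside determine the contour, as the decoding in [moved_inj]
    requires. *)
Lemma filling_loc (P' : pred V) : (forall x, P' x = P x && (x \in W)) ->
  filling P' = W.
Proof.
move=> P'E; suff cc : cluster P' =1 cluster P.
  by rewrite /W /filling (_ : cluster P' = cluster P) //; apply/funext.
have sub x : thick P' x -> thick P x.
  by case/orP => [|/existsP[s]]; rewrite P'E => /andP[h _]; apply/orP;
    [left|right; apply/existsP; exists s].
move=> x; apply/asboolP/asboolP; first exact: reach_sub.
move=> /reach_sym/reach_reach/reach_sym; apply: reach_sub => z /asboolP/reach_sym uz.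
have cz : cluster P z by apply/asboolP.
case: (boolP (par z)) => pz.
  have [s Ps cs] := even_cluster pz cz.
  by apply/orP; right; apply/existsP; exists s; rewrite P'E Ps cluster_in.
by apply/orP; left; rewrite P'E (odd_cluster pz cz) cluster_in.
Qed.

End Contour.

Section Config.
Variable I : {fset V}.
Hypotheses (IL : I `<=` Lam) (aI : admissible par Lam I) (uI : u \in I).
Local Notation P := (odd_part I).

Lemma odd_part_odd x : P x -> ~~ par x. Proof. by case/andP. Qed.

Lemma odd_part_occ x : P x -> occ par Lam I x.
Proof. by case/andP => xI _; rewrite /occ (fsubsetP IL _ xI). Qed.

Lemma thick_Lam x : thick P x -> x \in Lam.
Proof.
case/orP => [/andP[xI _]|/existsP[s Ps]]; first exact: (fsubsetP IL).
apply: contraT => xL; have := aI x s; rewrite (odd_part_occ Ps) andbT /occ (negPf xL).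
by have := odd_part_odd Ps; rewrite par_stp negbK => ->.
Qed.

(** An inner boundary site is even with an occupied odd neighbour, hence vacant; an occupied odd
    site on the outer boundary would be thick, join the cluster and be inside. *)
Lemma contour_of_filling : contour_of par Lam I (filling P).
Proof.
have iW := filling_interface odd_part_odd thick_Lam.
split => //; first by apply/fsubsetP => x; rewrite inE => /andP[].
move=> x s xs; case: (boolP (x \in filling P)) => xW.
  have ys : x + stp s \notin filling P by move: xs; rewrite xW; case: (_ \in _).
  have px := inner_even odd_part_odd thick_Lam xW ys.
  have [t Pt _] := even_cluster odd_part_odd px (inner_bdry thick_Lam xW ys).
  by have := aI x t; rewrite (odd_part_occ Pt) andbT.
have yW : x + stp s \in filling P by move: xs; rewrite (negPf xW); case: (_ \in _).
have xs' : x + stp s + stp (opp s) \notin filling P by rewrite stpN addrK.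
have py := inner_even odd_part_odd thick_Lam yW xs'.
have cy := inner_bdry thick_Lam yW xs'.
have px : ~~ par x by rewrite par_stp in py.
apply/negP => ox; have Px : P x.
  by move: ox; rewrite /occ /odd_part px andbT; case: ifP => // _; rewrite (negPf px).
case/negP: (notin_filling thick_Lam xW).
rewrite -[x](addrK (stp s)) -stpN; apply: cluster_step cy _.
by rewrite stpN addrK /thick Px.
Qed.

End Config.

Lemma filling_det I1 I2 :
  I1 `<=` Lam -> admissible par Lam I1 -> u \in I1 ->
  I2 `<=` Lam -> admissible par Lam I2 -> u \in I2 ->
  I1 `&` odds par (filling (odd_part I1)) = I2 `&` odds par (filling (odd_part I2)) ->
  filling (odd_part I1) = filling (odd_part I2).
Proof.
move=> IL1 aI1 uI1 IL2 aI2 uI2 e.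
have pE I x : (x \in I `&` odds par (filling (odd_part I))) =
    odd_part I x && (x \in filling (odd_part I)).
  by rewrite 3!inE /odd_part; case: (x \in I); case: (par x); rewrite ?andbF ?andbT.
rewrite -[LHS](filling_loc (@odd_part_odd I1) (thick_Lam IL1 aI1) (pE I1)).
by rewrite -(filling_loc (@odd_part_odd I2) (thick_Lam IL2 aI2) (pE I2)) e.
Qed.

End Peierls.

(** * The Peierls bound for contours of fixed excess *)

Section PeierlsBound.
Variable R : realType.
Variable d : nat.
Local Notation V := 'rV[int]_d.
Local Notation D := ('I_d * bool)%type.
Variable par : pred V.
Hypothesis par_stp : forall x s, par (x + stp s) = ~~ par x.
Variable r : nat.
Hypotheses (r0 : (0 < r)%N) (rd : (r * r <= d)%N) (d5 : (5 <= d)%N).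
Local Notation L := (ln (d%:R : R)).
Hypothesis L1 : 1 <= L.
Variables lam mu : R.
Hypotheses (lam0 : 0 < lam) (mu0 : 0 < mu) (mu1 : mu <= 1) (mulam : mu <= lam).
Variable K0 : R.
Hypotheses (K0pos : 0 < K0) (hK0 : 16 * 4005 <= K0).
Hypothesis Hmu : K0 * L ^+ 3 <= mu ^+ 2 * r%:R.
Variables (n : nat) (u : V).
Hypothesis pu : ~~ par u.
Local Notation Lam := (box d n).
Local Notation wt := (@wt d R lam).
Local Notation Z := (Zsum par Lam lam).

Let d0 : (0 < d)%N. Proof. exact: leq_trans d5. Qed.
Let d1 : (1 < d)%N. Proof. exact: leq_trans d5. Qed.
Let rled : (r <= d)%N. Proof. by apply: leq_trans rd; rewrite leq_pmulr. Qed.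
Let dR0 : 0 < d%:R :> R. Proof. by rewrite ltr0n. Qed.
Let rR0 : 0 < r%:R :> R. Proof. by rewrite ltr0n. Qed.
Let L0 : 0 <= L. Proof. exact: le_trans L1. Qed.
Let expL : expR L = d%:R. Proof. by rewrite lnK // posrE. Qed.

Definition Wof (I : {fset V}) : {fset V} := filling n u (odd_part par I).

Definition bad : seq {fset V} :=
  [seq I <- enum_fset (fpowerset Lam) | `[< admissible par Lam I >] && (u \in I)].

Lemma badP I : I \in bad -> [/\ I `<=` Lam, admissible par Lam I & u \in I].
Proof. by rewrite mem_filter fpowersetE => /andP[/andP[/asboolP]]. Qed.

Lemma bad_contour I : I \in bad -> [/\ contour par (Wof I), u \in Wof I &
  contour_of par Lam I (Wof I)].
Proof.
move=> /badP[IL aI uI]; have tL := thick_Lam par_stp IL aI.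
split; last exact: contour_of_filling.
  by apply: filling_contour => //; apply: odd_part_odd.
by apply: (cluster_in d1 tL); apply: cluster_u; rewrite /odd_part uI.
Qed.

Lemma wt_ge0 (I : {fset V}) : 0 <= wt I.
Proof. by rewrite exprn_ge0 // ltW. Qed.

Lemma Z_ge0 : 0 <= Z.
Proof. by apply: sumr_ge0 => J _; apply: wt_ge0. Qed.

(** Combine [expR (- (mu / 2)) >= 1 - mu / 2] with [(1 + mu) * (1 - mu / 2) >= 1], which is where
    [mu <= 1] enters. It turns the gain into an exponential, to be compared with the counts. *)
Lemma expR_half_le k : expR (mu / 2 * k%:R) <= (1 + lam) ^+ k.
Proof.
rewrite mulrC expRM_natl; apply: lerXn2r; rewrite ?nnegrE ?expR_ge0 ?addr_ge0 ?(ltW lam0) //.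
apply: (@le_trans _ _ (1 + mu)); last by rewrite lerD2l.
have h : expR (- (mu / 2)) >= 1 - mu / 2 by have := expR_ge1Dx (- (mu / 2)).
have e0 := expR_gt0 (mu / 2); rewrite expRN in h.
have h2 : (1 - mu / 2) * expR (mu / 2) <= 1 by rewrite -ler_pdivlMr // div1r.
have h3 : 1 <= (1 + mu) * (1 - mu / 2) by move: mu0 mu1; nra.
have h4 : 0 < 1 - mu / 2 by move: mu1; lra.
rewrite -(ler_pM2l h4); apply: (le_trans h2).
by rewrite mulrC.
Qed.

Lemma bucket_sum (A : eqType) (Is : seq {fset V}) (Ls : seq A)
    (good : {fset V} -> A -> Prop) (b : R) :
  (forall I, I \in Is -> exists2 a, a \in Ls & good I a) ->
  (forall a, \sum_(I <- Is | `[< good I a >]) wt I <= b) ->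
  \sum_(I <- Is) wt I <= (size Ls)%:R * b.
Proof.
move=> hg hb; apply: (@le_trans _ _ (\sum_(a <- Ls) \sum_(I <- Is | `[< good I a >]) wt I)).
  under [leRHS]eq_bigr do rewrite big_mkcond.
  rewrite exchange_big /= big_seq [leRHS]big_seq; apply: ler_sum => I IIs.
  have [a aL ga] := hg I IIs; rewrite (big_rem a aL) /=.
  have -> : `[< good I a >] by apply/asboolP.
  by rewrite lerDl sumr_ge0 // => a' _; case: ifP => // _; apply: wt_ge0.
rewrite -sum1_size natr_sum mulr_suml; apply: ler_sum => a _.
by rewrite mul1r.
Qed.

Lemma transfer_exp (Is : seq {fset V}) (F S : {fset V}) s k (q : R) :
  uniq Is -> {subset Is <= bad} ->
  (forall I, I \in Is -> [/\ F `<=` evens par (Wof I), odds par (Wof I) `<=` S &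
    (k <= #|` evens par (Wof I) `\` shift s S|)%N]) ->
  #|` shift s S `\` F|%:R <= q ->
  \sum_(I <- Is) wt I <= expR (q - mu / 2 * k%:R) * Z.
Proof.
move=> uI sub HI hq.
have := @transfer d par par_stp Lam s R lam lam0 Is Wof F S k uI.
move=> /(_ _ _)/wrap[].
- move=> I II; have [IL aI _] := badP (sub _ II); have [_ _ cI] := bad_contour (sub _ II).
  by have [FE OS hk] := HI _ II.
- move=> I1 I2 /sub/badP[IL1 aI1 uI1] /sub/badP[IL2 aI2 uI2].
  exact: filling_det.
move=> h; rewrite expRD expRN -mulrA [_^-1 * Z]mulrC mulrA ler_pdivlMr ?expR_gt0 //.
apply: (@le_trans _ _ ((1 + lam) ^+ k * \sum_(I <- Is) wt I)).
  rewrite mulrC; apply: ler_wpM2r; last exact: expR_half_le.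
  by apply: sumr_ge0 => I _; apply: wt_ge0.
apply: (le_trans h); apply: ler_wpM2r; first exact: Z_ge0.
apply: (@le_trans _ _ (expR #|` shift s S `\` F|%:R)); last by rewrite ler_expR.
rewrite -[X in expR X]mulr1 expRM_natl; apply: lerXn2r; rewrite ?nnegrE ?expR_ge0 //.
by apply: le_trans (expR_ge1Dx 1); rewrite -natr1.
Qed.

Section FixedExcess.
Variable t : nat.
Hypothesis dt : (d <= t)%N.

Local Notation q := (t%:R * L ^+ 2 / r%:R).
(** Naming [c * t] sites at cost [L] each takes [mu * t / 8] from the gain [mu * t / 2] of a known
    contour; freeing [c * t] sites gains [mu ^ 2 * t / (16 * L)], whence the 16 in the bound on
    [K0]. *)
Local Notation c := (mu / (8 * L)).

Let t0 : (0 < t)%N. Proof. exact: leq_trans dt. Qed.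
Let tR0 : 0 < t%:R :> R. Proof. by rewrite ltr0n. Qed.
Let Lp0 : 0 < L. Proof. exact: lt_le_trans L1. Qed.

Lemma trd : t%:R * r%:R / d%:R <= t%:R / r%:R :> R.
Proof.
rewrite ler_pdivrMr // mulrAC ler_pdivlMr // -!mulrA ler_pM2l // -natrM ler_nat.
exact: rd.
Qed.

Lemma tr_le_q : t%:R / r%:R <= q.
Proof. by rewrite mulrAC ler_peMr ?divr_ge0 // exprn_ege1. Qed.

(** Average over the [2 * d] directions: each edge from [S] to a site off [F] belongs to one
    direction, so some direction has at most 8 t r / (2 d) of them, and [r * r <= d] bounds this by
    4 t / r. *)
Lemma good_step (F S : {fset V}) : (\sum_(y <- S) nb (predC (mem F)) y <= 8 * t * r)%N ->
  exists s : D, #|` shift s S `\` F|%:R <= 4 * (t%:R / r%:R) :> R.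
Proof.
move=> h; suff [s hs] : exists s : D, (#|` shift s S `\` F| * (2 * d) <= 8 * t * r)%N.
  exists s; apply: (@le_trans _ _ (4 * (t%:R * r%:R / d%:R))); last first.
    by rewrite ler_pM2l // trd.
  have : (#|` shift s S `\` F| * d <= 4 * t * r)%N.
    by move: hs; move: #|` _| => a hs; clear -hs; nia.
  by rewrite mulrA ler_pdivlMr // mulrA -!natrM ler_nat.
have eS : (\sum_(s : D) #|` shift s S `\` F| = \sum_(y <- S) nb (predC (mem F)) y)%N.
  under [RHS]eq_bigr do rewrite nbE.
  rewrite exchange_big /=; apply: eq_bigr => s _.
  have -> : shift s S `\` F = [fset x + stp s | x in [fset x in S | x + stp s \notin F]].
    apply/fsetP => x; rewrite in_fsetD mem_shift; apply/andP/imfsetP => [[xF xS]|[y /=]].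
      by exists (x - stp s); rewrite ?subrK // !inE xS subrK.
    by rewrite !inE => /andP[yS yF] ->; rewrite addrK.
  rewrite card_imfset /=; last exact: addIr.
  rewrite (card_fset_count S (fun x => x + stp s \notin F)) -sum1_count big_mkcond.
  by apply: eq_bigr => x _; case: (_ \in F).
apply: contrapT => no.
have : (\sum_(s : D) 8 * t * r < \sum_(s : D) #|` shift s S `\` F| * (2 * d))%N.
  have lt s : (8 * t * r < #|` shift s S `\` F| * (2 * d))%N.
    by rewrite ltnNge; apply/negP => hs; apply: no; exists s.
  pose s0 : D := (Ordinal d0, false).
  rewrite (bigD1 s0) //= [ltnRHS](bigD1 s0) //=.
  by rewrite -addSn leq_add ?lt // leq_sum // => s _; apply: ltnW.
rewrite -[X in (_ < X)%N]big_distrl /= eS sum_nat_const card_dir mulnC.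
by rewrite ltn_pmul2r ?muln_gt0 // ltnNge h.
Qed.

(** [S] is so small that any translate of it misses more than [c * t] even sites of each contour in
    the class. *)
Lemma case_one (Is : seq {fset V}) (p : {fset V} * {fset V}) :
  uniq Is -> {subset Is <= bad} ->
  (forall I, I \in Is -> [/\ excess par (Wof I) = t, approx par r (Wof I) p.1 p.2 &
    #|` p.2|%:R + c * t%:R < #|` evens par (Wof I)|%:R]) ->
  \sum_(I <- Is) wt I <= expR (4 * (t%:R / r%:R) - mu / 2 * (c * t%:R)) * Z.
Proof.
case: p => F S /= uI sub HI.
case IE : Is => [|I0 Is'].
  by rewrite big_nil mulr_ge0 ?expR_ge0 ?Z_ge0.
have I0I : I0 \in Is by rewrite IE inE eqxx.
rewrite -IE; have [tE aI _] := HI I0 I0I; have [[iW _ _ _] _ _] := bad_contour (sub _ I0I).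
have [s hs] : exists s : D, #|` shift s S `\` F|%:R <= 4 * (t%:R / r%:R) :> R.
  by apply: good_step; rewrite -tE; exact: (approx_edges par_stp d0 iW rled aI).
pose k := (Num.truncn (c * t%:R)).+1.
have ck : c * t%:R <= k%:R by rewrite ltW // /k truncnS_gt.
have c0 : 0 <= c * t%:R by rewrite mulr_ge0 // divr_ge0 ?mulr_ge0 // ltW.
apply: (@le_trans _ _ (expR (4 * (t%:R / r%:R) - mu / 2 * k%:R) * Z)); last first.
  apply: ler_wpM2r; first exact: Z_ge0.
  by rewrite ler_expR lerD2l lerN2 ler_pM2l // divr_gt0.
apply: (transfer_exp (s := s) (S := S) (F := F)) => // I II.
have [_ [FE OS _ _] h] := HI I II; split => //.
have cS : (#|` evens par (Wof I)| <= #|` evens par (Wof I) `\` shift s S| + #|` S|)%N.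
  rewrite -(card_shift s S) -(cardfsID (shift s S)) addnC leq_add2l.
  by apply: fsubset_leq_card; apply: fsubsetIr.
rewrite /k truncn_lt_nat // -(ltrD2l #|` S|%:R); apply: (lt_le_trans h).
by rewrite -natrD ler_nat addnC.
Qed.

Lemma evens_inj W1 W2 : contour par W1 -> contour par W2 ->
  evens par W1 = evens par W2 -> W1 = W2.
Proof.
suff h W1' W2' : contour par W1' -> contour par W2' ->
    evens par W1' = evens par W2' -> W1' `<=` W2'.
  by move=> c1 c2 e; apply/eqP; rewrite eqEfsubset !h.
move=> [i1 _ _ _] [i2 n2 _ _] e; apply/fsubsetP => x xW.
case: (boolP (par x)) => px.
  have : x \in evens par W1' by rewrite !inE xW.
  by rewrite e !inE => /andP[].
have [s xs] := n2 x; rewrite -xs.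
have : x + stp s \in evens par W1' by apply: (odds_nb par_stp i1); rewrite !inE xW.
by rewrite e !inE => /andP[].
Qed.

(** The even part determines the contour, so [E] and the odd part approximate it without error:
    nothing has to be recorded, and all [t] surplus even sites are freed. *)
Lemma case_two (Is : seq {fset V}) (E : {fset V}) :
  uniq Is -> {subset Is <= bad} ->
  (forall I, I \in Is -> excess par (Wof I) = t /\ evens par (Wof I) = E) ->
  \sum_(I <- Is) wt I <= expR (- (mu / 2 * t%:R)) * Z.
Proof.
move=> uI sub HI; case IE : Is => [|I0 Is'].
  by rewrite big_nil mulr_ge0 ?expR_ge0 ?Z_ge0.
have I0I : I0 \in Is by rewrite IE inE eqxx.
rewrite -IE; have [tE EE] := HI I0 I0I; have [cW _ _] := bad_contour (sub _ I0I).
have WE I : I \in Is -> Wof I = Wof I0.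
  move=> II; have [_ EI] := HI I II; have [cI _ _] := bad_contour (sub _ II).
  exact: (evens_inj cI cW (etrans EI (esym EE))).
pose s0 : D := (Ordinal d0, false); have [iW _ _ _] := cW.
have sO : shift s0 (odds par (Wof I0)) `<=` E.
  apply/fsubsetP => x; rewrite mem_shift => /(odds_nb par_stp iW) => /(_ s0).
  by rewrite subrK EE.
rewrite -[- _]add0r; apply: (transfer_exp (s := s0) (F := E) (S := odds par (Wof I0))) => //.
  move=> I II; rewrite (WE I II) EE; split; rewrite ?fsubset_refl //.
  by rewrite cardfsDS // card_shift -EE -tE.
by rewrite (_ : _ `\` _ = fset0) ?cardfs0 //; apply/eqP; rewrite fsetD_eq0.
Qed.

Lemma mu_q : K0 * q <= mu * t%:R * (mu / L) /\ K0 * q <= mu * t%:R.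
Proof.
have h1 : K0 * (L ^+ 3) / r%:R <= mu ^+ 2 by rewrite ler_pdivrMr.
have tLr0 : 0 <= t%:R / L by rewrite divr_ge0.
split.
  have -> : mu * t%:R * (mu / L) = mu ^+ 2 * (t%:R / L) by ring.
  apply: le_trans (ler_wpM2r tLr0 h1).
  have -> : K0 * L ^+ 3 / r%:R * (t%:R / L) = K0 * q * (L / L) by ring.
  by rewrite divff ?mulr1 // gt_eqF.
have -> : K0 * q = K0 * L ^+ 2 / r%:R * t%:R by ring.
rewrite ler_pM2r //; apply: (@le_trans _ _ (mu ^+ 2)).
  apply: le_trans h1; rewrite ler_pM2r ?invr_gt0 // ler_pM2l //.
  by rewrite ler_weXn2l.
by rewrite expr2 ler_piMr // ltW.
Qed.

Lemma fixed_excess :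
  \sum_(I <- [seq I <- bad | excess par (Wof I) == t]) wt I <= 2 * expR (- q) * Z.
Proof.
set Is := [seq _ <- bad | _].
have uIs : uniq Is by rewrite !filter_uniq ?fset_uniq.
have IsP I : I \in Is -> I \in bad /\ excess par (Wof I) = t.
  by rewrite mem_filter => /andP[/eqP].
have thr I : I \in Is -> through par u t (Wof I).
  by move=> /IsP[Ib Et]; have [cW uW _] := bad_contour Ib.
have AL := @approx_list R d par par_stp r r0 rd d5 L1 u t pu dt.
have [Lp [sLp LpP]] := AL.
pose one I (p : {fset V} * {fset V}) := approx par r (Wof I) p.1 p.2 /\
  #|` p.2|%:R + c * t%:R < #|` evens par (Wof I)|%:R.
pose C1 I := `[< exists2 p, p \in Lp & one I p >].
rewrite (bigID C1) /= -big_filter -[X in _ + X <= _]big_filter.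
have [m1 m2] := mu_q; have tq := tr_le_q.
have q0 : 0 <= q by apply: le_trans tq; rewrite divr_ge0.
have Kq : 16 * 4005 * q <= K0 * q by apply: ler_wpM2r.
have -> : 2 * expR (- q) * Z = expR (- q) * Z + expR (- q) * Z by ring.
apply: lerD.
  apply: (le_trans (@bucket_sum _ _ Lp one (expR (4 * (t%:R / r%:R) - mu / 2 * (c * t%:R)) * Z) _ _)).
  - by move=> I; rewrite mem_filter => /andP[/asboolP].
  - move=> p; rewrite -big_filter; apply: (case_one (p := p)).
    + by do 2!apply: filter_uniq.
    + by move=> I; rewrite 2!mem_filter => /and3P[_ _ /IsP[]].
    + move=> I; rewrite mem_filter => /andP[/asboolP[a1 a2]].
      by rewrite mem_filter => /andP[_ /IsP[]].
  rewrite mulrA; apply: ler_wpM2r; first exact: Z_ge0.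
  apply: (le_trans (ler_wpM2r (expR_ge0 _) sLp)); rewrite -expRD ler_expR.
  (* 4000 for the list, 4 for the recorded sites and 1 for the result make up the 4005 in [hK0]. *)
  have -> : mu / 2 * (c * t%:R) = mu * t%:R * (mu / L) / 16.
    by field; rewrite gt_eqF.
  lra.
(* In the other case the even part has at most [#|S| + c * t] sites, and [approx_card] bounds
   [#|S| - #|F|] by 4 t / r; so [kap] bounds the number of even sites missing from [F]. *)
pose kap := c * t%:R + 4 * (t%:R / r%:R).
have [LE [sLE LEP]] : @listed R {fset V} {fset V} (4000 * q + (kap * L + 8 * q))
    (fun W => through par u t W /\ forall p, p \in Lp ->
        approx par r W p.1 p.2 -> #|` evens par W|%:R <= #|` p.2|%:R + c * t%:R)
    (fun W E => evens par W = E).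
  apply: (@listed_bind _ _ ({fset V} * {fset V})%type _ _ _ _
      (fun W p => p \in Lp /\ approx par r W p.1 p.2)).
    exists Lp; split => // W [tW _]; have [p pL pa] := LpP W tW.
    by exists p.
  move=> [F S]; apply: listed_assume => -[W0 [[[cW0 _ tW0] _] [_ /= a0]]].
  have [iW0 _ _ _] := cW0.
  have cN : (#|` nearby par S F| <= 8 * t * r)%N.
    apply: leq_trans (card_nearby _ _ _) _; rewrite -tW0.
    exact: (approx_edges par_stp d0 iW0 rled a0).
  have [LB [sLB LBP]] := few_subsets (nearby par S F) kap L0.
  exists [seq F `|` B | B <- LB]; split.
    rewrite size_map; apply: (le_trans sLB); rewrite ler_expR lerD2l expRN expL.
    rewrite ler_pdivrMr //; apply: (@le_trans _ _ (8 * t * r)%:R); first by rewrite ler_nat.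
    rewrite !natrM -mulrA -[leRHS]mulrA ler_pM2l // -ler_pdivrMr //.
    exact: le_trans trd tq.
  move=> W [[[cW uW Wt] nc] [pL /= aW]]; have [iW noiso _ _] := cW.
  have [FE OS SP FP] := aW.
  have EF : evens par W = F `|` (evens par W `\` F).
    apply/fsetP => x; rewrite in_fsetU in_fsetD; case: (boolP (x \in F)) => //= /(fsubsetP FE).
    by [].
  exists (evens par W) => //; rewrite {1}EF; apply/map_f/LBP.
    exact: (approx_nearby par_stp noiso aW).
  rewrite cardfsDS // natrB ?fsubset_leq_card //.
  have h1 := nc _ pL aW; rewrite /= in h1.
  have h2 : #|` S|%:R <= #|` F|%:R + 4 * (t%:R / r%:R) :> R.
    apply: (@le_trans _ _ (#|` F|%:R + 4 * (t%:R * r%:R / d%:R))); last first.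
      by rewrite lerD2l ler_pM2l // trd.
    have h := approx_card par_stp d0 iW rled aW.
    have : (#|` S| * d <= #|` F| * d + 4 * t * r)%N.
      by move: h; rewrite Wt; move: #|` S| #|` F| => a b h; clear -h; nia.
    rewrite -(ler_nat R) natrD !natrM => h'.
    by rewrite -(ler_pM2r dR0) mulrDl !mulrA divfK ?gt_eqF.
  by rewrite /kap; lra.
apply: (le_trans (@bucket_sum _ _ LE (fun I E => evens par (Wof I) = E)
    (expR (- (mu / 2 * t%:R)) * Z) _ _)).
- move=> I; rewrite mem_filter => /andP[nC II]; apply: LEP; split; first exact: thr.
  move=> p pL pa; rewrite leNgt; apply/negP => h; case/asboolP: nC.
  by exists p.
- move=> E; rewrite -big_filter; apply: (case_two (E := E)).
  + by do 2!apply: filter_uniq.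
  + by move=> I; rewrite 2!mem_filter => /and3P[_ _ /IsP[]].
  + move=> I; rewrite mem_filter => /andP[/asboolP eE].
    by rewrite mem_filter => /andP[_ /IsP[]].
rewrite mulrA; apply: ler_wpM2r; first exact: Z_ge0.
apply: (le_trans (ler_wpM2r (expR_ge0 _) sLE)); rewrite -expRD ler_expR.
have -> : kap * L = mu * t%:R / 8 + 4 * (t%:R * L / r%:R).
  by rewrite /kap; field; rewrite !gt_eqF.
have tLq : t%:R * L / r%:R <= q.
  by rewrite ler_pM2r ?invr_gt0 // ler_pM2l // ler_eXnr.
lra.
Qed.

End FixedExcess.
End PeierlsBound.

Section PeierlsSum.
Variable R : realType.

Lemma geometric_tail (a : R) m k : 0 <= a -> a < 1 ->
  \sum_(m <= t < k) a ^+ t <= a ^+ m / (1 - a).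
Proof.
move=> a0 a1; have b0 : 0 < 1 - a by rewrite subr_gt0.
rewrite ler_pdivlMr //; have [mk|km] := leqP m k; last first.
  by rewrite big_geq ?mul0r ?exprn_ge0 // ltnW.
suff -> : (\sum_(m <= t < k) a ^+ t) * (1 - a) = a ^+ m - a ^+ k.
  by rewrite lerBlDr lerDl exprn_ge0.
have /= h := telescope_sumr (fun t => a ^+ t) mk.
rewrite -[RHS]opprB -h mulr_suml -sumrN; apply: eq_bigr => t _.
by rewrite exprS; ring.
Qed.

Variable d : nat.
Local Notation V := 'rV[int]_d.
Variable par : pred V.
Hypothesis par_stp : forall x s, par (x + stp s) = ~~ par x.
Variable r : nat.
Hypotheses (r0 : (0 < r)%N) (rd : (r * r <= d)%N) (d5 : (5 <= d)%N).
Local Notation L := (ln (d%:R : R)).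
Hypothesis L1 : 1 <= L.
Variables lam mu : R.
Hypotheses (lam0 : 0 < lam) (mu0 : 0 < mu) (mu1 : mu <= 1) (mulam : mu <= lam).
Variable K0 : R.
Hypotheses (K0pos : 0 < K0) (hK0 : 16 * 4005 <= K0).
Hypothesis Hmu : K0 * L ^+ 3 <= mu ^+ 2 * r%:R.
Variables (n : nat) (u : V).
Hypothesis pu : ~~ par u.
Local Notation Lam := (box d n).

(** A geometric tail from [t = d] on, with ratio [a = exp (- L^2 / r)]. Since [r * r <= d] and r >=
    8 L^3, a^d <= d^-5; moreover 1 / (1 - a) <= 2 d, and the product 4 d^-4 is below d^-2. *)
Lemma peierls : \sum_(I <- bad par n u) wt lam I <= (d%:R ^+ 2)^-1 * Zsum par Lam lam.
Proof.
have d0 : (0 < d)%N by apply: leq_trans d5.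
have dR0 : 0 < d%:R :> R by rewrite ltr0n.
have rR0 : 0 < r%:R :> R by rewrite ltr0n.
have Lp : 0 < L by apply: lt_le_trans L1.
have expL : expR L = d%:R by rewrite lnK // posrE.
pose T := (\max_(I <- bad par n u) (excess par (Wof par n u I)).+1)%N.
pose x := L ^+ 2 / r%:R; pose a := expR (- x).
have x0 : 0 < x by rewrite divr_gt0 // exprn_gt0.
have Z0 : 0 <= Zsum par Lam lam by apply: Z_ge0.
have le1 : \sum_(I <- bad par n u) wt lam I <=
    \sum_(d <= t < T) 2 * a ^+ t * Zsum par Lam lam.
  apply: (@le_trans _ _ (\sum_(d <= t < T) \sum_(I <- bad par n u)
     if excess par (Wof par n u I) == t then wt lam I else 0)).
    rewrite exchange_big /= big_seq [leRHS]big_seq; apply: ler_sum => I Ib.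
    have [[iW _ _ _] uW _] := bad_contour par_stp d5 pu Ib.
    set t := excess _ _; rewrite (bigD1_seq t) ?iota_uniq //=.
      by rewrite eqxx lerDl sumr_ge0 // => t' _; case: ifP => // _; apply: wt_ge0.
    rewrite mem_index_iota (excess_ge_dim par_stp iW uW pu) /=.
    by rewrite /T (big_rem I Ib) /= leq_max ltnSn.
  rewrite big_nat [leRHS]big_nat; apply: ler_sum => t /andP[dt _].
  rewrite -big_mkcond -big_filter.
  have := fixed_excess par_stp r0 rd d5 L1 lam0 mu0 mu1 mulam K0pos hK0 Hmu n pu dt.
  move/le_trans; apply; apply: ler_wpM2r => //.
  rewrite /a -expRM_natl ler_pM2l // ler_expR.
  by rewrite (_ : t%:R * - x = - (t%:R * L ^+ 2 / r%:R)) // /x; ring.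
apply: (le_trans le1); rewrite -mulr_suml -mulr_sumr; apply: ler_wpM2r => //.
have K8 : 8 <= K0 by move: hK0; lra.
have rL : 8 * L ^+ 3 <= r%:R.
  apply: (@le_trans _ _ (K0 * L ^+ 3)); first by rewrite ler_pM2r // exprn_gt0.
  by apply: (le_trans Hmu); rewrite ler_piMl //; apply: exprn_ile1 => //; exact: ltW.
have L13 : L ^+ 2 <= L ^+ 3 by rewrite ler_weXn2l.
have L12 : 1 <= L ^+ 2 by rewrite exprn_ege1.
have x1 : x <= 1 by rewrite ler_pdivrMr // mul1r; lra.
have ha : a <= 1 - x / 2.
  have e1 := expR_ge1Dx x; have e0 := expR_gt0 x.
  rewrite /a expRN -div1r ler_pdivrMr //.
  apply: (@le_trans _ _ ((1 - x / 2) * (1 + x))); first by nra.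
  by rewrite ler_wpM2l //; lra.
have a1 : a < 1 by lra.
have gt := geometric_tail d T (expR_ge0 (- x)) a1.
have i1 : (1 - a)^-1 <= 2 * d%:R.
  have -> : 2 * d%:R = ((2 * d%:R)^-1)^-1 :> R by rewrite invrK.
  rewrite lef_pV2 ?posrE ?subr_gt0 ?invr_gt0 ?mulr_gt0 //.
  have : (2 * d%:R)^-1 <= x / 2 :> R.
    rewrite invfM [_ * d%:R^-1]mulrC ler_pM2r ?invr_gt0 // /x.
    apply: (@le_trans _ _ (r%:R^-1)).
      by rewrite lef_pV2 ?posrE // ler_nat (leq_trans _ rd) // leq_pmulr.
    by rewrite ler_peMl // invr_ge0.
  lra.
have ad : a ^+ d <= (d%:R ^+ 5)^-1.
  have -> : (d%:R ^+ 5)^-1 = expR (- (5 * L)) by rewrite expRN expRM_natl expL.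
  rewrite /a -expRM_natl ler_expR mulrN lerN2.
  apply: (@le_trans _ _ (r%:R * L ^+ 2)).
    rewrite -[X in _ <= _ * X]/(L * L) mulrA ler_pM2r //.
    by apply: (@le_trans _ _ r%:R); [lra|rewrite ler_peMr // ltW].
  rewrite /x [leRHS]mulrA ler_pdivlMr // mulrAC ler_pM2r ?exprn_gt0 // -natrM ler_nat.
  exact: rd.
have d3 : 4 <= d%:R ^+ 2 :> R.
  by rewrite -natrX ler_nat (@leq_exp2r 2 d 2) // (leq_trans _ d5).
apply: (@le_trans _ _ (2 * ((d%:R ^+ 5)^-1 * (2 * d%:R)))).
  rewrite ler_pM2l //; apply: (le_trans gt); apply: ler_pM => //; rewrite ?exprn_ge0 ?expR_ge0 //.
  by rewrite invr_ge0 subr_ge0 ltW.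
have -> : 2 * ((d%:R ^+ 5)^-1 * (2 * d%:R)) = 4 / d%:R ^+ 2 * (d%:R ^+ 2)^-1 :> R.
  by field; rewrite gt_eqF.
by rewrite ler_piMl ?invr_ge0 ?exprn_ge0 // ler_pdivrMr ?exprn_gt0 // mul1r.
Qed.

End PeierlsSum.

(** * Infinite-volume measures *)

Lemma ultra_fmap (S T : Type) (f : S -> T) (U : set_system S) :
  UltraFilter U -> UltraFilter (fmap f U).
Proof.
move=> UU; have PF : ProperFilter (fmap f U) by exact: fmap_proper_filter.
split => // G PG sG; rewrite predeqE => A; split; last exact: sG.
move=> GA; have [//|nA] := in_ultra_setVsetC (f @^-1` A)%classic UU.
have GnA : G (~` A)%classic by apply: sG.
have := filterI GA GnA; rewrite setICr => G0.
by case: (filter_not_empty G (G0 _)).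
Qed.

Section UltraLimit.
Local Open Scope classical_set_scope.
Variables (R : realType) (T : Type) (P : nat -> T -> R).
Hypothesis P01 : forall n A, 0 <= P n A <= 1.

(** One ultrafilter makes all these bounded sequences converge at once, for arbitrarily many [A].
    Linear relations and bounds that hold eventually pass to the limit; countable additivity need
    not. *)
Lemma ultralimit : exists m : T -> R, [/\
  forall A B C a b n0, (forall n, (n0 <= n)%N -> P n C = a * P n A + b * P n B) ->
    m C = a * m A + b * m B,
  forall A a n0, (forall n, (n0 <= n)%N -> P n A <= a) -> m A <= a &
  forall A a n0, (forall n, (n0 <= n)%N -> a <= P n A) -> a <= m A].
Proof.
have [U [UU sU]] := ultraFilterLemma (@eventually_filter).
have ev n0 : U [set n | (n0 <= n)%N]%classic by apply: sU; exists n0.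
have lim A : exists x : R, P n A @[n --> U] --> x.
  have := @segment_compact R 0 1; rewrite compact_ultra => /(_ (P n A @[n --> U]) (ultra_fmap _ UU))[].
    by rewrite /fmap /=; apply: filterS (ev 0%N) => n _; rewrite /= in_itv /= P01.
  by move=> x [_ h]; exists x.
have [m mP] := choice lim.
exists m; split=> [A B C a b n0 h|A a n0 h|A a n0 h].
- have h1 : P n C @[n --> U] --> a * m A + b * m B.
    apply: (@cvg_trans _ ((a * P n A + b * P n B) @[n --> U])).
      by apply: near_eq_cvg; apply: filterS (ev n0) => n /h ->.
    by apply: cvgD; apply: cvgMr => //; exact: mP.
  exact: (cvg_unique (@norm_hausdorff _ _) (mP C) h1).
- by apply: (cvgr_to_le (mP A)); apply: filterS (ev n0) => n /h.
- by apply: (cvgr_to_ge (mP A)); apply: filterS (ev n0) => n /h.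
Qed.

End UltraLimit.

Section Depends.
Local Open Scope classical_set_scope.
Variable V : countType.

Definition depends (l : seq V) (A : set (V -> bool)) : Prop :=
  forall w w' : V -> bool, {in l, w =1 w'} -> A w -> A w'.

Lemma depends_sub l l' A : {subset l <= l'} -> depends l A -> depends l' A.
Proof. by move=> ll dA w w' ww; apply: dA => v /ll; exact: ww. Qed.

Lemma dependsI l A B : depends l A -> depends l B -> depends l (A `&` B).
Proof. by move=> dA dB w w' ww [/(dA _ _ ww) ? /(dB _ _ ww)]. Qed.

Lemma depends_measurable (S : set V) l A :
  depends l A -> (forall v, v \in l -> S v) -> sigma_on S A.
Proof.
elim: l A => [|v l IH] A dA lS.
  have [[w Aw]|nA] := pselect (exists w, A w).
    have -> : A = setT by apply/seteqP; split => // w' _; exact: dA Aw.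
    exact: (@measurableT _ (g_sigma_algebraType (cylinders S))).
  have -> : A = set0 by apply/seteqP; split => // w Aw; apply: nA; exists w.
  exact: (@measurable0 _ (g_sigma_algebraType (cylinders S))).
pose upd b (w : V -> bool) : V -> bool := fun x => if x == v then b else w x.
have updP b (w : V -> bool) : w v = b -> upd b w = w.
  by move=> wb; apply/funext => x; rewrite /upd; case: eqP => // ->.
have mA b : sigma_on S [set w | A (upd b w)].
  apply: IH => [w w' ww|x xl]; last by apply: lS; rewrite inE xl orbT.
  by apply: dA => x; rewrite inE /upd; case: eqP => //= _; apply: ww.
have mv : sigma_on S [set w : V -> bool | w v].
  by apply: sub_sigma_algebra; exists v => //; apply: lS; rewrite inE eqxx.
have -> : A = ([set w : V -> bool | w v] `&` [set w | A (upd true w)]) `|`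
              (~` [set w : V -> bool | w v] `&` [set w | A (upd false w)]).
  apply/seteqP; split=> [w Aw|w [[/= wv Aw]|[/= /negP/negbTE wv Aw]]];
    try by rewrite updP in Aw.
  case wv: (w v); [left|right]; (split; [by rewrite /= wv|]);
    by rewrite /mkset updP.
apply: (@measurableU _ (g_sigma_algebraType (cylinders S))).
  exact: (@measurableI _ (g_sigma_algebraType (cylinders S)) _ _ mv (mA true)).
apply: (@measurableI _ (g_sigma_algebraType (cylinders S)) _ _ _ (mA false)).
exact: (@measurableC _ (g_sigma_algebraType (cylinders S)) _ mv).
Qed.

Lemma measurable_config l A : depends l A -> measurable (A : set (config V)).
Proof. by move=> dA; apply: (depends_measurable (S := [set: V]) dA). Qed.

End Depends.

(** * A finitely additive law realized as a measure *)

Section Law.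
Local Open Scope classical_set_scope.
Variables (R : realType) (V : countType) (m : set (V -> bool) -> R).
Hypotheses (m_ge0 : forall A, 0 <= m A) (mT : m setT = 1).
Hypothesis mU : forall A B, A `&` B = set0 -> m (A `|` B) = m A + m B.

Lemma m_set0 : m set0 = 0.
Proof. by have := mU (setI0 set0); rewrite setU0 => /eqP; rewrite -subr_eq subrr => /eqP. Qed.

Lemma m_split (A B : set (V -> bool)) : m A = m (A `&` B) + m (A `&` ~` B).
Proof.
rewrite -mU; first by rewrite -setIUr setUv setIT.
by rewrite setIACA setICr setI0.
Qed.

Definition cell (k : nat) (w : V -> bool) : bool :=
  if pickle_inv k is Some v then w v else false.

(* Words list the first cells in reverse order. *)
Fixpoint cyl (s : seq bool) : set (V -> bool) :=
  if s is b :: s' then cyl s' `&` [set w | cell (size s') w = b] else setT.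

Arguments cyl : simpl never.

Lemma cyl_nil : cyl [::] = setT. Proof. by []. Qed.

Lemma cyl_cons b s : cyl (b :: s) = cyl s `&` [set w | cell (size s) w = b].
Proof. by []. Qed.

(* [0, 1[ is cut into nested intervals: the word s gets the interval of length
   m (cyl s) starting at left_end s, and sample reads off the digits of a point. *)
Fixpoint left_end (s : seq bool) : R :=
  if s is b :: s' then left_end s' + (if b then m (cyl (false :: s')) else 0) else 0.

Lemma m_cyl s : m (cyl s) = m (cyl (false :: s)) + m (cyl (true :: s)).
Proof.
rewrite (m_split (cyl s) [set w | cell (size s) w = false]) !cyl_cons.
congr (_ + m (_ `&` _)); apply/seteqP; split=> w /=; first by case: (cell _ _).
by move=> ->.
Qed.

Lemma left_end_bounds s : 0 <= left_end s /\ left_end s + m (cyl s) <= 1.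
Proof.
elim: s => [|b s [h1 h2]]; first by rewrite /= cyl_nil mT add0r.
have := m_cyl s; have := m_ge0 (cyl (false :: s)); have := m_ge0 (cyl (true :: s)).
by rewrite [left_end _]/=; case: b; lra.
Qed.

Fixpoint digits (x : R) (k : nat) : seq bool :=
  if k is k'.+1 then let s := digits x k' in
    (left_end s + m (cyl (false :: s)) <= x) :: s else [::].

Lemma size_digits x k : size (digits x k) = k.
Proof. by elim: k => //= k ->. Qed.

Lemma digitsP x s : 0 <= x < 1 ->
  (digits x (size s) == s) = (left_end s <= x < left_end s + m (cyl s)).
Proof.
move=> x01; elim: s => [|b s IH]; first by rewrite /= eqxx cyl_nil mT add0r.
have := m_cyl s; have := m_ge0 (cyl (false :: s)); have := m_ge0 (cyl (true :: s)).
move=> h1 h0 e; rewrite [LHS]/= eqseq_cons; have [E|NE] := eqVneq (digits x (size s)) s.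
  rewrite E andbT; have := esym IH; rewrite E eqxx => /andP[lx xu].
  rewrite [left_end (_ :: _)]/=; case: b.
    by rewrite eqb_id; move: xu; rewrite e addrA => ->; rewrite andbT.
  by rewrite eqbF_neg -ltNge addr0 lx.
rewrite andbF; apply/esym/negbTE; move: IH; rewrite (negPf NE) => /esym/negbT.
apply: contra => /andP[]; rewrite [left_end (_ :: _)]/=; case: b => lx xu.
  by apply/andP; split; lra.
by apply/andP; split; lra.
Qed.

(** Digits are listed in reverse, so the digit of index [k] heads the list of the first [k + 1]. Off
    the unit interval all sites are vacant, to have a total function. *)
Definition sample (x : R) : config V := fun v => (0 <= x < 1) && head false (digits x (choice.pickle v).+1).

Lemma cell_sample x k : 0 <= x < 1 -> cell k (sample x) = head false (digits x k.+1).
Proof.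
move=> x01; rewrite /cell; have := @pickle_invK V k; case E: (pickle_inv k) => [v|] /= h.
  by rewrite /sample x01 h.
(* Here [k] codes no site: the cylinder of [true :: s] is empty, its interval has length 0, and the
   digit cannot be [true]. *)
apply/esym/negbTE/negP => hx; have := digitsP (digits x k.+1) x01.
rewrite size_digits eqxx => /esym; rewrite [digits x k.+1]/= hx.
set s := digits x k; have -> : cyl (true :: s) = set0.
  by apply/seteqP; split => // w /= [_]; rewrite /cell size_digits E.
by rewrite m_set0 addr0 => /andP[a /(le_lt_trans a)]; rewrite ltxx.
Qed.

Lemma sample_cyl x s : 0 <= x < 1 -> cyl s (sample x) <-> left_end s <= x < left_end s + m (cyl s).
Proof.
move=> x01; rewrite -digitsP //; elim: s => [|b s IH]; first by rewrite /= eqxx.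
rewrite cyl_cons [size _]/= [digits _ _]/= eqseq_cons; split.
  move=> [/IH/eqP e] /=; rewrite cell_sample // => <-.
  by rewrite [digits _ _.+1]/= e !eqxx.
move=> /andP[/eqP hb hs] /=; split; first exact/IH.
by rewrite cell_sample // [digits _ _.+1]/= hb.
Qed.

Lemma measurable_sample :
  measurable_fun [set: measurableTypeR R] (sample : measurableTypeR R -> config V).
Proof.
refine (@measurability _ _ (measurableTypeR R) (config V) setT sample
  (cylinders [set: V]) _ _) => // _ [_ [v _ <-] <-].
rewrite setTI.
have -> : sample @^-1` [set w | w v] = \bigcup_(s in [set` [seq val s | s : (choice.pickle v).-tuple bool]])
    `[left_end (true :: s), left_end (true :: s) + m (cyl (true :: s))[%classic.
  apply/seteqP; split=> [x /= /andP[x01 hx]|x [s /= /mapP[t _ ->]]].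
    exists (digits x (choice.pickle v)).
      apply/mapP; exists (Tuple (introT eqP (size_digits x (choice.pickle v)))) => //.
      by rewrite mem_enum.
    move: hx; rewrite /= => hx.
    set S := digits x _; suff : left_end (true :: S) <= x < left_end (true :: S) + m (cyl (true :: S)).
      by rewrite /= in_itv.
    have := digitsP (digits x (choice.pickle v).+1) x01.
    have E : digits x (choice.pickle v).+1 = true :: S by rewrite /= hx.
    by rewrite size_digits eqxx E => /esym.
  rewrite in_itv => h0.
  have h : left_end (true :: val t) <= x < left_end (true :: val t) + m (cyl (true :: val t)) := h0.
  have x01 : 0 <= x < 1.
    have [b1 b2] := left_end_bounds (true :: val t); move/andP: h => [h1 h2].
    by rewrite (le_trans b1 h1) (lt_le_trans h2 b2).
  rewrite /sample x01 /=; have := digitsP (true :: val t) x01; rewrite h => /eqP.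
  by rewrite [size _]/= size_tuple => e; rewrite -[_ <= x]/(head false (digits x (choice.pickle v).+1)) e.
apply: fin_bigcup_measurable => [|s _]; [exact: finite_seq|exact: measurable_itv].
Qed.

Definition sample_rv : measurableTypeR R -> config V := sample.

HB.instance Definition _ := isMeasurableFun.Build _ _ (measurableTypeR R) (config V)
  sample_rv measurable_sample.

Lemma uniform01_itv (a b : R) : 0 <= a -> a <= b -> b <= 1 ->
  uniform_prob (@ltr01 R) `[a, b[%classic = (b - a)%:E.
Proof.
move=> a0 ab b1; rewrite /uniform_prob integral_uniform_pdf.
have -> : `[a, b[%classic `&` `[0, 1]%classic = `[a, b[%classic :> set R.
  apply/setIidl => x /=; rewrite !in_itv /= => /andP[h1 h2].
  by rewrite (le_trans a0 h1) (le_trans (ltW h2) b1).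
rewrite (eq_integral (fun=> 1%E)); last first.
  move=> x; rewrite inE /= in_itv /= => /andP[h1 h2]; rewrite /uniform_pdf.
  by rewrite (le_trans a0 h1) (le_trans (ltW h2) b1) subr0 invr1.
rewrite integral_cst /= ?mul1e; last exact: measurable_itv.
rewrite lebesgue_measure_itv /= lte_fin; case: ltP => // ba.
by have -> : b = a; [apply/eqP; rewrite eq_le ab ba|rewrite subrr].
Qed.

(** The image of the uniform law on the unit interval under [sample] inherits countable additivity,
    and finite additivity of [m] is enough for the intervals to nest. An event on finitely many
    sites is cut into cylinders long enough to decide it. *)
Lemma law_exists : exists mu : probability (config V) R,
  forall l A, depends l A -> mu A = (m A)%:E.
Proof.
pose U : probability (measurableTypeR R) R := uniform_prob (@ltr01 R).
pose X := sample_rv.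
pose mu : probability (config V) R := distribution U X.
have dcyl s : depends (pmap pickle_inv (iota 0 (size s))) (cyl s).
  elim: s => [//|b s IH] w w' ww; rewrite cyl_cons => -[h1 h2]; split.
    apply: IH h1 => v; rewrite !mem_pmap => /mapP[k kk e]; apply: ww.
    rewrite mem_pmap; apply/mapP; exists k => //.
    by move: kk; rewrite !mem_iota /= => /ltnW.
  rewrite -h2 /cell; case E: (pickle_inv _) => [v|//]; apply/esym/ww.
  by rewrite mem_pmap; apply/mapP; exists (size s) => //; rewrite mem_iota /=.
have mucyl s : mu (cyl s) = (m (cyl s))%:E.
  have [b1 b2] := left_end_bounds s.
  rewrite /mu /distribution /pushforward /=.
  have U01 : U `[0, 1[%classic = 1%E by rewrite /U /= uniform01_itv ?subr0.
  have m01 : measurable (`[0, 1[%classic : set (measurableTypeR R)) by exact: measurable_itv.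
  have mX : measurable (X @^-1` cyl s).
    by rewrite -[_ @^-1` _]setTI; apply: measurable_sample => //; apply: measurable_config (dcyl s).
  have Uc : U (~` `[0, 1[%classic) = 0%E by rewrite probability_setC // U01 subee.
  have -> : U (X @^-1` cyl s) = U ((X @^-1` cyl s) `&` `[0, 1[%classic).
    have mC : measurable (~` `[0, 1[%classic : set (measurableTypeR R)).
      exact: measurableC.
    rewrite [X in U X = _](_ : _ = ((X @^-1` cyl s) `&` `[0, 1[%classic) `|`
      ((X @^-1` cyl s) `&` ~` `[0, 1[%classic)); last by rewrite -setIUr setUv setIT.
    rewrite measureU //; [|exact: measurableI|exact: measurableI|
      by rewrite setIACA setICr setI0].
    rewrite [X in (_ + X)%E](_ : _ = 0%E) ?adde0 //.
    apply/eqP; rewrite eq_le measure_ge0 andbT -Uc; apply: le_measure.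
    - by rewrite inE; apply: measurableI.
    - by rewrite inE.
    - exact: subIsetr.
  have -> : (X @^-1` cyl s) `&` `[0, 1[%classic =
      `[left_end s, left_end s + m (cyl s)[%classic.
    apply/seteqP; split => x /=; rewrite !in_itv /=.
      by move=> [hc x01]; apply/sample_cyl.
    move=> h; have x01 : 0 <= x < 1.
      by move/andP: h => [h1 h2]; rewrite (le_trans b1 h1) (lt_le_trans h2 b2).
    by split => //; apply/sample_cyl.
  by rewrite /U /= uniform01_itv ?lerDl // addrAC subrr add0r.
exists mu => l A dA; pose N := (\max_(v <- l) (choice.pickle v).+1)%N.
have lN v : v \in l -> (choice.pickle v < N)%N.
  by move=> vl; rewrite /N (big_rem v vl) /= leq_max ltnSn.
suff main j s : (size s + j = N)%N -> mu (A `&` cyl s) = (m (A `&` cyl s))%:E.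
  by have := main N [::] erefl; rewrite cyl_nil setIT.
elim: j s => [|j IH] s sN.
  rewrite addn0 in sN.
  have [[w [Aw cw]]|no] := pselect (exists w, A w /\ cyl s w); last first.
    have -> : A `&` cyl s = set0 by apply/seteqP; split => // w [Aw cw]; apply: no; exists w.
    by rewrite measure0 m_set0.
  have -> : A `&` cyl s = cyl s; last exact: mucyl.
  apply/setIidr => w' cw'; apply: dA Aw => v /lN; rewrite -sN => vs.
  have cE : forall w0 s0 k, cyl s0 w0 -> (k < size s0)%N ->
      cell k w0 = nth false (rev s0) k.
    move=> w0; elim=> [//|b s0 IH0] k [h1 h2]; rewrite ltnS leq_eqVlt => /orP[/eqP ->|ks].
      by rewrite rev_cons nth_rcons size_rev ltnn eqxx.
    by rewrite rev_cons nth_rcons size_rev ks; apply: IH0.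
  have := cE _ _ _ cw' vs; have := cE _ _ _ cw vs.
  by rewrite /cell pickleK_inv => -> ->.
have mA s0 : measurable (A `&` cyl s0 : set (config V)).
  by apply: measurableI; [apply: measurable_config dA|apply: measurable_config (dcyl s0)].
have -> : A `&` cyl s = (A `&` cyl (false :: s)) `|` (A `&` cyl (true :: s)).
  rewrite -setIUr !cyl_cons -setIUr; congr (_ `&` _); apply/esym/setIidl => w _ /=.
  by case: (cell _ _); [right|left].
have dis : (A `&` cyl (false :: s)) `&` (A `&` cyl (true :: s)) = set0.
  by apply/seteqP; split => // w [[_ [_ /= e1]] [_ [_ /= e2]]]; rewrite e1 in e2.
rewrite measureU // mU // EFinD; congr (_ + _)%E; apply: IH; rewrite /=; lia.
Qed.

End Law.

Lemma zd_adjP (d : nat) (x y : 'rV[int]_d) :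
  reflect (exists s, y = x + stp s) (Zd_adj x y).
Proof.
apply: (iffP idP) => [/eqP e|[s ->]].
  have [i xyi] : exists i, x 0 i != y 0 i.
    apply/existsP; apply: contra_eqT e => /existsPn h.
    rewrite big1 // => i _; have /negPn/eqP -> := h i; by rewrite subrr normr0.
  move: e; rewrite (bigD1 i) //= => e.
  have r0 : 0 <= \sum_(j < d | j != i) `|x 0 j - y 0 j| by apply: sumr_ge0.
  have p0 : 0 < `|x 0 i - y 0 i| by rewrite normr_gt0 subr_eq0.
  have s0 : \sum_(j < d | j != i) `|x 0 j - y 0 j| = 0.
    by move: r0 p0 e; move: (\sum_(j < d | j != i) _) `|_| => a b; lia.
  exists (i, y 0 i < x 0 i); apply/rowP => j; rewrite mxE stp_coord /=.
  have [->|ji] := eqVneq j i.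
    move: p0 e; rewrite s0 addr0; move: (x 0 i) (y 0 i) => a b p0 e.
    by case: ltP => h; rewrite ?expr1 ?expr0; lia.
  move/eqP: s0; rewrite psumr_eq0 // => /allP /(_ j).
  rewrite mem_index_enum => /(_ isT); rewrite ji /= normr_eq0 subr_eq0 => /eqP ->.
  by rewrite addr0.
rewrite /Zd_adj (bigD1 s.1) //= big1 ?addr0 => [|j js].
  by rewrite mxE stp_coord eqxx opprD addrA subrr sub0r normrN normrX normrN1 expr1n.
by rewrite mxE stp_coord (negPf js) addr0 subrr normr0.
Qed.

Lemma feasibleP (d : nat) (w : 'rV[int]_d -> bool) :
  feasible (@Zd_adj d) w <-> forall x s, ~~ (w x && w (x + stp s)).
Proof.
split=> [h x s|h x y /zd_adjP[s ->]]; last exact: h.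
by apply: h; apply/zd_adjP; exists s.
Qed.

Section JoinConfig.
Variables (V : countType) (W : {fset V}).

(** Vacating all sites off a finite set turns the kernel into a function of finitely many
    coordinates. *)
Definition mask (B : {fset V}) (eta : V -> bool) : V -> bool :=
  fun v => (v \in B) && eta v.

Definition supp (z : {ffun W -> bool}) : {fset V} := [fset v in W | join_config z pred0 v].

Lemma join_in (z : {ffun W -> bool}) w v : v \in W -> join_config z w v = (v \in supp z).
Proof. by move=> vW; rewrite /supp in_fset /= inE /= vW /= /join_config insubT. Qed.

Lemma join_out (z : {ffun W -> bool}) w v : v \notin W -> join_config z w v = w v.
Proof. by move=> vW; rewrite /join_config insubF //; apply/negbTE. Qed.

Lemma supp_sub z : supp z `<=` W.
Proof. by apply/fsubsetP => v; rewrite /supp in_fset /= inE => /andP[]. Qed.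

Lemma weight_gt0 (R : realType) (lam : R) (z : {ffun W -> bool}) :
  0 < lam -> 0 < weight lam z.
Proof. by move=> lam0; apply: prodr_gt0 => v _; apply: exprn_gt0. Qed.

End JoinConfig.

(** * Finite-volume laws and their conditional kernels *)

Section FiniteVolume.
Variables (R : realType) (d : nat).
Local Notation V := 'rV[int]_d.
Variable par : pred V.
Hypothesis par_stp : forall x s, par (x + stp s) = ~~ par x.
Variable lam : R.
Hypothesis lam0 : 0 < lam.
Variable Lam : {fset V}.
Local Notation Z := (Zsum par Lam lam).

Definition mass (A : set (V -> bool)) : R :=
  \sum_(I <- fpowerset Lam | `[< admissible par Lam I >] && `[< A (occ par Lam I) >])
    wt lam I.

Definition fin_law (A : set (V -> bool)) : R := Z^-1 * mass A.

Lemma wt_pos (I : {fset V}) : 0 < wt lam I.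
Proof. exact: exprn_gt0. Qed.

Lemma Z_pos : 0 < Z.
Proof.
rewrite /Zsum big_mkcond (bigD1_seq fset0) ?fset_uniq ?fpowersetE ?fsub0set //= asboolT; last first.
  move=> x s; rewrite /occ !in_fset0 par_stp.
  by case: (x \in Lam) => //; case: (_ \in Lam); rewrite ?andbF // andbN.
by rewrite ltr_pwDl ?wt_pos ?sumr_ge0 // => I _; case: ifP => // _; exact/ltW/wt_pos.
Qed.

Lemma mass_ge0 A : 0 <= mass A.
Proof. by apply: sumr_ge0 => I _; exact/ltW/wt_pos. Qed.

Lemma mass_le A B : (A `<=` B)%classic -> mass A <= mass B.
Proof.
move=> AB; rewrite /mass big_mkcond [leRHS]big_mkcond; apply: ler_sum => I _.
case: ifP => [/andP[-> /asboolP/AB/asboolP -> //]|_].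
by case: ifP => // _; exact/ltW/wt_pos.
Qed.

Lemma massT : mass setT = Z.
Proof. by apply: eq_bigl => I; rewrite [X in _ && X]asboolT ?andbT. Qed.

Lemma massU A B : (A `&` B = set0)%classic -> mass (A `|` B)%classic = mass A + mass B.
Proof.
move=> AB; rewrite /mass big_mkcond [X in _ = X + _]big_mkcond [X in _ = _ + X]big_mkcond /=.
rewrite -big_split; apply: eq_bigr => I _; case: (`[< admissible _ _ _ >]) => /=; last by rewrite addr0.
have [a|a] := pselect (A (occ par Lam I)); have [b|b] := pselect (B (occ par Lam I)).
- by have : (A `&` B)%classic (occ par Lam I) by []; rewrite AB.
- by rewrite (asboolT a) (asboolF b) asboolT ?addr0 //; left.
- by rewrite (asboolT b) (asboolF a) asboolT ?add0r //; right.
- by rewrite (asboolF a) (asboolF b) asboolF ?addr0 // => -[].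
Qed.

Lemma fin_law_ge0 A : 0 <= fin_law A.
Proof. by rewrite mulr_ge0 ?mass_ge0 // invr_ge0 ltW // Z_pos. Qed.

Lemma fin_law_le1 A : fin_law A <= 1.
Proof. by rewrite /fin_law mulrC ler_pdivrMr ?Z_pos // mul1r -massT; exact: mass_le. Qed.

Lemma fin_lawT : fin_law setT = 1.
Proof. by rewrite /fin_law massT mulVf // gt_eqF // Z_pos. Qed.

Lemma fin_lawU A B : (A `&` B = set0)%classic -> fin_law (A `|` B)%classic = fin_law A + fin_law B.
Proof. by move=> AB; rewrite /fin_law massU // mulrDr. Qed.

Lemma fin_law_adj x s : fin_law [set w : V -> bool | w x /\ w (x + stp s)] = 0.
Proof.
rewrite /fin_law /mass big1 ?mulr0 // => I /andP[/asboolP aI /asboolP[h1 h2]].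
by have := aI x s; rewrite h1 h2.
Qed.

Section Kernel.
Variables (W B : {fset V}).
Hypotheses (WLam : W `<=` Lam) (WB : forall x s, x \in W -> x + stp s \in W `|` B).
Variable A : set (V -> bool).
Variable eta : V -> bool.
Hypothesis (A_W : forall w w' : V -> bool, (forall v, v \notin W -> w v = w' v) -> A w -> A w').
Hypothesis (A_B : forall w : V -> bool, A w -> forall v, v \in B -> v \notin W -> w v = eta v).

Local Notation masked := (mask B eta).

Lemma weight_supp (z : {ffun W -> bool}) : weight lam z = lam ^+ #|` supp z|.
Proof.
rewrite /supp card_fset_count -sum1_count big_mkcond big_seq_fsetE /=.
rewrite (big_morph (fun k => lam ^+ k) (exprD _) (expr0 _)).
apply: eq_bigr => v _; rewrite /join_config inE /= insubT ?fsvalP // => vW.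
by rewrite (_ : Sub _ _ = v) ?fsvalP; [case: (z v)|exact: val_inj].
Qed.

Lemma restricts_toP (z : {ffun W -> bool}) (w : V -> bool) :
  restricts_to z w <-> forall v, v \in W -> w v = (v \in supp z).
Proof.
split=> [h v vW|h v].
  by rewrite -(join_in z w vW) /join_config insubT -h.
rewrite h ?fsvalP // -(join_in z w (fsvalP v)) /join_config.
by case: insubP => [u _ /val_inj -> //|]; rewrite fsvalP.
Qed.

Lemma occ_join (J : {fset V}) (z : {ffun W -> bool}) : J `<=` Lam `\` W ->
  occ par Lam (J `|` supp z) =1 join_config z (occ par Lam J).
Proof.
move=> JL v; case: (boolP (v \in W)) => vW.
  rewrite join_in // /occ (fsubsetP WLam) // in_fsetU.
  by case: (boolP (v \in J)) => // /(fsubsetP JL); rewrite in_fsetD vW.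
rewrite join_out // /occ in_fsetU; case: (v \in Lam) => //.
by case: (boolP (v \in supp z)) => [/(fsubsetP (supp_sub z))|]; rewrite ?(negPf vW) // orbF.
Qed.

Lemma adm_join (J : {fset V}) (z : {ffun W -> bool}) : J `<=` Lam `\` W -> A (occ par Lam J) ->
  `[< admissible par Lam (J `|` supp z) >] =
  `[< admissible par Lam J >] && `[< feasible (@Zd_adj d) (join_config z masked) >].
Proof.
move=> JL AJ.
have JW v : v \in W -> occ par Lam J v = false.
  move=> vW; rewrite /occ (fsubsetP WLam) //; apply/negbTE/negP => /(fsubsetP JL).
  by rewrite in_fsetD vW.
apply/asboolP/andP => [aJ|[/asboolP aJ /asboolP/feasibleP fz] x s].
  split; apply/asboolP; last first.
    apply/feasibleP => x s; apply: contra (aJ x s); rewrite !occ_join //.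
    have le v : join_config z masked v -> join_config z (occ par Lam J) v.
      case: (boolP (v \in W)) => vW; first by rewrite !join_in.
      by rewrite !join_out // => /andP[vB]; rewrite (A_B AJ).
    by move=> /andP[/le -> /le ->].
  move=> x s; apply: contra (aJ x s); rewrite !occ_join //.
  have le v : occ par Lam J v -> join_config z (occ par Lam J) v.
    by case: (boolP (v \in W)) => vW; [rewrite JW|rewrite join_out].
  by move=> /andP[/le -> /le ->].
rewrite !occ_join //.
have key v : v \in W `|` B -> join_config z (occ par Lam J) v = join_config z masked v.
  rewrite in_fsetU; case: (boolP (v \in W)) => vW /= vB; first by rewrite !join_in.
  by rewrite !join_out // /mask vB (A_B AJ).
case: (boolP (x \in W)) => xW.
  by rewrite (key x) ?in_fsetU ?xW // (key _ (WB s xW)); apply: fz.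
case: (boolP (x + stp s \in W)) => yW; last by rewrite !join_out //; exact: aJ.
have xB : x \in W `|` B by have := WB (opp s) yW; rewrite stpN addrK.
by rewrite (key _ xB) key ?in_fsetU ?yW //; apply: fz.
Qed.

Local Notation outer := (\sum_(J <- fpowerset (Lam `\` W) |
  `[< admissible par Lam J >] && `[< A (occ par Lam J) >]) wt lam J).

(** An admissible [I] in the event is [J] together with [supp z], with [J] outside [W]. As the event
    fixes the values on [B] outside [W] to those of [eta], the compatibility of [z] with [J] depends
    on [eta] only, and the weights factor. *)
Lemma mass_restrict (z : {ffun W -> bool}) :
  mass (restricts_to z `&` A)%classic =
  (if `[< feasible (@Zd_adj d) (join_config z masked) >] then weight lam z else 0) * outer.
Proof.
have Aocc (J : {fset V}) : J `<=` Lam `\` W ->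
    `[< A (occ par Lam (J `|` supp z)) >] = `[< A (occ par Lam J) >].
  move=> JL; have out v : v \notin W -> occ par Lam (J `|` supp z) v = occ par Lam J v.
    by move=> vW; rewrite occ_join // join_out.
  by apply/asboolP/asboolP; apply: A_W => v /out ->.
transitivity (\sum_(J <- fpowerset (Lam `\` W) |
    `[< admissible par Lam (J `|` supp z) >] && `[< A (occ par Lam J) >]) wt lam (J `|` supp z)).
  rewrite /mass -big_filter -[RHS]big_filter -[RHS](big_map (fun J => J `|` supp z) xpredT).
  have supD (J : {fset V}) : J `<=` Lam `\` W -> (J `|` supp z) `\` W = J.
    move=> JL; apply/fsetP => v; rewrite in_fsetD in_fsetU.
    case: (boolP (v \in J)) => [/(fsubsetP JL)|_] /=; first by rewrite in_fsetD => /andP[->].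
    by case: (boolP (v \in W)) => //= vW; apply/negbTE/negP => /(fsubsetP (supp_sub z)); rewrite (negPf vW).
  apply/perm_big/uniq_perm.
  - by rewrite filter_uniq ?fset_uniq.
  - rewrite map_inj_in_uniq ?filter_uniq ?fset_uniq // => J1 J2.
    rewrite !mem_filter !fpowersetE => /andP[_ h1] /andP[_ h2] e.
    by rewrite -(supD _ h1) e supD.
  move=> I; rewrite mem_filter fpowersetE; apply/andP/mapP => [[]|[J]].
    move=> /andP[aI /asboolP[/restricts_toP rI AI]] IL.
    have IE : I = (I `\` W) `|` supp z.
      apply/fsetP => v; rewrite in_fsetU in_fsetD; case: (boolP (v \in W)) => vW /=.
        by rewrite -rI // /occ (fsubsetP WLam).
      by case: (boolP (v \in supp z)) => [/(fsubsetP (supp_sub z))|]; rewrite ?(negPf vW) // orbF.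
    have JL : I `\` W `<=` Lam `\` W by exact: fsetSD.
    exists (I `\` W); rewrite // mem_filter fpowersetE JL -Aocc // -IE aI /= andbT.
    exact/asboolP.
  rewrite mem_filter fpowersetE => /andP[/andP[aJ AJ] JL] ->.
  rewrite aJ /=; split.
    apply/asboolP; split; last by apply/asboolP; rewrite Aocc.
    by apply/restricts_toP => v vW; rewrite occ_join // join_in.
  by rewrite fsubUset (fsubset_trans JL) ?fsubsetDl // (fsubset_trans (supp_sub z)).
rewrite mulr_sumr big_seq_cond [RHS]big_seq_cond.
rewrite big_mkcond [RHS]big_mkcond; apply: eq_bigr => J _.
rewrite fpowersetE; case: (boolP (J `<=` _)) => //= JL.
case: (boolP `[< A _ >]) => [/asboolP AJ|]; last by rewrite !andbF.
rewrite !andbT adm_join //; case: `[< admissible _ _ _ >] => //=; case: ifP => _; last by rewrite mul0r.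
rewrite weight_supp /wt -exprD addnC; congr (_ ^+ _).
have /eqP := cardfsUI J (supp z); suff -> : J `&` supp z = fset0 by rewrite cardfs0 addn0 => /eqP.
apply/eqP; rewrite -fsubset0; apply/fsubsetP => v; rewrite in_fsetI => /andP[/(fsubsetP JL)].
by rewrite in_fsetD => /andP[vW _] /(fsubsetP (supp_sub z)); rewrite (negPf vW).
Qed.

Lemma mass_sum : mass A = \sum_(z : {ffun W -> bool}) mass (restricts_to z `&` A)%classic.
Proof.
rewrite /mass; under [RHS]eq_bigr do rewrite big_mkcond.
rewrite exchange_big /= big_mkcond; apply: eq_bigr => I _.
pose zI : {ffun W -> bool} := [ffun v => occ par Lam I (val v)].
rewrite (bigD1 zI) //= big1 ?addr0 => [|z /eqP zz].
  congr (if _ && _ then _ else _); apply/asboolP/asboolP => [AI|[]//].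
  by split => // v; rewrite ffunE.
rewrite (_ : (`[< (restricts_to z `&` A)%classic _ >]) = false) ?andbF //.
apply/asboolPn => -[h _]; apply: zz; apply/ffunP => v; rewrite ffunE; exact/esym/h.
Qed.

Lemma fin_law_kernel (z : {ffun W -> bool}) :
  fin_law (restricts_to z `&` A)%classic =
  hard_core_kernel (@Zd_adj d) lam z masked * fin_law A.
Proof.
rewrite /fin_law mulrCA; congr (_ * _).
rewrite mass_sum; under [in RHS]eq_bigr do rewrite mass_restrict.
rewrite -mulr_suml -big_mkcond mass_restrict /hard_core_kernel.
case: ifP => fz; last by rewrite !mul0r.
rewrite [RHS]mulrACA [X in _ = X * _](_ : _ = 1) ?mul1r //; apply: mulVf.
rewrite gt_eqF // /partition_function (bigD1 z) //= ltr_pwDl ?weight_gt0 // sumr_ge0 // => z' _.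
exact/ltW/weight_gt0.
Qed.

End Kernel.
End FiniteVolume.

(** * From cylinder equations to conditional probabilities *)

Section DLR.
Local Open Scope classical_set_scope.
Variables (R : realType) (V : countType) (adj : rel V) (lam : R).
Hypothesis lam0 : 0 < lam.
Variable mu : probability (config V) R.
Variable bd : {fset V} -> {fset V}.
Hypothesis bd_out : forall (W : {fset V}) v, v \in bd W -> v \notin W.
Hypothesis bd_adj : forall (W : {fset V}) x y, x \in W -> y \notin W -> adj x y || adj y x -> y \in bd W.

Hypothesis mu_kernel : forall (W : {fset V}) (z : {ffun W -> bool}) (eta : V -> bool)
  (l : seq V) (A : set (V -> bool)), depends l A -> (forall v, v \in l -> v \notin W) ->
  (forall w : V -> bool, A w -> forall v, v \in bd W -> w v = eta v) ->
  mu (restricts_to z `&` A) = ((hard_core_kernel adj lam z (mask (bd W) eta))%:E * mu A)%E.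
Hypothesis mu_adj : forall x y, adj x y -> mu [set w : V -> bool | w x /\ w y] = 0%E.

Lemma kernel_bounds (W : {fset V}) (z : {ffun W -> bool}) w :
  0 <= hard_core_kernel adj lam z w <= 1.
Proof.
rewrite /hard_core_kernel; case: ifP => [fz|_]; last by rewrite lexx ler01.
have zp : weight lam z <= partition_function adj lam W w.
  by rewrite /partition_function (bigD1 z) //= lerDl sumr_ge0 // => z' _; exact/ltW/weight_gt0.
have p0 := lt_le_trans (weight_gt0 z lam0) zp.
by rewrite mulr_ge0 ?invr_ge0 ?(ltW p0) ?(ltW (weight_gt0 z lam0)) //= mulrC ler_pdivrMr // mul1r.
Qed.

Lemma kernel_mask (W : {fset V}) (z : {ffun W -> bool}) (w : V -> bool) :
  feasible adj w -> hard_core_kernel adj lam z (mask (bd W) w) = hard_core_kernel adj lam z w.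
Proof.
move=> fw; have eqf (z' : {ffun W -> bool}) :
    `[< feasible adj (join_config z' (mask (bd W) w)) >] = `[< feasible adj (join_config z' w) >].
  have jin u u' v : v \in W -> join_config z' u v = join_config z' u' v.
    by move=> vW; rewrite !join_in.
  apply/asboolP/asboolP => h x y xy; last first.
    apply: contra (h x y xy).
    have le v : join_config z' (mask (bd W) w) v -> join_config z' w v.
      by case: (boolP (v \in W)) => vW; [rewrite (jin _ w)|rewrite !join_out // => /andP[]].
    by move=> /andP[/le -> /le ->].
  have [xW|xW] := boolP (x \in W); have [yW|yW] := boolP (y \in W).
  - by rewrite (jin _ (mask (bd W) w) x) // (jin _ (mask (bd W) w) y) //; exact: h.
  - have yB : y \in bd W by apply: (bd_adj xW yW); rewrite xy.
    have := h x y xy; rewrite (jin _ w x) // ![join_config _ _ y]join_out // /mask yB; exact.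
  - have xB : x \in bd W by apply: (bd_adj yW xW); rewrite xy orbT.
    have := h x y xy; rewrite (jin _ w y) // ![join_config _ _ x]join_out // /mask xB; exact.
  - by rewrite !join_out //; exact: fw.
rewrite /hard_core_kernel eqf /partition_function.
by under eq_bigl do rewrite eqf.
Qed.

Section Version.
Variables (W : {fset V}) (z : {ffun W -> bool}).

(** The kernel itself vanishes when the configuration is infeasible anywhere off [W], so it sees
    infinitely many sites. The masked kernel does not, and the two agree on feasible
    configurations. *)
Definition version (w : config V) : R := hard_core_kernel adj lam z (mask (bd W) w).

Definition outside : set V := [set v | v \notin W].

Lemma depends_version (S : set R) : depends (enum_fset (bd W)) (version @^-1` S).
Proof.
move=> w w' ww; rewrite /= /version; suff -> : mask (bd W) w = mask (bd W) w' by [].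
by apply/funext => v; rewrite /mask; case: (boolP (v \in bd W)) => // /ww ->.
Qed.

Lemma measurable_version : measurable_fun setT version.
Proof. by move=> _ S mS; rewrite setTI; exact: measurable_config (@depends_version S). Qed.

Lemma depends_restricts : depends (enum_fset W) (restricts_to z).
Proof. by move=> w w' ww h v; rewrite -ww ?fsvalP. Qed.

Lemma sigma_on_measurable (S : set V) (A : set (config V)) : sigma_on S A -> measurable A.
Proof. by apply: sub_sigma_algebra2 => _ [v _ <-]; exists v. Qed.

Lemma integrable_version : mu.-integrable setT (EFin \o version).
Proof.
apply: measurable_bounded_integrable => //.
- by apply: le_lt_trans (probability_le1 mu _) _; rewrite ?ltry.
- exact: measurable_version.

exists 1; split => // M M1 w _; have /andP[h0 h1] := kernel_bounds z (mask (bd W) w).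
by rewrite /= ger0_norm // (le_trans h1) // ltW.
Qed.

Definition boundary_event (eta : V -> bool) : set (config V) :=
  [set w | forall v, v \in bd W -> w v = eta v].

(** Intersected with the boundary event, both sides are finite measures in [A]. They agree by
    [mu_kernel] on the events that depend on finitely many sites outside [W], which are closed under
    intersection and generate. *)
Lemma version_on_cell eta (A : set (config V)) : sigma_on outside A ->
  A `<=` boundary_event eta ->
  mu (restricts_to z `&` A) = ((hard_core_kernel adj lam z (mask (bd W) eta))%:E * mu A)%E.
Proof.
move=> sA AC; set k := hard_core_kernel _ _ _ _.
have k0 : 0 <= k by have /andP[] := kernel_bounds z (mask (bd W) eta).
pose kn : {nonneg R} := NngNum k0.
have dC : depends (enum_fset (bd W)) (boundary_event eta).
  by move=> w w' ww h v vB; rewrite -ww // h.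
have mC := measurable_config dC; have mE := measurable_config (@depends_restricts).
have mEC : measurable (restricts_to z `&` boundary_event eta) by exact: measurableI.
pose G : set (set (config V)) := [set A | exists2 l, depends l A & forall v, v \in l -> v \notin W].
have sGA : <<s G >> A.
  apply: sub_sigma_algebra2 sA => _ [v vW <-]; exists [:: v] => [w w'|v']; last by rewrite inE => /eqP ->.
  by move=> /(_ v); rewrite inE eqxx => /(_ isT) /= ->.
have -> : restricts_to z `&` A = A `&` (restricts_to z `&` boundary_event eta).
  by rewrite setICA; congr (_ `&` _); apply/esym/setIidl.
have AE : A = A `&` boundary_event eta by apply/esym/setIidl.
rewrite {2}AE.
have := @g_sigma_algebra_measure_unique _ R (config V) G _ (fun=> setT) _ _
  (mrestr mu mEC) (mscale kn (mrestr mu mC)) _ _ _ A sGA.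
rewrite /mscale /mrestr /=; apply.
- by move=> X [l dX _]; exact: measurable_config dX.
- by move=> _; exists [::] => // w w' _.
- by rewrite bigcup_const //; exists 0%N.
- move=> X Y [l dX lW] [l' dY lW']; exists (l ++ l').
    apply: dependsI; [apply: depends_sub dX|apply: depends_sub dY] => v;
      by rewrite mem_cat => ->; rewrite ?orbT.
  by move=> v; rewrite mem_cat => /orP[/lW|/lW'].
- move=> X [l dX lW]; rewrite /mscale /mrestr /= setICA.
  rewrite (@mu_kernel W z eta (l ++ enum_fset (bd W)) (X `&` boundary_event eta)) //.
  + apply: dependsI; [apply: depends_sub dX|apply: depends_sub dC] => v;
      by rewrite mem_cat => ->; rewrite ?orbT.
  + by move=> v; rewrite mem_cat => /orP[/lW|/bd_out].
  + by move=> w [_].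
- by move=> _; rewrite /mrestr setTI; apply: le_lt_trans (probability_le1 _ _) _; rewrite ?ltry.
Qed.

Lemma version_integral (A : set (config V)) : sigma_on outside A ->
  mu (restricts_to z `&` A) = (\int[mu]_(x in A) (version x)%:E)%E.
Proof.
move=> sA.
(* [l] lists the boundary sites whose values may vary on [A]; splitting [A] by the value at one of
   them shortens it, and for empty [l] the version is constant on [A]. *)
suff main (l : seq V) : forall (eta : V -> bool) A, sigma_on outside A ->
    (forall w, A w -> forall v, v \in bd W -> v \notin l -> w v = eta v) ->
    mu (restricts_to z `&` A) = (\int[mu]_(x in A) (version x)%:E)%E.
  by apply: (main (enum_fset (bd W)) pred0) => // w _ v vB; rewrite vB.
elim: l => [|v l IH] eta {sA A} A sA hA.
  have AC : A `<=` boundary_event eta by move=> w Aw u uB; exact: hA.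
  rewrite (version_on_cell sA AC).
  rewrite (eq_integral (fun=> (hard_core_kernel adj lam z (mask (bd W) eta))%:E)).
    by rewrite integral_cst //; exact: sigma_on_measurable sA.
  move=> w; rewrite inE => Aw; congr (_%:E); rewrite /version; congr hard_core_kernel.
  by apply/funext => u; rewrite /mask; case: (boolP (u \in bd W)) => // /(AC _ Aw) ->.
have [vB|vB] := boolP (v \in bd W); last first.
  apply: (IH eta) => // w Aw u uB ul; apply: hA => //; rewrite inE negb_or ul andbT.
  by apply: contra vB => /eqP <-.
pose Ev : set (config V) := [set w : V -> bool | w v].
have sEv : sigma_on outside Ev.
  by apply: sub_sigma_algebra; exists v => //; exact: bd_out.
have s1 : sigma_on outside (A `&` Ev).
  exact: (@measurableI _ (g_sigma_algebraType (cylinders outside)) _ _ sA sEv).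
have s2 : sigma_on outside (A `&` ~` Ev).
  apply: (@measurableI _ (g_sigma_algebraType (cylinders outside)) _ _ sA).
  exact: (@measurableC _ (g_sigma_algebraType (cylinders outside)) _ sEv).
pose upd b u := if u == v then b else eta u.
have AE : A = (A `&` Ev) `|` (A `&` ~` Ev) by rewrite -setIUr setUv setIT.
have dis : (A `&` Ev) `&` (A `&` ~` Ev) = set0 by rewrite setIACA setICr setI0.
have mE := measurable_config (@depends_restricts).
rewrite {1 2}AE setIUr measureU; first last.
- by rewrite setIACA dis setI0.
- by apply: measurableI => //; exact: sigma_on_measurable s2.
- by apply: measurableI => //; exact: sigma_on_measurable s1.
rewrite integral_setU.
- congr (_ + _)%E; [apply: (IH (upd true)) => //|apply: (IH (upd false)) => //];
    move=> w [Aw wv] u uB ul; rewrite /upd; have [->|uv] := eqVneq u v => //;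
    try (by apply: hA => //; rewrite inE negb_or uv).
  by apply/negbTE/negP.
- exact: sigma_on_measurable s1.
- exact: sigma_on_measurable s2.
- rewrite -AE; apply/measurable_EFinP; exact: measurable_funTS measurable_version.
- exact/disj_set2P.
Qed.

Lemma cond_prob : cond_prob_version mu (sigma_on outside) (restricts_to z) version.
Proof.
split; [move=> S _| exact: integrable_version| exact: version_integral].
apply: depends_measurable (@depends_version S) _ => v; exact: bd_out.
Qed.

(** Feasibility is a countable conjunction over coded pairs of sites, each failing on a null set by
    [mu_adj]. *)
Lemma version_ae : {ae mu, forall w, version w = hard_core_kernel adj lam z w}.
Proof.
pose ok (n : nat) (w : V -> bool) := forall x y : V, choice.unpickle n = Some (x, y) -> adj x y -> ~~ (w x && w y).
have h : {ae mu, forall w, forall n, ok n w}.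
  apply: ae_foralln => n; rewrite /ok; case: (choice.unpickle n) => [[x y]|]; last by apply: aeW.
  have [xy|xy] := boolP (adj x y); last first.
    by apply: aeW => w x' y' [<- <-]; rewrite (negPf xy).
  exists [set w : V -> bool | w x /\ w y]; split; [|exact: mu_adj|].
    apply: (@measurable_config _ [:: x; y]) => w w' ww /=.
    by rewrite !ww ?inE ?eqxx ?orbT.
  by move=> w /= hw; apply: contrapT => nw; apply: hw => _ _ [<- <-] _; apply/negP => /andP.
case: h => N [mN N0 hN]; exists N; split => // w hw; apply: hN => /= okw; apply: hw.
apply: kernel_mask => x y xy; apply: (okw (choice.pickle (x, y))) => //; exact: (@choice.pickleK (V * V)%type).
Qed.

End Version.

Lemma dlr : hard_core_measure adj lam mu.
Proof. by move=> W z; exists (version z); [exact: cond_prob|exact: version_ae]. Qed.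

End DLR.

(** * Limit measures and the occupation of a single site *)

Section Gibbs.
Local Open Scope classical_set_scope.
Variables (R : realType) (d : nat).
Local Notation V := 'rV[int]_d.
Local Notation D := ('I_d * bool)%type.
Variable par : pred V.
Hypothesis par_stp : forall x s, par (x + stp s) = ~~ par x.
Variable lam : R.
Hypothesis lam0 : 0 < lam.

Lemma limit_measure : exists mu : probability (config V) R,
  [/\ hard_core_measure (@Zd_adj d) lam mu,
    forall l A a n0, depends l A ->
      (forall n, (n0 <= n)%N -> fin_law par lam (box d n) A <= a) -> (mu A <= a%:E)%E &
    forall l A a n0, depends l A ->
      (forall n, (n0 <= n)%N -> a <= fin_law par lam (box d n) A) -> (a%:E <= mu A)%E].
Proof.
have P01 n A : 0 <= fin_law par lam (box d n) A <= 1 by rewrite fin_law_ge0 ?fin_law_le1.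
have [m [mlin mub mlb]] := ultralimit P01.
have m_ge0 A : 0 <= m A by apply: (mlb A 0 0%N) => n _; have /andP[] := P01 n A.
have mT : m setT = 1.
  by apply/eqP; rewrite eq_le (mub _ _ 0%N) ?(mlb _ _ 0%N) // => n _; rewrite fin_lawT.
have mU A B : A `&` B = set0 -> m (A `|` B) = m A + m B.
  move=> AB; rewrite (mlin A B (A `|` B) 1 1 0%N) ?mul1r // => n _.
  by rewrite !mul1r fin_lawU.
have [mu muE] := law_exists m_ge0 mT mU.
exists mu; split=> [|l A a n0 dA h|l A a n0 dA h].
- apply: (@dlr R V (@Zd_adj d) lam lam0 mu (fun W => Nb W `\` W)%fset).
  + by move=> W v; rewrite in_fsetD => /andP[].
  + move=> W x y xW yW xy; rewrite in_fsetD yW /=.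
    case/orP: xy => /zd_adjP[s e]; first by rewrite e mem_Nb.
    by rewrite -[y](addrK (stp s)) -e -stpN mem_Nb.
  + move=> W z eta l A dA lW hA.
    have dEA : depends (enum_fset W ++ l) (restricts_to z `&` A).
      apply: dependsI; last by apply: depends_sub dA => v; rewrite mem_cat => ->; rewrite orbT.
      apply: (depends_sub (l := enum_fset W)) => [v|w w' ww h v]; first by rewrite mem_cat => ->.
      by rewrite -ww ?fsvalP.
    rewrite (muE _ _ dEA) (muE _ _ dA) -EFinM; congr (_%:E).
    have [n0 hn0] := box_exhaust W.
    rewrite (mlin A A _ (hard_core_kernel (@Zd_adj d) lam z (mask (Nb W `\` W)%fset eta)) 0 n0).
      by rewrite mul0r addr0.
    move=> n /hn0 Wn; rewrite mul0r addr0.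
    apply: (fin_law_kernel par lam0 Wn (B := (Nb W `\` W)%fset)).
    * by move=> x s xW; rewrite in_fsetU in_fsetD mem_Nb // andbT orbN.
    * by move=> w w' ww; apply: dA => v /lW; exact: ww.
    * by move=> w /hA h v vB _; exact: h.
  + move=> x y /zd_adjP[s ->].
    have dxy : depends [:: x; (x + stp s)%R] [set w : V -> bool | w x /\ w (x + stp s)].
      by move=> w w' ww /=; rewrite !ww ?inE ?eqxx ?orbT.
    rewrite (muE _ _ dxy); congr (_%:E).
    by apply/eqP; rewrite eq_le m_ge0 (mub _ _ 0%N) // => n _; rewrite fin_law_adj.
- by rewrite (muE _ _ dA) lee_fin; exact: mub h.
- by rewrite (muE _ _ dA) lee_fin; exact: mlb h.
Qed.

Variable Lam : {fset V}.
Local Notation P := (fin_law par lam Lam).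

Definition free (v : V) : set (V -> bool) := [set w : V -> bool | forall s, ~~ w (v + stp s)].

Lemma stp_neq0 (s : D) : stp s != 0.
Proof.
apply/eqP => /rowP /(_ s.1); rewrite stp_coord eqxx mxE => /eqP.
by rewrite signr_eq0.
Qed.

(** The case of a single site in [mass_restrict]: with vacant neighbours both values at [v] are
    feasible, with weights [lam] and 1. *)
Lemma law_flip v : v \in Lam ->
  P ([set w : V -> bool | w v] `&` free v) = lam * P ([set w : V -> bool | ~~ w v] `&` free v).
Proof.
move=> vL; pose W : {fset V} := [fset v]%fset.
pose z b : {ffun W -> bool} := [ffun _ => b].
have WL : (W `<=` Lam)%fset by rewrite fsub1set.
have WB x s : x \in W -> (x + stp s)%R \in (W `|` Nb W)%fset.
  by move=> xW; rewrite in_fsetU mem_Nb // orbT.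
have nv s : (v + stp s)%R \notin W.
  by rewrite in_fset1 -subr_eq0 addrAC subrr add0r stp_neq0.
have AW (w w' : V -> bool) : (forall u, u \notin W -> w u = w' u) -> free v w -> free v w'.
  by move=> ww h s; rewrite -ww.
have AB (w : V -> bool) : free v w -> forall u, u \in Nb W -> u \notin W -> w u = (fun=> false) u.
  move=> h u; rewrite in_Nb => /existsP[s]; rewrite in_fset1 => /eqP e _.
  by apply/negbTE; have := h (opp s); rewrite -e stpN addrK.
have H b := mass_restrict par lam WL WB AW AB (z b).
have sup b : supp (z b) = if b then W else fset0.
  apply/fsetP => u; have [uW|uW] := boolP (u \in W).
    by rewrite -(join_in _ pred0 uW) /join_config insubT ffunE; case: b; rewrite ?uW ?in_fset0.
  have /negbTE -> : u \notin supp (z b) by apply: contra uW; apply/fsubsetP/supp_sub.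
  by case: b; rewrite ?(negPf uW) ?in_fset0.
have E b : restricts_to (z b) = [set w : V -> bool | w v = b].
  have vW : v \in W by rewrite in_fset1.
  have supv : (v \in supp (z b)) = b by rewrite sup; case: b; rewrite ?vW ?in_fset0.
  apply/seteqP; split => w /=; first by move=> /restricts_toP /(_ v vW) ->.
  by move=> wv; apply/restricts_toP => u; rewrite in_fset1 => /eqP ->; rewrite wv supv.
have feas b : `[< feasible (@Zd_adj d) (join_config (z b) (mask (Nb W) (fun=> false))) >].
  apply/asboolP/feasibleP => x s.
  have out u : u \notin W -> join_config (z b) (mask (Nb W) (fun=> false)) u = false.
    by move=> uW; rewrite join_out // /mask andbF.
  have [xW|xW] := boolP (x \in W); last by rewrite out.
  rewrite [in X in _ && X]out ?andbF //; move: xW; rewrite in_fset1 => /eqP ->; exact: nv.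
have E1 : [set w : V -> bool | w v] = restricts_to (z true) by rewrite E.
have E0 : [set w : V -> bool | ~~ w v] = restricts_to (z false).
  by rewrite E; apply/seteqP; split => w /=; [move/negbTE|move=> ->].
rewrite E1 E0 /fin_law !H !feas !weight_supp !sup cardfs0 cardfs1 expr1 expr0 mul1r.
by rewrite mulrCA.
Qed.

Lemma law_free (v : V) : 1 - \sum_(s : D) P [set w : V -> bool | w (v + stp s)] <= P (free v).
Proof.
rewrite lerBlDr /fin_law -mulr_sumr -mulrDr -[leLHS](@mulVf _ (Zsum par Lam lam)); last first.
  by rewrite gt_eqF ?Z_pos.
rewrite ler_pM2l ?invr_gt0 ?Z_pos // -massT /mass.
under [X in _ <= _ + X]eq_bigr do rewrite big_mkcond.
rewrite exchange_big /= big_mkcond [X in _ <= X + _]big_mkcond -big_split /=.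
apply: ler_sum => I _; case: (boolP `[< admissible par Lam I >]) => aI /=; last first.
  by rewrite big1 ?addr0.
have w0 := ltW (wt_pos lam0 I); rewrite (asboolT Logic.I).
have [h|h] := boolP `[< free v (occ par Lam I) >].
  by rewrite lerDl sumr_ge0 // => s _; case: ifP.
move/asboolPn: h => /existsNP[s /negP/negPn ws].
by rewrite add0r (bigD1 s) //= asboolT // lerDl sumr_ge0 // => t _; case: ifP.
Qed.

End Gibbs.

Section NonUnique.
Local Open Scope classical_set_scope.
Variables (R : realType) (d : nat).
Local Notation V := 'rV[int]_d.
Local Notation D := ('I_d * bool)%type.
Variables (r : nat) (lam mu K0 : R).
Hypotheses (r0 : (0 < r)%N) (rd : (r * r <= d)%N) (d5 : (5 <= d)%N).
Local Notation L := (ln (d%:R : R)).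
Hypothesis L1 : 1 <= L.
Hypotheses (lam0 : 0 < lam) (mu0 : 0 < mu) (mu1 : mu <= 1) (mulam : mu <= lam).
Hypotheses (K0pos : 0 < K0) (hK0 : 16 * 4005 <= K0).
Hypothesis Hmu : K0 * L ^+ 3 <= mu ^+ 2 * r%:R.

Lemma law_odd (par : pred V) u n :
  (forall x s, par (x + stp s) = ~~ par x) -> ~~ par u ->
  fin_law par lam (box d n) [set w : V -> bool | w u] <= (d%:R ^+ 2)^-1.
Proof.
move=> ps pu; rewrite /fin_law mulrC ler_pdivrMr ?Z_pos //.
have [uL|uL] := boolP (u \in box d n); last first.
  rewrite /mass big1 ?mulr_ge0 ?invr_ge0 ?exprn_ge0 ?(ltW (Z_pos ps lam0 _)) //.
  by move=> I /andP[_ /asboolP /=]; rewrite /occ (negPf uL) (negPf pu).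
apply: le_trans (peierls ps r0 rd d5 L1 lam0 mu0 mu1 mulam K0pos hK0 Hmu n pu).
rewrite /mass /bad big_filter big_seq_cond [leRHS]big_seq_cond.
rewrite big_mkcond [leRHS]big_mkcond; apply: ler_sum => I _.
case: (I \in _) => //=; case: `[< admissible _ _ _ >] => //=.
have -> : `[< [set w : V -> bool | w u] (occ par (box d n) I) >] = (u \in I).
  by apply/asboolP/idP; rewrite /= /occ uL.
by [].
Qed.

(** [b] is the value at the origin, so [parity true] is the boundary condition favouring the
    sublattice of the origin. *)
Definition parity (b : bool) : pred V := fun x => b (+) odd (absz (\sum_(i < d) x 0 i)).

Lemma parity_stp b x s : parity b (x + stp s) = ~~ parity b x.
Proof.
rewrite /parity -addbN; congr (_ (+) _).
have -> : \sum_(i < d) (x + stp s) 0 i = \sum_(i < d) x 0 i + (-1) ^+ s.2.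
  rewrite (bigD1 s.1) //= [X in _ = X + _](bigD1 s.1) //= mxE stp_coord eqxx addrAC.
  by congr (_ + _ + _); apply: eq_bigr => i ne; rewrite mxE stp_coord (negPf ne) addr0.
have h (a : int) c : (absz (a + (-1) ^+ nat_of_bool c)%R = (absz a).+1)%N \/
    (absz a = (absz (a + (-1) ^+ nat_of_bool c)%R).+1)%N.
  by clear; case: c; rewrite ?expr1 ?expr0; lia.
by case: (h (\sum_(i < d) x 0 i) s.2) => -> /=; rewrite ?negbK.
Qed.

Theorem not_unique : ~ unique_hard_core_measure (@Zd_adj d) lam.
Proof.
move=> [nu hnu nuq].
pose Occ : set (config V) := [set w : V -> bool | w 0].
have dO : depends [:: 0] Occ by move=> w w' ww /=; rewrite /Occ /= ww ?inE.
have mO := measurable_config dO.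
have e0 : 0 <= (d%:R ^+ 2)^-1 :> R by rewrite invr_ge0 exprn_ge0.
have up : (nu Occ <= ((d%:R ^+ 2)^-1)%:E)%E.
  have [m [hm ub _]] := limit_measure (parity_stp false) lam0.
  rewrite -(nuq m hm _ mO); apply: (ub _ _ _ 0%N dO) => n _.
  apply: (law_odd (par := parity false)); first exact: parity_stp.
  by rewrite /parity big1 // => i _; rewrite mxE.
(* For [parity true] the [2 * d] neighbours of the origin are odd, each occupied with probability at
   most d^-2; so all are vacant with probability at least 1 - 2 / d, and given this the origin is
   occupied with probability lam / (1 + lam). *)
pose q := lam / (1 + lam) * (1 - 2 / d%:R).
have lo : (q%:E <= nu Occ)%E.
  have [m [hm _ lb]] := limit_measure (parity_stp true) lam0.
  have [n0 hn0] := box_exhaust [fset (0 : V)]%fset.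
  rewrite -(nuq m hm _ mO); apply: (lb _ _ _ n0 dO) => n /hn0; rewrite fsub1set => L0.
  have ps := parity_stp true.
  have hf := law_flip (parity true) lam L0.
  have hF := law_free ps lam0 (box d n) 0.
  set P := fin_law _ _ _ in hf hF *.
  have hs : \sum_(s : D) P [set w : V -> bool | w (0 + stp s)] <= 2 / d%:R.
    apply: (@le_trans _ _ (\sum_(s : D) (d%:R ^+ 2)^-1)).
      apply: ler_sum => s _; apply: law_odd => //; rewrite ps negbK.
      by rewrite /parity big1 // => i _; rewrite mxE.
    rewrite sumr_const card_dir -[X in X <= _]mulr_natr natrM.
    have d0 : d%:R != 0 :> R by rewrite pnatr_eq0 -lt0n (leq_trans _ d5).
    by rewrite (_ : (d%:R ^+ 2)^-1 * (2 * d%:R) = 2 / d%:R) //; field.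
  have free_split : P (free 0) = P ([set w : V -> bool | w 0] `&` free 0) +
      P ([set w : V -> bool | ~~ w 0] `&` free 0).
    rewrite -fin_lawU.
      congr P; rewrite -setIUl; apply/esym/setIidr => w _ /=.
      by case: (w 0); [left|right].
    by apply/seteqP; split => // w [[/= h _] [/= /negP h' _]].
  have le1 : P ([set w : V -> bool | w 0] `&` free 0) <= P Occ.
    rewrite /P /fin_law ler_pM2l ?invr_gt0 ?Z_pos //; apply: mass_le => //.
  apply: le_trans le1; rewrite hf; set x := P (_ `&` _).
  have hx : 1 - 2 / d%:R <= (1 + lam) * x.
    have : 1 - 2 / d%:R <= P (free 0) by lra.
    by rewrite free_split hf -/x (_ : (1 + lam) * x = lam * x + x) //; ring.
  have l1 : 0 < 1 + lam by rewrite addr_gt0.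
  by rewrite /q -mulrA ler_pM2l // mulrC ler_pdivrMr // [leRHS]mulrC.
have : q <= (d%:R ^+ 2)^-1 by rewrite -lee_fin (le_trans lo).
apply/negP; rewrite -ltNge /q.
have d5R : 5 <= d%:R :> R by rewrite (ler_nat _ 5 d).
have d0 : 0 < d%:R :> R by lra.
(* From mu^2 r <= mu d, the hypothesis [Hmu] also bounds [lam * d] below by 4. Hence lam / (1 + lam)
   >= 2 / d, and 3 / 5 of this still exceeds 1 / d. *)
have mud : 4 <= mu * d%:R.
  apply: (@le_trans _ _ (K0 * L ^+ 3)).
    have L3 : 1 <= L ^+ 3 by rewrite exprn_ege1.
    have K4 : 4 <= K0.
      by apply: le_trans hK0; rewrite -[4]mulr1; apply: ler_pM; rewrite ?ler01 ?ler0n ?ler1n ?ler_nat.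
    by rewrite -[4]mulr1; apply: ler_pM; rewrite ?L3 ?K4.
  apply: (le_trans Hmu); rewrite expr2 -mulrA ler_pM2l //.
  apply: (@le_trans _ _ r%:R); first by rewrite ler_piMl.
  by rewrite ler_nat (leq_trans _ rd) // leq_pmulr.
have lamd : mu * d%:R <= lam * d%:R by rewrite ler_pM2r.
have lamd5 : lam * 5 <= lam * d%:R by rewrite ler_pM2l.
have h1 : 2 / d%:R <= lam / (1 + lam).
  have l1 : 0 < 1 + lam by rewrite addr_gt0.
  by rewrite ler_pdivlMr // mulrAC ler_pdivrMr //; lra.
have h2 : 3 / 5 <= 1 - 2 / d%:R :> R.
  suff : 2 / d%:R <= 2 / 5 :> R by lra.
  by rewrite ler_pM2l // lef_pV2 ?posrE.
have h3 : (d%:R ^+ 2)^-1 <= d%:R^-1 :> R.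
  by rewrite lef_pV2 ?posrE ?exprn_gt0 // expr2 ler_peMr //; lra.
have i0 : 0 < d%:R^-1 :> R by rewrite invr_gt0.
apply: (le_lt_trans h3); apply: (@lt_le_trans _ _ (2 / d%:R * (3 / 5))); first by lra.
by apply: ler_pM => //; lra.
Qed.

End NonUnique.

(** * The critical activity *)

Lemma floor_sqrt d : exists r, (r * r <= d < r.+1 * r.+1)%N.
Proof.
elim: d => [|d [r /andP[h1 h2]]]; first by exists 0%N.
have [h|h] := leqP (r.+1 * r.+1) d.+1; last by exists r; rewrite h (leq_trans h1).
by exists r.+1; rewrite h /=; nia.
Qed.

Section ScaleChoice.
Variable R : realType.
Variables (K0 lam : R) (d : nat).
Local Notation L := (ln (d%:R : R)).
Hypotheses (K128 : 128 <= K0) (hL : 2 * K0 <= L) (d5 : (5 <= d)%N).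
Hypothesis hlam : d%:R `^ (- (1 / 4)) * L ^+ 2 < lam.

(** [mu] is the minimum of [lam] and 1. For x = d^(-1/4), the bound 4 r^2 >= d gives 2 r x^2 >= 1,
    so lam > x L^2 yields 2 lam^2 r >= L^4 >= 2 K0 L^3: the spare factor [L] absorbs [K0]. *)
Lemma scale_choice : exists r mu, [/\ (0 < r)%N, (r * r <= d)%N, 0 < mu /\ mu <= 1, mu <= lam &
  K0 * L ^+ 3 <= mu ^+ 2 * r%:R].
Proof.
have [r /andP[r1 r2]] := floor_sqrt d.
have r0 : (0 < r)%N by rewrite lt0n; apply/eqP => e; move: r2; rewrite e; lia.
have d0 : 0 < d%:R :> R by rewrite ltr0n; lia.
have R0 : 0 < r%:R :> R by rewrite ltr0n.
have dr : d%:R <= (2 * r%:R) ^+ 2 :> R.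
  by rewrite -natrM -natrX ler_nat; apply: (leq_trans (ltnW r2)); rewrite -mulnn leq_mul //; lia.
have L256 : 256 <= L by apply: le_trans hL; rewrite (_ : 256 = 2 * 128) ?ler_pM2l // -natrM.
have L0 : 0 < L by rewrite (lt_le_trans _ L256) ?ltr0n.
pose x : R := d%:R `^ (- (1 / 4)).
have x0 : 0 < x by rewrite powR_gt0.
have x4 : x ^+ 4 * d%:R = 1.
  rewrite -powR_mulrn ?ltW // /x -powRrM.
  have -> : - (1 / 4) * 4%:R = -1 :> R by field.
  by rewrite powR_inv1 ?ltW // mulVf // gt_eqF.
have xr : 1 <= x ^+ 2 * (2 * r%:R).
  rewrite -(@ler_pXn2r _ 2) ?nnegrE ?mulr_ge0 ?exprn_ge0 ?(ltW x0) ?(ltW R0) //.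
  by rewrite expr1n exprMn -exprM -[leLHS]x4 ler_pM2l ?exprn_gt0.
have L4 : 2 * (K0 * L ^+ 3) <= L ^+ 4.
  by rewrite mulrA [leRHS]exprS ler_pM2r ?exprn_gt0.
have lam0 : 0 < lam by apply: lt_trans hlam; rewrite mulr_gt0 ?exprn_gt0.
have [lam1|lam1] := leP lam 1.
  exists r, lam; split => //.
  have h : x ^+ 2 * L ^+ 4 <= lam ^+ 2.
    rewrite -[4%N]/(2 * 2)%N exprM -exprMn ler_pXn2r ?nnegrE ?(ltW lam0) ?(ltW hlam) //.
    by rewrite mulr_ge0 ?exprn_ge0 ?(ltW x0) ?(ltW L0).
  rewrite -(@ler_pM2l _ 2) //; apply: (le_trans L4).
  apply: (@le_trans _ _ (x ^+ 2 * (2 * r%:R) * L ^+ 4)); first by rewrite ler_peMl ?exprn_ge0 ?(ltW L0).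
  have -> : x ^+ 2 * (2 * r%:R) * L ^+ 4 = 2 * (x ^+ 2 * L ^+ 4 * r%:R) by ring.
  by rewrite ler_pM2l // ler_pM2r.
exists r, 1; split => //; first exact: ltW.
rewrite expr1n mul1r -(@ler_pM2l _ 2) //; apply: (le_trans L4).
rewrite -(@ler_pXn2r _ 2) ?nnegrE ?exprn_ge0 ?mulr_ge0 ?(ltW L0) ?(ltW R0) //.
apply: le_trans dr.
(* For lam > 1 it remains to see L^4 <= 2 r, which follows from L^8 <= d: indeed d = exp (L / 16)^16
   >= (L / 16)^16 = (L / 256)^8 L^8, and L >= 256 because [K0] is at least 128. *)
have dE : d%:R = expR (L / 16) ^+ 16 :> R.
  rewrite -expRM_natl (_ : 16%:R * (L / 16) = L); last by field.
  by rewrite lnK // posrE.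
rewrite [leRHS]dE; apply: (@le_trans _ _ ((L / 16) ^+ 16)); last first.
  rewrite ler_pXn2r ?nnegrE ?expR_ge0 ?divr_ge0 ?(ltW L0) //.
  by apply: le_trans (expR_ge1Dx _); rewrite lerDr.
have -> : (L / 16) ^+ 16 = (L / 256) ^+ 8 * (L ^+ 4) ^+ 2 by field.
by rewrite ler_peMl ?exprn_ge0 ?(ltW L0) // exprn_ege1 // ler_pdivlMr ?ltr0n // mul1r.
Qed.

End ScaleChoice.

Theorem theorem1p2 (R : realType) :
  exists (d0 : nat) (C : R), forall d : nat, (d0 <= d)%N ->
    (critical_activity R d <=
       (C * d%:R `^ (- (1 / 4)) * (ln d%:R) ^+ 2)%:E)%E.
Proof.
have [K0 [K128 hK0]] : exists K0 : R, 128 <= K0 /\ 16 * 4005 <= K0.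
  exists (16 * 4005); split => //; rewrite (_ : 128 = 16 * 8); last by rewrite -natrM.
  by rewrite ler_pM2l // ler_nat.
(* The second bound on [d] makes log d at least [2 * K0]; the 5 is for the count of words in
   [cover_list]. *)
exists (maxn 5 (Num.bound (expR (2 * K0)))), 1 => d; rewrite geq_max => /andP[d5 hd].
have hL : 2 * K0 <= ln d%:R.
  rewrite -ler_expR lnK ?posrE ?ltr0n ?(leq_trans _ d5) //.
  apply/ltW/(lt_le_trans (archi_boundP (expR_ge0 _))); by rewrite ler_nat.
rewrite mul1r; apply: ge_ereal_sup => _ [lam [lam0 uniq_lam] <-].
rewrite lee_fin leNgt; apply/negP => hlam.
have [r [mu [r0 rd [mu0 mu1] mulam hmu]]] := scale_choice K128 hL d5 hlam.
apply: (not_unique r0 rd d5 _ lam0 mu0 mu1 mulam _ hK0 hmu uniq_lam); lra.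
Qed.
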